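(* Let $V$ be a vertex operator algebra, let $\mathcal{C}_0$ be an essentially small full subcategory of the category $\mathcal{B}$ of generalized $V$-modules, and let $\mathcal{C}$ be the full subcategory of $\mathcal{B}$ whose objects are the generalized $V$-modules that are unions of submodules which are objects of $\mathcal{C}_0$. Assume also that: (1) $\mathcal{C}_0$ is closed under finite coproducts and arbitrary quotients. (2) $\mathcal{C}_0$ admits the vertex algebraic braided monoidal structure of Huang--Lepowsky--Zhang, so that in particular $V$ is the unit object of $\mathcal{C}_0$ and the tensor product functor of $\mathcal{C}_0$ is given by tensor products relative to $\mathcal{C}_0$. (3) For any intertwining operator $\mathcal{Y}$ of type $\binom{M_3}{M_1\,M_2}$ where $M_1,M_2$ are objects of $\mathcal{C}_0$ and $M_3$ is an object of $\mathcal{C}$, the image of $\mathcal{Y}$ is contained in a $V$-submodule of $M_3$ which is an object of $\mathcal{C}_0$. (4) All objects of $\mathcal{C}_0$ are finitely generated as generalized $V$-modules. Then $\mathcal{C}$ is additive and cocomplete and admits the vertex algebraic braided monoidal structure of Huang--Lepowsky--Zhang. Furthermore, the inclusion $\mathcal{C}_0\hookrightarrow\mathcal{C}$ is braided monoidal, and the tensor product $\boxtimes:\mathcal{C}\times\mathcal{C}\to\mathcal{C}$ is cocontinuous in each factor.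
   Context: Everything is over $\mathbb{C}$. $V=\bigoplus_{n\in\mathbb{Z}}V_{(n)}$ is graded by $L_0$-eigenvalues. A generalized $V$-module is a module $(M,Y_M)$ for $V$ as a vertex algebra, $Y_M(v,x)=\sum_{n\in\mathbb{Z}}v_n x^{-n-1}$, that is the direct sum $M=\bigoplus_{h\in\mathbb{C}}M_{[h]}$ of its generalized eigenspaces for the Virasoro operator $L_0$, with no restriction on $\dim M_{[h]}$. $\mathcal{B}$ is the (abelian, cocomplete) category of generalized $V$-modules and $V$-module maps. Cocomplete means having all small colimits; cocontinuous means commuting with small colimits. Formal series: $M[\log x]\{x\}$ is the space of formal sums $\sum_{h\in\mathbb{C}}p_h(\log x)x^{h}$ with $p_h\in M[\log x]$. Intertwining operators: for generalized $V$-modules $M_1,M_2,M_3$, an intertwining operator of type $\binom{M_3}{M_1\,M_2}$ is a linear map $\mathcal{Y}:M_1\otimes_{\mathbb{C}}M_2\to M_3[\log x]\{x\}$, $m_1\otimes m_2\mapsto\mathcal{Y}(m_1,x)m_2=\sum_{h\in\mathbb{C}}\sum_{k\ge0}(m_1)^{\mathcal{Y}}_{h;k}m_2\,x^{-h-1}(\log x)^k$, such that: (i) for all $m_1,m_2,h$, $(m_1)^{\mathcal{Y}}_{h+n;k}m_2=0$ for $n\in\mathbb{Z}_{\ge0}$ sufficiently large, independently of $k$; (ii) for all $v\in V$, $m_1\in M_1$, $$x_0^{-1}\delta\Big(\tfrac{x_1-x_2}{x_0}\Big)Y_{M_3}(v,x_1)\mathcal{Y}(m_1,x_2)-x_0^{-1}\delta\Big(\tfrac{x_2-x_1}{-x_0}\Big)\mathcal{Y}(m_1,x_2)Y_{M_2}(v,x_1)=x_2^{-1}\delta\Big(\tfrac{x_1-x_0}{x_2}\Big)\mathcal{Y}(Y_{M_1}(v,x_0)m_1,x_2),$$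 where $\delta(x)=\sum_{n\in\mathbb{Z}}x^n$; (iii) $\mathcal{Y}(L_{-1}m_1,x)=\frac{d}{dx}\mathcal{Y}(m_1,x)$. The image of $\mathcal{Y}$ is the span in $M_3$ of all the coefficients $(m_1)^{\mathcal{Y}}_{h;k}m_2$. Tensor products: for a full subcategory $\mathcal{D}\subseteq\mathcal{B}$ and objects $M_1,M_2$ of $\mathcal{D}$, a tensor product relative to $\mathcal{D}$ is a pair $(M_1\boxtimes M_2,\mathcal{Y}_{M_1,M_2})$ with $M_1\boxtimes M_2$ an object of $\mathcal{D}$ and $\mathcal{Y}_{M_1,M_2}$ an intertwining operator of type $\binom{M_1\boxtimes M_2}{M_1\,M_2}$, such that for every object $M_3$ of $\mathcal{D}$ and intertwining operator $\mathcal{Y}$ of type $\binom{M_3}{M_1\,M_2}$ there is a unique $V$-module map $f:M_1\boxtimes M_2\to M_3$ with $f\circ\mathcal{Y}_{M_1,M_2}=\mathcal{Y}$. If tensor products exist for all pairs, $\boxtimes$ is a functor, with $f_1\boxtimes f_2$ determined by $(f_1\boxtimes f_2)(\mathcal{Y}_{M_1,M_2}(m_1,x)m_2)=\mathcal{Y}_{N_1,N_2}(f_1(m_1),x)f_2(m_2)$. Vertex algebraic braided monoidal structure of Huang--Lepowsky--Zhang: a full subcategory $\mathcal{D}\subseteq\mathcal{B}$ admits it if $V$ is an object of $\mathcal{D}$, tensor products relative to $\mathcal{D}$ exist for all pairs of objects, and $\mathcal{D}$ is a braided monoidal category with tensor product functor $\boxtimes$, unit object $V$, and natural isomorphisms characterized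 as follows. - Left unit $l_W:V\boxtimes W\to W$: $l_W(\mathcal{Y}_{V,W}(v,x)w)=Y_W(v,x)w$. - Right unit $r_W:W\boxtimes V\to W$: $r_W(\mathcal{Y}_{W,V}(w,x)v)=e^{xL_{-1}}Y_W(v,-x)w$. - Braiding $\mathcal{R}_{W_1,W_2}:W_1\boxtimes W_2\to W_2\boxtimes W_1$: $\mathcal{R}_{W_1,W_2}(\mathcal{Y}_{W_1,W_2}(w_1,x)w_2)=e^{xL_{-1}}\mathcal{Y}_{W_2,W_1}(w_2,e^{\pi i}x)w_1$ (substituting $x^h\mapsto e^{\pi i h}x^h$, $\log x\mapsto\log x+\pi i$). - Associativity $\mathcal{A}_{W_1,W_2,W_3}:W_1\boxtimes(W_2\boxtimes W_3)\to(W_1\boxtimes W_2)\boxtimes W_3$: for all real $r_1>r_2>r_1-r_2>0$ and $w_i\in W_i$, $$\overline{\mathcal{A}_{W_1,W_2,W_3}}\big(\mathcal{Y}_{W_1,W_2\boxtimes W_3}(w_1,r_1)\mathcal{Y}_{W_2,W_3}(w_2,r_2)w_3\big)=\mathcal{Y}_{W_1\boxtimes W_2,W_3}\big(\mathcal{Y}_{W_1,W_2}(w_1,r_1-r_2)w_2,r_2\big)w_3.$$ Here, for real $r>0$, one substitutes $x^h=e^{h\ln r}$, $\log x=\ln r$; $\overline{W}=\prod_{h}W_{[h]}$ is the algebraic completion and $\overline{\mathcal{A}}$ the natural extension of $\mathcal{A}$; and it is part of the requirement that both sides converge absolutely to elements of the completion, i.e. the sums over $h\in\mathbb{C}$ obtained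 by inserting the projections $P_h$ to the generalized $L_0$-eigenspaces of the intermediate module ($W_2\boxtimes W_3$, resp. $W_1\boxtimes W_2$) converge absolutely after pairing with any element of $\bigoplus_h (W_{[h]})^*$, where $W$ is the target module. *)

(* Defs.v *)
From HB Require Import structures.
From mathcomp Require Import all_boot all_order all_algebra finmap.
From mathcomp Require Import complex.
From mathcomp Require Import mathcomp_extra boolp classical_sets functions.
From mathcomp Require Import cardinality fsbigop reals ereal topology normedtype.
From mathcomp Require Import sequences esum exp trigo.

Set Implicit Arguments.
Unset Strict Implicit.
Unset Printing Implicit Defensive.

Import Order.TTheory GRing.Theory Num.Theory.

Local Open Scope classical_set_scope.
Local Open Scope ring_scope.

(** * Categories *)

(* The universe of small types is the universe of the carriers of modules:
   [carrier_small] and [power_small] force the two to coincide. *)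
Definition small := Type.

Definition carrier_small (K : nzRingType) (M : lmodType K) : small := M.

Definition power_small (K : nzRingType) (M : lmodType K) (I : small) :
  lmodType K := (I -> M)%type.

Definition small_type (T : Type) : Prop :=
  exists (I : small) (g : I -> T), forall t, exists i, g i = t.

Record category := Category {
  ob :> Type;
  hom : ob -> ob -> Type;
  idm : forall a, hom a a;
  comp : forall a b c, hom b c -> hom a b -> hom a c;
  compA : forall a b c d (f : hom c d) (g : hom b c) (h : hom a b),
    comp f (comp g h) = comp (comp f g) h;
  comp1m : forall a b (f : hom a b), comp (idm b) f = f;
  compm1 : forall a b (f : hom a b), comp f (idm a) = f }.

Arguments hom {_} a b.
Arguments idm {_} a.
Arguments comp {_ a b c} f g : rename.
Notation "g \c f" := (comp g f) (at level 50, left associativity).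

Definition is_inv (C : category) (a b : C) (f : hom a b) (g : hom b a) : Prop :=
  g \c f = idm a /\ f \c g = idm b.

Definition is_iso (C : category) (a b : C) (f : hom a b) : Prop :=
  exists g, is_inv f g.

Definition ess_small (C : category) : Prop :=
  (forall a b : C, small_type (hom a b)) /\
  exists (I : small) (F : I -> C),
    forall a, exists (i : I) (f : hom a (F i)), is_iso f.

Record functor (C D : category) := Functor {
  fob :> C -> D;
  fmor : forall a b, hom a b -> hom (fob a) (fob b);
  fmor1 : forall a, fmor (idm a) = idm (fob a);
  fmorM : forall a b c (f : hom b c) (g : hom a b),
    fmor (f \c g) = fmor f \c fmor g }.

Definition is_cocone (J C : category) (F : functor J C) (L : C)
    (i : forall j, hom (F j) L) : Prop :=
  forall j k (u : hom j k), i k \c fmor F u = i j.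

Definition is_colimit (J C : category) (F : functor J C) (L : C)
    (i : forall j, hom (F j) L) : Prop :=
  is_cocone i /\
  forall (L' : C) (i' : forall j, hom (F j) L'), is_cocone i' ->
    exists! f : hom L L', forall j, f \c i j = i' j.

Definition small_category (J : category) : Prop :=
  small_type J /\ forall a b : J, small_type (hom a b).

Definition cocomplete (C : category) : Prop :=
  forall J : category, small_category J -> forall F : functor J C,
    exists (L : C) (i : forall j, hom (F j) L), is_colimit i.

Definition comp_functor (J C D : category) (G : functor C D) (F : functor J C) :
  functor J D.
Proof.
exists (fun j => G (F j)) (fun a b u => fmor G (fmor F u)).
- by move=> a; rewrite !fmor1.
- by move=> a b c f g; rewrite !fmorM.
Defined.

Definition cocontinuous (C D : category) (G : functor C D) : Prop :=
  forall J : category, small_category J -> forall (F : functor J C) (L : C)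
    (i : forall j, hom (F j) L), is_colimit i ->
  @is_colimit J D (comp_functor G F) (G L) (fun j => fmor G (i j)).

Definition is_coproduct (C : category) (n : nat) (F : 'I_n -> C) (L : C)
    (i : forall j, hom (F j) L) : Prop :=
  forall (L' : C) (i' : forall j, hom (F j) L'),
    exists! f : hom L L', forall j, f \c i j = i' j.

Record preadditive (C : category) := Preadditive {
  hadd : forall a b : C, hom a b -> hom a b -> hom a b;
  hzero : forall a b : C, hom a b;
  hopp : forall a b : C, hom a b -> hom a b;
  haddA : forall a b (f g h : hom a b), hadd f (hadd g h) = hadd (hadd f g) h;
  haddC : forall a b (f g : hom a b), hadd f g = hadd g f;
  hadd0 : forall a b (f : hom a b), hadd (hzero a b) f = f;
  haddN : forall a b (f : hom a b), hadd (hopp f) f = hzero a b;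
  compDl : forall a b c (f f' : hom b c) (g : hom a b),
    hadd f f' \c g = hadd (f \c g) (f' \c g);
  compDr : forall a b c (f : hom b c) (g g' : hom a b),
    f \c hadd g g' = hadd (f \c g) (f \c g') }.

Definition is_zero_object (C : category) (z : C) : Prop :=
  forall a : C, (exists! f : hom z a, True) /\ (exists! f : hom a z, True).

Definition is_biproduct (C : category) (A : preadditive C) (a b p : C)
    (i1 : hom a p) (i2 : hom b p) (p1 : hom p a) (p2 : hom p b) : Prop :=
  [/\ p1 \c i1 = idm a, p2 \c i2 = idm b,
      p1 \c i2 = hzero A b a, p2 \c i1 = hzero A a b &
      hadd A (i1 \c p1) (i2 \c p2) = idm p].

Definition additive_category (C : category) : Prop :=
  exists A : preadditive C,
    (exists z : C, is_zero_object z) /\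
    forall a b : C, exists (p : C) (i1 : hom a p) (i2 : hom b p)
      (p1 : hom p a) (p2 : hom p b), is_biproduct A i1 i2 p1 p2.

(* Braided monoidal structure with prescribed unit object and tensor product of
   objects; the associativity goes from a(bc) to (ab)c. *)
Record braided_monoidal (C : category) (I : C) (T : C -> C -> C) :=
  BraidedMonoidal {
  tmor : forall a a' b b', hom a a' -> hom b b' -> hom (T a b) (T a' b');
  tmor1 : forall a b, tmor (idm a) (idm b) = idm (T a b);
  tmorM : forall a a' a'' b b' b'' (f' : hom a' a'') (f : hom a a')
    (g' : hom b' b'') (g : hom b b'),
    tmor (f' \c f) (g' \c g) = tmor f' g' \c tmor f g;
  lunit : forall a, hom (T I a) a;
  runit : forall a, hom (T a I) a;
  braid : forall a b, hom (T a b) (T b a);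
  assoc : forall a b c, hom (T a (T b c)) (T (T a b) c);
  assocV : forall a b c, hom (T (T a b) c) (T a (T b c));
  lunit_iso : forall a, is_iso (lunit a);
  runit_iso : forall a, is_iso (runit a);
  braid_iso : forall a b, is_iso (braid a b);
  assoc_inv : forall a b c, is_inv (assoc a b c) (assocV a b c);
  lunit_nat : forall a b (f : hom a b),
    lunit b \c tmor (idm I) f = f \c lunit a;
  runit_nat : forall a b (f : hom a b),
    runit b \c tmor f (idm I) = f \c runit a;
  braid_nat : forall a a' b b' (f : hom a a') (g : hom b b'),
    braid a' b' \c tmor f g = tmor g f \c braid a b;
  assoc_nat : forall a a' b b' c c'
    (f : hom a a') (g : hom b b') (h : hom c c'),
    assoc a' b' c' \c tmor f (tmor g h) = tmor (tmor f g) h \c assoc a b c;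
  pentagon : forall a b c d,
    assoc (T a b) c d \c assoc a b (T c d) =
    tmor (assoc a b c) (idm d) \c assoc a (T b c) d
      \c tmor (idm a) (assoc b c d);
  triangle : forall a b,
    tmor (runit a) (idm b) \c assoc a I b = tmor (idm a) (lunit b);
  hexagon1 : forall a b c,
    assoc c a b \c braid (T a b) c \c assoc a b c =
    tmor (braid a c) (idm b) \c assoc a c b \c tmor (idm a) (braid b c);
  hexagon2 : forall a b c,
    assocV b c a \c braid a (T b c) \c assocV a b c =
    tmor (idm b) (braid a c) \c assocV b a c \c tmor (braid a b) (idm c) }.

Arguments tmor {C I T} _ {a a' b b'} f g.

Definition ltensor (C : category) (I : C) (T : C -> C -> C)
  (B : braided_monoidal I T) (w : C) : functor C C.
Proof.
exists (fun a => T w a) (fun a b f => tmor B (idm w) f).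
- by move=> a; rewrite tmor1.
- by move=> a b c f g; rewrite -tmorM comp1m.
Defined.

Definition rtensor (C : category) (I : C) (T : C -> C -> C)
  (B : braided_monoidal I T) (w : C) : functor C C.
Proof.
exists (fun a => T a w) (fun a b f => tmor B f (idm w)).
- by move=> a; rewrite tmor1.
- by move=> a b c f g; rewrite -tmorM comp1m.
Defined.

Definition braided_monoidal_functor (C D : category)
    (I : C) (T : C -> C -> C) (B : braided_monoidal I T)
    (I' : D) (T' : D -> D -> D) (B' : braided_monoidal I' T')
    (F : functor C D) : Prop :=
  exists (phi : hom I' (F I)) (J : forall a b, hom (T' (F a) (F b)) (F (T a b))),
    is_iso phi /\ (forall a b, is_iso (J a b)) /\
    [/\ forall a a' b b' (f : hom a a') (g : hom b b'),
          J a' b' \c tmor B' (fmor F f) (fmor F g) =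
          fmor F (tmor B f g) \c J a b,
        forall a b c,
          fmor F (assoc B a b c) \c J a (T b c)
            \c tmor B' (idm (F a)) (J b c) =
          J (T a b) c \c tmor B' (J a b) (idm (F c))
            \c assoc B' (F a) (F b) (F c),
        forall a,
          fmor F (lunit B a) \c J I a \c tmor B' phi (idm (F a)) =
          lunit B' (F a),
        forall a,
          fmor F (runit B a) \c J a I \c tmor B' (idm (F a)) phi =
          runit B' (F a) &
        forall a b,
          fmor F (braid B a b) \c J a b = J b a \c braid B' (F a) (F b)].

(** * Vertex operator algebras and generalized modules *)

(* [bincoef n i] is the coefficient of a^(n-i) b^i in (a - b)^n, expanded in
   nonnegative powers of b. *)
Definition bincoef (K : fieldType) (n : int) (i : nat) : K :=
  (-1) ^+ i * ((\prod_(j < i) (n%:~R - j%:R)) / i`!%:R).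

(* The coefficient of x0^(-l-1) x1^(-m-1) x2^(-h-1) in the Jacobi identity, with
   the delta functions expanded as
     x0^-1 delta((x1 - x2)/x0) = \sum_l x0^(-l-1) (x1 - x2)^l,
     x0^-1 delta((x2 - x1)/(-x0)) = \sum_l (-1)^l x0^(-l-1) (x2 - x1)^l,
     x2^-1 delta((x1 - x0)/x2) = \sum_n x2^(-n-1) (x1 - x0)^n.
   Here [act v n] is v_n and [Y m1 h m2] is (m1)_h m2.  The sums have finite
   support when all products are lower truncated. *)
Definition jacobi (K : fieldType) (Ix : pzRingType) (V M1 M2 M3 : lmodType K)
    (act1 : V -> int -> M1 -> M1) (act2 : V -> int -> M2 -> M2)
    (act3 : V -> int -> M3 -> M3) (Y : M1 -> Ix -> M2 -> M3) : Prop :=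
  forall (v : V) (m1 : M1) (m2 : M2) (l m : int) (h : Ix),
    \sum_(i \in [set: nat])
      bincoef K l i *: act3 v (m + l - i%:Z) (Y m1 (h + i%:R) m2)
    - \sum_(i \in [set: nat])
      ((-1) ^ l * bincoef K l i) *: Y m1 (h + l%:~R - i%:R) (act2 v (m + i%:Z) m2)
    = \sum_(i \in [set: nat])
      bincoef K (i%:Z - m - 1) i *: Y (act1 v (l + i%:Z) m1) (h + m%:~R - i%:R) m2.

Record voa (R : realType) := Voa {
  voa_sort :> lmodType R[i];
  vact : voa_sort -> int -> voa_sort -> voa_sort;
  vac : voa_sort;
  conf : voa_sort;
  central_charge : R[i];
  vact_linl : forall n w, linear (fun v => vact v n w);
  vact_linr : forall v n, linear (vact v n);
  vact_trunc : forall v w, exists N : int, forall n, N <= n -> vact v n w = 0;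
  vac_act : forall n w, vact vac n w = if n == -1 then w else 0;
  creation : forall v,
    vact v (-1) vac = v /\ forall n : int, 0 <= n -> vact v n vac = 0;
  vact_jacobi : jacobi vact vact vact vact;
  virasoro : forall (m n : int) v,
    vact conf (m + 1) (vact conf (n + 1) v)
    - vact conf (n + 1) (vact conf (m + 1) v) =
    (m - n)%:~R *: vact conf (m + n + 1) v
    + (if m + n == 0 then (m ^+ 3 - m)%:~R / 12%:R * central_charge else 0) *: v;
  vact_deriv : forall v n w,
    vact (vact conf 0 v) n w = - n%:~R *: vact v (n - 1) w;
  vwt : int -> set voa_sort := fun n => [set v | vact conf 1 v = n%:~R *: v];
  vac_wt : vwt 0 vac;
  conf_wt : vwt 2 conf;
  (* the sum of the V_(n) is automatically direct *)
  voa_graded : forall v, exists s : seq voa_sort,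
    (forall u, u \in s -> exists n, vwt n u) /\ v = \sum_(u <- s) u;
  voa_wt_fin : forall n, exists s : seq voa_sort,
    forall v, vwt n v -> exists c : nat -> R[i],
      v = \sum_(i < size s) c i *: nth 0 s i;
  voa_wt_low : exists N : int, forall n, n < N -> forall v, vwt n v -> v = 0 }.

Definition gen_eigen (K : nzRingType) (M : lmodType K) (L0 : M -> M) (h : K) :
  set M := [set m | exists n : nat, iter n (fun x => L0 x - h *: x) m = 0].

Record gmod (R : realType) (V : voa R) := Gmod {
  gmod_sort :> lmodType R[i];
  act : V -> int -> gmod_sort -> gmod_sort;
  act_linl : forall n m, linear (fun v => act v n m);
  act_linr : forall v n, linear (act v n);
  act_trunc : forall v m, exists N : int, forall n, N <= n -> act v n m = 0;
  act_vac : forall n m, act (vac V) n m = if n == -1 then m else 0;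
  act_jacobi : jacobi (@vact R V) act act act;
  (* the sum of the generalized eigenspaces is automatically direct *)
  gmod_graded : forall m, exists s : seq gmod_sort,
    (forall x, x \in s -> exists h, gen_eigen (act (conf V) 1) h x) /\
    m = \sum_(x <- s) x }.

Arguments act {R V g} v n m.

Definition vir (R : realType) (V : voa R) (M : gmod V) (n : int) : M -> M :=
  act (conf V) (n + 1).
Arguments vir {R V} M n m.

Definition wt_space (R : realType) (V : voa R) (M : gmod V) (h : R[i]) : set M :=
  gen_eigen (vir M 0) h.

Definition wt_proj (R : realType) (V : voa R) (M : gmod V) (h : R[i]) (m : M) :
  M :=
  xget 0 [set y | wt_space h y /\ exists s : seq M,
    (forall x, x \in s -> exists2 g, g != h & wt_space g x) /\
    m = y + \sum_(x <- s) x].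

Lemma voa_gmod_graded (R : realType) (V : voa R) (v : V) :
  exists s : seq V,
    (forall x, x \in s -> exists h, gen_eigen (vact (conf V) 1) h x) /\
    v = \sum_(x <- s) x.
Proof.
have [s [sP ->]] := voa_graded v; exists s; split => // x /sP[n xn].
by exists n%:~R, 1%N; rewrite /= [X in X - _]xn subrr.
Qed.

Definition voa_gmod (R : realType) (V : voa R) : gmod V :=
  @Gmod R V V (@vact R V) (@vact_linl R V) (@vact_linr R V) (@vact_trunc R V)
    (@vac_act R V) (@vact_jacobi R V) (@voa_gmod_graded R V).

Record vhom (R : realType) (V : voa R) (M N : gmod V) := Vhom {
  vhom_fun :> M -> N;
  vhom_linear : linear vhom_fun;
  vhom_act : forall v n m, vhom_fun (act v n m) = act v n (vhom_fun m) }.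

Lemma vhomP (R : realType) (V : voa R) (M N : gmod V) (f g : vhom M N) :
  f =1 g -> f = g.
Proof.
case: f g => [f lf af] [g lg ag] /= /funext fg; rewrite -{}fg in lg ag *.
by rewrite (Prop_irrelevance lf lg) (Prop_irrelevance af ag).
Qed.

Definition vhom_id (R : realType) (V : voa R) (M : gmod V) : vhom M M.
Proof. by exists id. Defined.

Definition vhom_comp (R : realType) (V : voa R) (M N P : gmod V)
  (f : vhom N P) (g : vhom M N) : vhom M P.
Proof.
exists (fun m => f (g m)).
- by move=> c x y; rewrite (vhom_linear g) (vhom_linear f).
- by move=> v n m; rewrite !vhom_act.
Defined.

(* [gmod_cat V] is the category B, and [full_sub P] the full subcategory of B on
   the objects satisfying [P]. *)
Definition gmod_cat (R : realType) (V : voa R) : category.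
Proof.
exists (gmod V) (@vhom R V) (@vhom_id R V) (@vhom_comp R V).
- by move=> *; apply: vhomP.
- by move=> *; apply: vhomP.
- by move=> *; apply: vhomP.
Defined.

Record subob (R : realType) (V : voa R) (P : gmod V -> Prop) := Subob {
  subob_gmod :> gmod V;
  subobP : P subob_gmod }.

Definition full_sub (R : realType) (V : voa R) (P : gmod V -> Prop) : category.
Proof.
exists (subob P) (fun A B : subob P => vhom A B)
  (fun A => vhom_id A) (fun A B C => @vhom_comp R V A B C).
- by move=> *; apply: vhomP.
- by move=> *; apply: vhomP.
- by move=> *; apply: vhomP.
Defined.

Definition full_sub_incl (R : realType) (V : voa R) (P Q : gmod V -> Prop)
  (PQ : forall M, P M -> Q M) : functor (full_sub P) (full_sub Q).
Proof.
by exists (fun A : subob P => Subob (PQ A (subobP A)))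
  (fun (A B : subob P) (f : vhom A B) => f).
Defined.

(** * Submodules *)

Definition subspace (K : nzRingType) (M : lmodType K) (U : set M) : Prop :=
  U 0 /\ forall c x y, U x -> U y -> U (c *: x + y).

Definition submodule (R : realType) (V : voa R) (M : gmod V) (U : set M) : Prop :=
  subspace U /\ forall v n m, U m -> U (act v n m).

Definition finitely_generated (R : realType) (V : voa R) (M : gmod V) : Prop :=
  exists s : seq M, smallest (@submodule R V M) [set` s] = [set: M].

(* The submodule [U] is, as a module, an object of the subcategory [D]: it is
   the image of an injective map from an object of [D]. *)
Definition submodule_in (R : realType) (V : voa R) (D : gmod V -> Prop)
    (M : gmod V) (U : set M) : Prop :=
  submodule U /\
  exists N : gmod V, D N /\ exists f : vhom N M, injective f /\ range f = U.

Definition union_closure (R : realType) (V : voa R) (D : gmod V -> Prop)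
    (M : gmod V) : Prop :=
  exists F : set (set M),
    (forall U, F U -> submodule_in D U) /\ \bigcup_(U in F) U = [set: M].

Lemma sub_union_closure (R : realType) (V : voa R) (D : gmod V -> Prop) M :
  D M -> union_closure D M.
Proof.
move=> DM; exists [set setT]; split; last by rewrite bigcup_set1.
move=> _ ->; split; first by [].
exists M; split=> //; exists (vhom_id M); split; first by [].
by apply/seteqP; split => // x _; exists x.
Qed.

Definition closed_fin_coproducts (R : realType) (V : voa R)
    (D : gmod V -> Prop) : Prop :=
  forall (n : nat) (F : 'I_n -> gmod_cat V) (L : gmod_cat V)
    (i : forall j, hom (F j) L),
    (forall j, D (F j)) -> is_coproduct i -> D L.

Definition closed_quotients (R : realType) (V : voa R)
    (D : gmod V -> Prop) : Prop :=
  forall (M N : gmod V) (f : vhom M N), set_surj setT setT f -> D M -> D N.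

(** * Formal series and intertwining operators *)

(* [s : fser M] is the formal sum of the s e k x^e (log x)^k. *)
Definition fser (R : realType) (M : lmodType R[i]) := R[i] -> nat -> M.

Definition cexp (R : realType) (z : R[i]) : R[i] :=
  ((expR (complex.Re z))%:C * (cos (complex.Im z) +i* sin (complex.Im z)))%C.

Definition fser_deriv (R : realType) (M : lmodType R[i]) (s : fser M) : fser M :=
  fun e k => (e + 1) *: s (e + 1) k + k.+1%:R *: s (e + 1) k.+1.

(* \sum_n f n x^n *)
Definition fser_int (R : realType) (M : lmodType R[i]) (f : int -> M) : fser M :=
  fun e k => if k == 0%N then \sum_(n \in [set n : int | n%:~R = e]) f n else 0.

(* s(e^(pi i) x), with x^e replaced by e^(pi i e) x^e and log x by
   log x + pi i *)
Definition fser_rot (R : realType) (M : lmodType R[i]) (s : fser M) : fser M :=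
  let pii : R[i] := Complex 0 pi in
  fun e k => \sum_(j \in [set j | (k <= j)%N])
    (cexp (pii * e) * 'C(j, k)%:R * pii ^+ (j - k)) *: s e j.

(* e^(x L_{-1}) s(x) *)
Definition fser_exp_xL (R : realType) (V : voa R) (M : gmod V) (s : fser M) :
  fser M :=
  fun e k => \sum_(j \in [set: nat])
    (j`!%:R)^-1 *: iter j (vir M (-1)) (s (e - j%:R) k).

(* Y_M(v, x) m *)
Definition mod_series (R : realType) (V : voa R) (M : gmod V) (v : V) (m : M) :
  fser M :=
  fser_int (fun n => act v (- n - 1) m).

(* Y_M(v, -x) m *)
Definition mod_series_neg (R : realType) (V : voa R) (M : gmod V) (v : V)
    (m : M) : fser M :=
  fser_int (fun n => (-1) ^ n *: act v (- n - 1) m).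

(* [coef Y k m1 h m2] is (m1)_{h;k} m2. *)
Definition coef (R : realType) (M1 M2 M3 : lmodType R[i])
    (Y : M1 -> M2 -> fser M3) (k : nat) (m1 : M1) (h : R[i]) (m2 : M2) : M3 :=
  Y m1 m2 (- h - 1) k.

Record intertwining (R : realType) (V : voa R) (M1 M2 M3 : gmod V) :=
  Intertwining {
  itw_fun :> M1 -> M2 -> fser M3;
  itw_linl : forall m2 e k, linear (fun m1 => itw_fun m1 m2 e k);
  itw_linr : forall m1 e k, linear (fun m2 => itw_fun m1 m2 e k);
  itw_poly : forall m1 m2 e, exists K : nat,
    forall k, (K <= k)%N -> itw_fun m1 m2 e k = 0;
  itw_trunc : forall m1 m2 h, exists N : nat,
    forall n k, (N <= n)%N -> coef itw_fun k m1 (h + n%:R) m2 = 0;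
  itw_jacobi : forall k, jacobi (@act R V M1) (@act R V M2) (@act R V M3)
    (coef itw_fun k);
  itw_deriv : forall m1 m2,
    itw_fun (vir M1 (-1) m1) m2 = fser_deriv (itw_fun m1 m2) }.

Definition itw_image (R : realType) (V : voa R) (M1 M2 M3 : gmod V)
    (Y : intertwining M1 M2 M3) : set M3 :=
  smallest (@subspace R[i] M3) [set x | exists k m1 h m2, x = coef Y k m1 h m2].

Definition is_tensor_product (R : realType) (V : voa R) (D : gmod V -> Prop)
    (M1 M2 T : gmod V) (Y : intertwining M1 M2 T) : Prop :=
  forall M3 : gmod V, D M3 -> forall Y3 : intertwining M1 M2 M3,
    exists! f : vhom T M3, forall m1 m2 e k, f (Y m1 m2 e k) = Y3 m1 m2 e k.

(** * Convergence *)

(* The unordered sum of the f h converges absolutely, to s. *)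
Definition abs_sum (R : realType) (T : choiceType) (f : T -> R[i]) (s : R[i]) :
  Prop :=
  summable [set: T] (fun h => (complex.Re `|f h|)%:E) /\
  forall eps : R, 0 < eps -> exists F0 : {fset T}, forall F : {fset T},
    (F0 `<=` F)%fset -> complex.Re `|\sum_(h <- F) f h - s| < eps.

(* An element of the algebraic completion, given by its components. *)
Definition in_completion (R : realType) (V : voa R) (M : gmod V)
    (z : R[i] -> M) : Prop :=
  forall h, wt_space h (z h).

(* The elements of the direct sum of the (M_[h])^*, as linear functionals on M
   vanishing on all but finitely many M_[h]. *)
Definition in_graded_dual (R : realType) (V : voa R) (M : gmod V)
    (phi : M -> R[i]) : Prop :=
  scalar phi /\
  exists s : seq R[i], forall h m, h \notin s -> wt_space h m -> phi m = 0.

Definition pairing (R : realType) (V : voa R) (M : gmod V) (phi : M -> R[i])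
    (z : R[i] -> M) : R[i] :=
  \sum_(h \in [set: R[i]]) phi (z h).

Definition compl_sum (R : realType) (V : voa R) (M : gmod V)
    (u : R[i] -> R[i] -> M) (z : R[i] -> M) : Prop :=
  in_completion z /\
  forall phi, in_graded_dual phi ->
    abs_sum (fun h => pairing phi (u h)) (pairing phi z).

(* s(r) in the completion of M, for r > 0: the component of weight h is the sum
   of the P_h(s e k) r^e (ln r)^k, which has finite support when
   s = Y(m1, x) m2 for an intertwining operator Y. *)
Definition fser_eval (R : realType) (V : voa R) (M : gmod V) (s : fser M)
    (r : R) : R[i] -> M :=
  fun h => \sum_(p \in [set: R[i] * nat])
    (cexp (p.1 * (ln r)%:C%C) * (ln r)%:C%C ^+ p.2) *: wt_proj h (s p.1 p.2).

Definition itw_product (R : realType) (V : voa R) (M1 M2 M3 P W : gmod V)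
    (Y1 : intertwining M1 P W) (Y2 : intertwining M2 M3 P)
    (m1 : M1) (m2 : M2) (m3 : M3) (r1 r2 : R) (h : R[i]) : R[i] -> W :=
  fser_eval (Y1 m1 (fser_eval (Y2 m2 m3) r2 h)) r1.

Definition itw_iterate (R : realType) (V : voa R) (M1 M2 M3 P W : gmod V)
    (Y1 : intertwining P M3 W) (Y2 : intertwining M1 M2 P)
    (m1 : M1) (m2 : M2) (m3 : M3) (r0 r2 : R) (h : R[i]) : R[i] -> W :=
  fser_eval (Y1 (fser_eval (Y2 m1 m2) r0 h) m3) r2.

(** * The vertex algebraic braided monoidal structure *)

Record hlz_structure (R : realType) (V : voa R) (D : gmod V -> Prop) := Hlz {
  hlz_V : D (voa_gmod V);
  hlz_unit : full_sub D := Subob hlz_V;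
  hlz_tens : full_sub D -> full_sub D -> full_sub D;
  hlz_Y : forall A B : subob D, intertwining A B (hlz_tens A B : subob D);
  hlz_univ : forall A B, is_tensor_product D (hlz_Y A B);
  hlz_bm : braided_monoidal hlz_unit hlz_tens;
  hlz_tmorE : forall (A A' B B' : subob D) (f : vhom A A') (g : vhom B B')
    (a : A) (b : B) e k,
    (@tmor (full_sub D) _ _ hlz_bm A A' B B' f g : vhom _ _) (hlz_Y A B a b e k)
    = hlz_Y A' B' (f a) (g b) e k;
  hlz_lunitE : forall (A : subob D) (v : V) (a : A) e k,
    (lunit hlz_bm A : vhom _ _) (hlz_Y (Subob hlz_V) A v a e k)
    = mod_series v a e k;
  hlz_runitE : forall (A : subob D) (v : V) (a : A) e k,
    (runit hlz_bm A : vhom _ _) (hlz_Y A (Subob hlz_V) a v e k)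
    = fser_exp_xL (mod_series_neg v a) e k;
  hlz_braidE : forall (A B : subob D) (a : A) (b : B) e k,
    (braid hlz_bm A B : vhom _ _) (hlz_Y A B a b e k)
    = fser_exp_xL (fser_rot (hlz_Y B A b a)) e k;
  hlz_assocE : forall (A B C : subob D) (a : A) (b : B) (c : C) (r1 r2 : R),
    r2 < r1 -> r1 - r2 < r2 -> 0 < r1 - r2 ->
    exists z1 z2,
      [/\ compl_sum (itw_product (hlz_Y A (hlz_tens B C)) (hlz_Y B C)
            a b c r1 r2) z1,
          compl_sum (itw_iterate (hlz_Y (hlz_tens A B) C) (hlz_Y A B)
            a b c (r1 - r2) r2) z2 &
          forall h, (assoc hlz_bm A B C : vhom _ _) (z1 h) = z2 h] }.

(* Main.v *)
From HB Require Import structures.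
From mathcomp Require Import all_boot all_order all_algebra finmap.
From mathcomp Require Import generic_quotient complex ring.
From mathcomp Require Import mathcomp_extra boolp classical_sets functions.
From mathcomp Require Import cardinality fsbigop reals exp trigo.
Require Import Defs.

(* Every object of the closure C of C0 under unions is, already as a vector
   space, the colimit of its submodules in C0.  The tensor product of A and B is
   the colimit of the tensor products of their submodules in C0: a natural
   family of intertwining operators glues to one on the colimits, because bilinear
   maps on two colimits are compatible families of bilinear maps, and
   hypothesis (3) makes the tensor product of C0 universal for targets in C as
   well.  The unit, braiding and associativity isomorphisms of C are glued from
   those of C0, and two maps out of an iterated tensor product in C are equal
   when they agree on the images of the iterated tensor products of objects of
   C0, so all coherence laws reduce to those of C0.  Convergence is transported
   along module maps: the coefficients of an intertwining operator are
   homogeneous for the generalized L_0-grading, hence evaluation at a real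
   number is a finite sum in each weight.  Gluing along an arbitrary colimit
   gives cocontinuity. *)

Set Implicit Arguments.
Unset Strict Implicit.
Unset Printing Implicit Defensive.

Import Order.TTheory GRing.Theory Num.Theory.

Local Open Scope classical_set_scope.
Local Open Scope ring_scope.

(** * Linear maps and finitely supported sums *)

(** The obstacle is that the universal property of a colimit of modules says nothing about bilinear
    maps. Currying a bilinear map gives a linear map into a function space, which carries no action
    of [V]. Colimits are therefore handled through [lin_colimit], which is universal for linear maps
    into every vector space, and every small colimit in the closure is shown to be of this kind.
    Directedness matters only for seeing a module as the colimit of its submodules; gluing itself
    works over arbitrary diagrams. A second constraint is that a sum over an infinite support has
    the value 0 by convention. Linearity of such sums and their compatibility with maps thus hold
    only once lower truncation or homogeneity has made the supports finite. Finally, gluing data are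
    indexed by all maps from objects of [C0], not only by inclusions of submodules: compatibility is
    then plain naturality under precomposition, and images of submodules need not be tracked. *)

Definition linear_pack (K : nzRingType) (M N : lmodType K) (f : M -> N)
    (lf : linear f) : {linear M -> N} :=
  HB.pack f (GRing.isLinear.Build K M N *:%R f lf).

Section LinearMaps.
Variables (K : nzRingType) (M N : lmodType K) (f : M -> N).
Hypothesis lf : linear f.

Lemma lin0 : f 0 = 0. Proof. exact: (linear0 (linear_pack lf)). Qed.

Lemma linD x y : f (x + y) = f x + f y.
Proof. exact: (linearD (linear_pack lf)). Qed.

Lemma linB x y : f (x - y) = f x - f y.
Proof. exact: (linearB (linear_pack lf)). Qed.

Lemma linN x : f (- x) = - f x.
Proof. exact: (linearN (linear_pack lf)). Qed.

Lemma linZ c x : f (c *: x) = c *: f x.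
Proof. exact: (linearZ_LR (linear_pack lf)). Qed.

Lemma lin_sum (I : Type) (r : seq I) (P : pred I) (F : I -> M) :
  f (\sum_(i <- r | P i) F i) = \sum_(i <- r | P i) f (F i).
Proof. exact: (linear_sum (linear_pack lf)). Qed.

(** Finiteness is required before [f] is applied: an infinitely supported sum is 0 by convention,
    while [f] may kill enough terms to leave a finite nonzero sum on the right. *)
Lemma lin_fsum (T : choiceType) (A : set T) (F : T -> M) :
  finite_set (A `&` F @^-1` [set~ 0]) ->
  f (\sum_(i \in A) F i) = \sum_(i \in A) f (F i).
Proof.
move=> fin; rewrite fsbig_supp fsbig_finite// lin_sum -fsbig_finite//.
apply: fsbig_widen => [x []//|x [Ax] /= /not_andP[//|]].
by rewrite /preimage /= notK => ->; rewrite lin0.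
Qed.

End LinearMaps.

Lemma lin_surj_lift (K : nzRingType) (M Q N : lmodType K) (q : M -> Q)
    (f : M -> N) : linear q -> (forall y, exists x, q x = y) -> linear f ->
  (forall x, q x = 0 -> f x = 0) ->
  exists2 g : Q -> N, linear g & forall x, g (q x) = f x.
Proof.
move=> lq qsurj lf f0; pose g y := f (sval (cid (qsurj y))).
have gE x : g (q x) = f x.
  apply/eqP; rewrite -subr_eq0 -(linB lf); apply/eqP/f0.
  by rewrite (linB lq) (svalP (cid (qsurj _))) subrr.
exists g => // c y z; have [[x <-] [x' <-]] := conj (qsurj y) (qsurj z).
by rewrite -lq !gE lf.
Qed.

Lemma fsum_nat (M : nmodType) (F : nat -> M) n :
  (forall i, (n <= i)%N -> F i = 0) ->
  \sum_(i \in [set: nat]) F i = \sum_(i < n) F i.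
Proof.
move=> F0; rewrite fsbig_ord; apply/esym/fsbig_widen => // i [_ /= ni].
by apply: F0; rewrite leqNgt; apply/negP.
Qed.

Lemma finite_nat_support (M : nmodType) (F : nat -> M) n :
  (forall i, (n <= i)%N -> F i = 0) ->
  finite_set ([set: nat] `&` F @^-1` [set~ 0]).
Proof.
move=> F0; apply: (@sub_finite_set _ _ `I_n) => [i [_ /= Fi]|]; last exact: finite_II.
by rewrite ltnNge; apply/negP => /F0.
Qed.

(** * Jacobi identities *)

Section Jacobi.
Variables (K : fieldType) (Ix : pzRingType) (V M1 M2 M3 : lmodType K).
Variables (act1 : V -> int -> M1 -> M1) (act2 : V -> int -> M2 -> M2).
Variables (act3 : V -> int -> M3 -> M3) (Y : M1 -> Ix -> M2 -> M3).

(** The two sides of [jacobi] get names so that each can be studied as a function of its arguments.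
    [Ix] stays general to serve module actions, indexed by integers, and intertwining operators,
    indexed by complex numbers. *)
Definition jacobi_lhs v m1 m2 (l m : int) (h : Ix) : M3 :=
    \sum_(i \in [set: nat])
      bincoef K l i *: act3 v (m + l - i%:Z) (Y m1 (h + i%:R) m2)
    - \sum_(i \in [set: nat])
      ((-1) ^ l * bincoef K l i) *: Y m1 (h + l%:~R - i%:R) (act2 v (m + i%:Z) m2).

Definition jacobi_rhs v m1 m2 (l m : int) (h : Ix) : M3 :=
  \sum_(i \in [set: nat])
      bincoef K (i%:Z - m - 1) i *: Y (act1 v (l + i%:Z) m1) (h + m%:~R - i%:R) m2.

Definition trunc_act (M : lmodType K) (act : V -> int -> M -> M) :=
  forall v m, exists N : int, forall n, N <= n -> act v n m = 0.

Definition trunc_itw := forall m1 m2 h, exists N : nat,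
    forall n, (N <= n)%N -> Y m1 (h + n%:R) m2 = 0.

Hypotheses (lin1 : forall v n, linear (act1 v n)).
Hypotheses (lin2 : forall v n, linear (act2 v n)).
Hypotheses (lin3 : forall v n, linear (act3 v n)).
Hypothesis linYl : forall h m2, linear (fun m1 => Y m1 h m2).
Hypothesis linYr : forall m1 h, linear (Y m1 h).
Hypotheses (tr1 : trunc_act act1) (tr2 : trunc_act act2) (trY : trunc_itw).

Lemma trunc_actN (M : lmodType K) (act : V -> int -> M -> M) v m (n : int) :
  trunc_act act -> exists N : nat, forall i, (N <= i)%N -> act v (n + i%:Z) m = 0.
Proof.
move=> /(_ v m)[N NP]; exists `|N - n|%N => i Ni; apply: NP.
by rewrite -lerBlDl (le_trans (ler_norm _))// -abszE lez_nat.
Qed.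

Lemma jacobi_bound v m1 m2 (l m : int) (h : Ix) : exists N, forall i, (N <= i)%N ->
  [/\ Y m1 (h + i%:R) m2 = 0, act2 v (m + i%:Z) m2 = 0
    & act1 v (l + i%:Z) m1 = 0].
Proof.
have [N1 N1P] := trY m1 m2 h.
have [N2 N2P] := trunc_actN v m2 m tr2.
have [N3 N3P] := trunc_actN v m1 l tr1.
exists (maxn N1 (maxn N2 N3)) => i; rewrite !geq_max => /and3P[? ? ?].
by rewrite N1P// N2P// N3P.
Qed.

Definition jacobi_lhsn N v m1 m2 (l m : int) (h : Ix) : M3 :=
    \sum_(i < N) bincoef K l i *: act3 v (m + l - i%:Z) (Y m1 (h + i%:R) m2)
    - \sum_(i < N)
      ((-1) ^ l * bincoef K l i) *: Y m1 (h + l%:~R - i%:R) (act2 v (m + i%:Z) m2).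

Definition jacobi_rhsn N v m1 m2 (l m : int) (h : Ix) : M3 :=
  \sum_(i < N)
      bincoef K (i%:Z - m - 1) i *: Y (act1 v (l + i%:Z) m1) (h + m%:~R - i%:R) m2.

(** All large [N] are allowed so that the vectors [x], [y] and [c *: x + y] can share one cut-off;
    linearity of both sides is then that of finite sums. *)
Lemma jacobi_fin v m1 m2 (l m : int) (h : Ix) : exists N0, forall N, (N0 <= N)%N ->
  jacobi_lhs v m1 m2 l m h = jacobi_lhsn N v m1 m2 l m h /\
  jacobi_rhs v m1 m2 l m h = jacobi_rhsn N v m1 m2 l m h.
Proof.
have [N0 N0P] := jacobi_bound v m1 m2 l m h; exists N0 => N NN.
have {}N0P i : (N <= i)%N -> _ := fun Ni => N0P i (leq_trans NN Ni).
rewrite /jacobi_lhs /jacobi_rhs !(@fsum_nat _ _ N)//.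
- by move=> i /N0P[_ _ ->]; rewrite (lin0 (linYl _ _)) scaler0.
- by move=> i /N0P[_ -> _]; rewrite (lin0 (linYr _ _)) scaler0.
- by move=> i /N0P[-> _ _]; rewrite (lin0 (lin3 _ _)) scaler0.
Qed.

Lemma jacobi_lhs_linr v m1 l m h : linear (fun m2 => jacobi_lhs v m1 m2 l m h).
Proof.
move=> c x y; have [N1 /(_ _ _)/proj1 N1P] := jacobi_fin v m1 x l m h.
have [N2 /(_ _ _)/proj1 N2P] := jacobi_fin v m1 y l m h.
have [N3 /(_ _ _)/proj1 N3P] := jacobi_fin v m1 (c *: x + y) l m h.
rewrite (N1P (maxn N1 (maxn N2 N3))) ?(N2P (maxn N1 (maxn N2 N3)))
  ?(N3P (maxn N1 (maxn N2 N3))) ?leq_max ?leqnn ?orbT//.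
rewrite /jacobi_lhsn scalerBr !scaler_sumr addrACA -opprD -!big_split /=.
congr (_ - _); apply: eq_bigr => i _.
  by rewrite linYr lin3 scalerDr !scalerA mulrC.
by rewrite lin2 linYr scalerDr !scalerA mulrC.
Qed.

Lemma jacobi_rhs_linr v m1 l m h : linear (fun m2 => jacobi_rhs v m1 m2 l m h).
Proof.
move=> c x y; have [N1 /(_ _ _)/proj2 N1P] := jacobi_fin v m1 x l m h.
have [N2 /(_ _ _)/proj2 N2P] := jacobi_fin v m1 y l m h.
have [N3 /(_ _ _)/proj2 N3P] := jacobi_fin v m1 (c *: x + y) l m h.
rewrite (N1P (maxn N1 (maxn N2 N3))) ?(N2P (maxn N1 (maxn N2 N3)))
  ?(N3P (maxn N1 (maxn N2 N3))) ?leq_max ?leqnn ?orbT//.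
rewrite /jacobi_rhsn !scaler_sumr -!big_split /=.
by apply: eq_bigr => i _; rewrite linYr scalerDr !scalerA mulrC.
Qed.

Lemma jacobi_lhs_linl v m2 l m h : linear (fun m1 => jacobi_lhs v m1 m2 l m h).
Proof.
move=> c x y; have [N1 /(_ _ _)/proj1 N1P] := jacobi_fin v x m2 l m h.
have [N2 /(_ _ _)/proj1 N2P] := jacobi_fin v y m2 l m h.
have [N3 /(_ _ _)/proj1 N3P] := jacobi_fin v (c *: x + y) m2 l m h.
rewrite (N1P (maxn N1 (maxn N2 N3))) ?(N2P (maxn N1 (maxn N2 N3)))
  ?(N3P (maxn N1 (maxn N2 N3))) ?leq_max ?leqnn ?orbT//.
rewrite /jacobi_lhsn scalerBr !scaler_sumr addrACA -opprD -!big_split /=.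
congr (_ - _); apply: eq_bigr => i _.
  by rewrite linYl lin3 scalerDr !scalerA mulrC.
by rewrite linYl scalerDr !scalerA mulrC.
Qed.

Lemma jacobi_rhs_linl v m2 l m h : linear (fun m1 => jacobi_rhs v m1 m2 l m h).
Proof.
move=> c x y; have [N1 /(_ _ _)/proj2 N1P] := jacobi_fin v x m2 l m h.
have [N2 /(_ _ _)/proj2 N2P] := jacobi_fin v y m2 l m h.
have [N3 /(_ _ _)/proj2 N3P] := jacobi_fin v (c *: x + y) m2 l m h.
rewrite (N1P (maxn N1 (maxn N2 N3))) ?(N2P (maxn N1 (maxn N2 N3)))
  ?(N3P (maxn N1 (maxn N2 N3))) ?leq_max ?leqnn ?orbT//.
rewrite /jacobi_rhsn !scaler_sumr -!big_split /=.
by apply: eq_bigr => i _; rewrite lin1 linYl scalerDr !scalerA mulrC.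
Qed.

End Jacobi.

Section JacobiMap.
Variables (K : fieldType) (Ix : pzRingType) (V M1 M2 M3 M1' M2' M3' : lmodType K).
Variables (act1 : V -> int -> M1 -> M1) (act2 : V -> int -> M2 -> M2).
Variables (act3 : V -> int -> M3 -> M3) (Y : M1 -> Ix -> M2 -> M3).
Variables (act1' : V -> int -> M1' -> M1') (act2' : V -> int -> M2' -> M2').
Variables (act3' : V -> int -> M3' -> M3') (Y' : M1' -> Ix -> M2' -> M3').
Variables (f1 : M1 -> M1') (f2 : M2 -> M2') (f3 : M3 -> M3').
Hypotheses (lin3 : forall v n, linear (act3 v n)).
Hypothesis linYl : forall h m2, linear (fun m1 => Y m1 h m2).
Hypothesis linYr : forall m1 h, linear (Y m1 h).
Hypotheses (tr1 : trunc_act act1) (tr2 : trunc_act act2) (trY : trunc_itw Y).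
Hypothesis lf3 : linear f3.
Hypothesis f1act : forall v n m, f1 (act1 v n m) = act1' v n (f1 m).
Hypothesis f2act : forall v n m, f2 (act2 v n m) = act2' v n (f2 m).
Hypothesis f3act : forall v n m, f3 (act3 v n m) = act3' v n (f3 m).
Hypothesis fY : forall m1 h m2, Y' (f1 m1) h (f2 m2) = f3 (Y m1 h m2).

Lemma jacobi_lhs_map v m1 m2 l m h :
  f3 (jacobi_lhs act2 act3 Y v m1 m2 l m h) =
  jacobi_lhs act2' act3' Y' v (f1 m1) (f2 m2) l m h.
Proof.
have [N NP] := jacobi_bound tr1 tr2 trY v m1 m2 l m h.
rewrite /jacobi_lhs (linB lf3); congr (_ - _).
  rewrite (lin_fsum lf3); first last.
    apply: (@finite_nat_support _ _ N) => i /NP[-> _ _].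
    by rewrite (lin0 (lin3 _ _)) scaler0.
  by apply: eq_fsbigr => i _; rewrite (linZ lf3) f3act fY.
rewrite (lin_fsum lf3); first last.
  apply: (@finite_nat_support _ _ N) => i /NP[_ -> _].
  by rewrite (lin0 (linYr _ _)) scaler0.
by apply: eq_fsbigr => i _; rewrite (linZ lf3) -fY f2act.
Qed.

Lemma jacobi_rhs_map v m1 m2 l m h :
  f3 (jacobi_rhs act1 Y v m1 m2 l m h) =
  jacobi_rhs act1' Y' v (f1 m1) (f2 m2) l m h.
Proof.
have [N NP] := jacobi_bound tr1 tr2 trY v m1 m2 l m h.
rewrite /jacobi_rhs (lin_fsum lf3); first last.
  apply: (@finite_nat_support _ _ N) => i /NP[_ _ ->].
  by rewrite (lin0 (linYl _ _)) scaler0.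
by apply: eq_fsbigr => i _; rewrite (linZ lf3) -fY f1act.
Qed.

(** Serves when the target is covered by sources that satisfy the identity, as for quotients and
    glued operators. *)
Lemma jacobi_push v m1 m2 l m h :
  jacobi_lhs act2 act3 Y v m1 m2 l m h = jacobi_rhs act1 Y v m1 m2 l m h ->
  jacobi_lhs act2' act3' Y' v (f1 m1) (f2 m2) l m h =
  jacobi_rhs act1' Y' v (f1 m1) (f2 m2) l m h.
Proof. by move=> /(congr1 f3); rewrite jacobi_lhs_map jacobi_rhs_map. Qed.

(** The conclusion holds only after [f3]; it is applied with [f3] injective, or with a family
    separating points such as the components of a direct sum. *)
Lemma jacobi_pull v m1 m2 l m h :
  jacobi_lhs act2' act3' Y' v (f1 m1) (f2 m2) l m h =
  jacobi_rhs act1' Y' v (f1 m1) (f2 m2) l m h ->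
  f3 (jacobi_lhs act2 act3 Y v m1 m2 l m h) =
  f3 (jacobi_rhs act1 Y v m1 m2 l m h).
Proof. by rewrite jacobi_lhs_map jacobi_rhs_map. Qed.

End JacobiMap.

(** * Quotients and direct sums *)

Section Subspaces.
Variables (K : nzRingType) (M : lmodType K).

Lemma subspaceZ (U : set M) c x : subspace U -> U x -> U (c *: x).
Proof. by move=> [U0 UZ] Ux; rewrite -[_ *: _]addr0; apply: UZ. Qed.

Lemma subspaceD (U : set M) x y : subspace U -> U x -> U y -> U (x + y).
Proof. by move=> [_ UZ] Ux Uy; rewrite -[x]scale1r; apply: UZ. Qed.

Lemma subspaceN (U : set M) x : subspace U -> U x -> U (- x).
Proof. by move=> Us Ux; rewrite -scaleN1r; apply: subspaceZ. Qed.

Lemma subspaceB (U : set M) x y : subspace U -> U x -> U y -> U (x - y).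
Proof. by move=> Us Ux Uy; apply: subspaceD => //; apply: subspaceN. Qed.

Definition span (S : set M) : set M := smallest (@subspace K M) S.

Lemma span_subspace S : subspace (span S).
Proof.
split=> [U [[]]//|c x y Sx Sy U [Us SU]].
by apply: Us.2; [apply: Sx|apply: Sy].
Qed.

Lemma sub_span S : S `<=` span S.
Proof. by move=> x Sx U [_ SU]; apply: SU. Qed.

Lemma span_min S U : subspace U -> S `<=` U -> span S `<=` U.
Proof. by move=> Us SU x; apply; split. Qed.

Lemma lin_eq_span (N : lmodType K) (f g : M -> N) S :
  linear f -> linear g -> (forall x, S x -> f x = g x) ->
  forall x, span S x -> f x = g x.
Proof.
move=> lf lg fg x /(_ [set y | f y = g y]); apply; split=> //.
split=> [|c y z fy fz]; first by rewrite /= (lin0 lf) (lin0 lg).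
by rewrite /= lf lg fy fz.
Qed.

End Subspaces.

Section Quotient.
Variables (K : nzRingType) (M : lmodType K) (U : set M) (Us : subspace U).

Definition quot_rel : rel M := fun x y => `[< U (x - y) >].

Lemma quot_rel_refl : reflexive quot_rel.
Proof. by move=> x; apply/asboolP; rewrite subrr; case: Us. Qed.

Lemma quot_rel_sym : symmetric quot_rel.
Proof.
move=> x y; apply/asboolP/asboolP => /(subspaceN Us); by rewrite opprB.
Qed.

Lemma quot_rel_trans : transitive quot_rel.
Proof.
move=> y x z /asboolP xy /asboolP yz; apply/asboolP.
by rewrite -(subrKA y); apply: subspaceD.
Qed.

Definition quot_equiv := EquivRel quot_rel quot_rel_refl quot_rel_sym quot_rel_trans.

Definition quot := {eq_quot quot_equiv}%qT.
HB.instance Definition _ := Choice.on quot.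

Definition quot_pi (x : M) : quot := \pi_({eq_quot quot_equiv}%qT)%qT x.
Definition quot_repr (q : quot) : M := repr (q : {eq_quot quot_equiv}%qT).

Lemma quot_reprK q : quot_pi (quot_repr q) = q.
Proof. exact: reprK. Qed.

Lemma quot_piP x y : quot_pi x = quot_pi y <-> U (x - y).
Proof.
split=> [/eqP|Uxy]; first by rewrite /quot_pi eqmodE => /asboolP.
by apply/eqP; rewrite /quot_pi eqmodE; apply/asboolP.
Qed.

Lemma quot_repr_pi x : U (quot_repr (quot_pi x) - x).
Proof. by apply/quot_piP; rewrite quot_reprK. Qed.

Lemma quot_surj q : exists x, quot_pi x = q.
Proof. by exists (quot_repr q); rewrite quot_reprK. Qed.

Definition quot_add (p q : quot) := quot_pi (quot_repr p + quot_repr q).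
Definition quot_opp (p : quot) := quot_pi (- quot_repr p).
Definition quot_scale c (p : quot) := quot_pi (c *: quot_repr p).

Lemma quot_piD x y : quot_add (quot_pi x) (quot_pi y) = quot_pi (x + y).
Proof.
by apply/quot_piP; rewrite opprD addrACA; apply: subspaceD => //; apply: quot_repr_pi.
Qed.

Lemma quot_piN x : quot_opp (quot_pi x) = quot_pi (- x).
Proof.
by apply/quot_piP; rewrite -opprD; apply: subspaceN => //; apply: quot_repr_pi.
Qed.

Lemma quot_piZ c x : quot_scale c (quot_pi x) = quot_pi (c *: x).
Proof.
by apply/quot_piP; rewrite -scalerBr; apply: subspaceZ => //; apply: quot_repr_pi.
Qed.

Lemma quot_addA : associative quot_add.
Proof.
move=> p q r; have [x <-] := quot_surj p.
have [[y <-] [z <-]] := conj (quot_surj q) (quot_surj r).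
by rewrite !quot_piD addrA.
Qed.

Lemma quot_addC : commutative quot_add.
Proof. by move=> p q; rewrite /quot_add addrC. Qed.

Lemma quot_add0 : left_id (quot_pi 0) quot_add.
Proof. by move=> p; have [x <-] := quot_surj p; rewrite quot_piD add0r. Qed.

Lemma quot_addN : left_inverse (quot_pi 0) quot_opp quot_add.
Proof.
by move=> p; have [x <-] := quot_surj p; rewrite quot_piN quot_piD addNr.
Qed.

HB.instance Definition _ :=
  GRing.isZmodule.Build quot quot_addA quot_addC quot_add0 quot_addN.

Lemma quot_scaleA a b p : quot_scale a (quot_scale b p) = quot_scale (a * b) p.
Proof. by have [x <-] := quot_surj p; rewrite !quot_piZ scalerA. Qed.

Lemma quot_scale1 : left_id 1 quot_scale.
Proof. by move=> p; have [x <-] := quot_surj p; rewrite !quot_piZ scale1r. Qed.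

Lemma quot_scaleDr : right_distributive quot_scale +%R.
Proof.
move=> c p q; have [[x <-] [y <-]] := conj (quot_surj p) (quot_surj q).
by rewrite -![_ + _]/(quot_add _ _) quot_piD !quot_piZ quot_piD scalerDr.
Qed.

Lemma quot_scaleDl p : {morph (fun c => quot_scale c p) : a b / a + b}.
Proof.
move=> a b; have [x <-] := quot_surj p.
by rewrite -[RHS]/(quot_add _ _) !quot_piZ quot_piD scalerDl.
Qed.

HB.instance Definition _ := GRing.Zmodule_isLmodule.Build K quot
  quot_scaleA quot_scale1 quot_scaleDr quot_scaleDl.

Lemma quot_pi_linear : linear quot_pi.
Proof.
by move=> c x y; rewrite -quot_piD -quot_piZ.
Qed.

Lemma quot_pi_eq0 x : quot_pi x = 0 <-> U x.
Proof. by rewrite -[0]/(quot_pi 0) quot_piP subr0. Qed.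

End Quotient.

Section DirectProduct.
Variables (K : nzRingType) (I : Type) (M : I -> lmodType K).

Definition dprod := forall i, M i.
HB.instance Definition _ := Choice.copy dprod (forall i, M i).

Definition dprod_add (f g : dprod) : dprod := fun i => f i + g i.
Definition dprod_opp (f : dprod) : dprod := fun i => - f i.
Definition dprod_scale c (f : dprod) : dprod := fun i => c *: f i.

Lemma dprodP (f g : dprod) : (forall i, f i = g i) -> f = g.
Proof. exact: functional_extensionality_dep. Qed.

Lemma dprod_addA : associative dprod_add.
Proof. by move=> f g h; apply: dprodP => i; rewrite /dprod_add addrA. Qed.

Lemma dprod_addC : commutative dprod_add.
Proof. by move=> f g; apply: dprodP => i; rewrite /dprod_add addrC. Qed.

Lemma dprod_add0 : left_id (fun i => 0) dprod_add.
Proof. by move=> f; apply: dprodP => i; rewrite /dprod_add add0r. Qed.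

Lemma dprod_addN : left_inverse (fun i => 0) dprod_opp dprod_add.
Proof. by move=> f; apply: dprodP => i; rewrite /dprod_add addNr. Qed.

HB.instance Definition _ :=
  GRing.isZmodule.Build dprod dprod_addA dprod_addC dprod_add0 dprod_addN.

Lemma dprod_scaleA a b f : dprod_scale a (dprod_scale b f) = dprod_scale (a * b) f.
Proof. by apply: dprodP => i; rewrite /dprod_scale scalerA. Qed.

Lemma dprod_scale1 : left_id 1 dprod_scale.
Proof. by move=> f; apply: dprodP => i; rewrite /dprod_scale scale1r. Qed.

Lemma dprod_scaleDr : right_distributive dprod_scale +%R.
Proof. by move=> c f g; apply: dprodP => i; rewrite /dprod_scale scalerDr. Qed.

Lemma dprod_scaleDl f : {morph (fun c => dprod_scale c f) : a b / a + b}.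
Proof. by move=> a b; apply: dprodP => i; rewrite /dprod_scale scalerDl. Qed.

HB.instance Definition _ := GRing.Zmodule_isLmodule.Build K dprod
  dprod_scaleA dprod_scale1 dprod_scaleDr dprod_scaleDl.

End DirectProduct.

Section SubLmodule.
Variables (K : nzRingType) (M : lmodType K) (U : set M) (Us : subspace U).

(** Carrying the proof as an argument makes [sub_pred Us] determine the closure proof that the
    instance below has to provide. *)
Definition sub_pred (_ : subspace U) : pred M := fun x => `[< U x >].

Lemma sub_pred_submod : GRing.submod_closed (sub_pred Us).
Proof.
split=> [|c x y /asboolP Ux /asboolP Uy]; apply/asboolP; first by case: Us.
exact: Us.2.
Qed.

HB.instance Definition _ :=
  GRing.isSubmodClosed.Build K M (sub_pred Us) sub_pred_submod.

Definition sublmod := {x : M | sub_pred Us x}.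
HB.instance Definition _ := SubChoice.on sublmod.
HB.instance Definition _ := [SubChoice_isSubLmodule of sublmod by <:].

End SubLmodule.

Section DirectSum.
Variables (K : nzRingType) (I : Type) (M : I -> lmodType K).

(** The type of a component depends on its index, so [x] is transported along an equality of
    indices, decided classically; proof irrelevance makes the transport trivial at [i]. *)
Definition dinj (i : I) (x : M i) : dprod M := fun j =>
  if pselect (i = j) is left e then eq_rect i (fun k => M k) x j e else 0.

Lemma dinjE i x : dinj x i = x.
Proof.
by rewrite /dinj; case: pselect => // e; rewrite (Prop_irrelevance e erefl).
Qed.

Lemma dinj_neq i j x : i <> j -> @dinj i x j = 0.
Proof. by rewrite /dinj; case: pselect. Qed.

Lemma dinj_linear i : linear (@dinj i).
Proof.
move=> c x y; apply: dprodP => j; have [<-|ij] := pselect (i = j).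
  by rewrite /= /GRing.add /= /dprod_add /GRing.scale /= /dprod_scale !dinjE.
by rewrite /= /GRing.add /= /dprod_add /GRing.scale /= /dprod_scale !dinj_neq// scaler0 addr0.
Qed.

Lemma dprod_comp_linear i : linear (fun f : dprod M => f i).
Proof. by []. Qed.

Definition dgen : set (dprod M) := [set f | exists i x, f = @dinj i x].

(** Taking the span of the one-component vectors, instead of the finitely supported families, makes
    the induction principle immediate; finite support becomes a lemma. *)
Definition dsum := sublmod (span_subspace dgen).

Definition dval (f : dsum) : dprod M := val f.

Lemma dval_linear : linear dval.
Proof. by []. Qed.

Lemma dvalP (f : dsum) : span dgen (dval f).
Proof. by apply/asboolP; exact: (valP f). Qed.

Definition dsum_mk f (sf : span dgen f) : dsum :=
  Sub f (introT (asboolP _) sf : sub_pred (span_subspace dgen) f).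

Lemma dval_mk f (sf : span dgen f) : dval (dsum_mk sf) = f.
Proof. by []. Qed.

Lemma dval_inj : injective dval.
Proof. exact: val_inj. Qed.

Definition dsum_in i (x : M i) : dsum :=
  dsum_mk (sub_span (ex_intro _ i (ex_intro _ x erefl))).

Lemma dval_in i x : dval (@dsum_in i x) = dinj x.
Proof. by []. Qed.

Lemma dsum_in_linear i : linear (@dsum_in i).
Proof. by move=> c x y; apply: dval_inj; rewrite dval_linear !dval_mk dinj_linear. Qed.

Lemma dsum_ind (P : set dsum) : subspace P -> (forall i x, P (@dsum_in i x)) ->
  forall f, P f.
Proof.
move=> Ps Pi f.
(* Induction on the span takes place in the product, whereas [P] speaks of the subtype; hence the
   quantified membership proof, whose choice does not matter by [dval_inj]. *)
suff [sf] : [set g | exists sg : span dgen g, P (dsum_mk sg)] (dval f).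
  by congr P; apply: dval_inj.
apply: (dvalP f); split; last first.
  by move=> _ [i [x ->]]; exists (sub_span (ex_intro _ i (ex_intro _ x erefl))); exact: Pi.
split=> [|c x y [sx Px] [sy Py]].
  exists (span_subspace dgen).1; suff -> : dsum_mk (span_subspace dgen).1 = 0 by case: Ps.
  exact: dval_inj.
exists ((span_subspace dgen).2 c x y sx sy).
suff -> : dsum_mk ((span_subspace dgen).2 c x y sx sy) = c *: dsum_mk sx + dsum_mk sy.
  exact: Ps.2.
by apply: dval_inj; rewrite dval_linear.
Qed.

(** [{classic I}] equips the bare index type with the choice structure that finitely supported sums
    demand. *)
Lemma dsum_supp (f : dsum) : finite_set [set i : {classic I} | dval f i <> 0].
Proof.
apply: (dsum_ind (P := [set f | finite_set [set i : {classic I} | dval f i <> 0]])).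
  split=> [|c x y fx fy] /=.
    have -> : [set i : {classic I} | dval 0 i <> 0] = set0; last exact: finite_set0.
    by apply/seteqP; split => i // /(_ erefl).
  apply: sub_finite_set (_ : finite_set ([set i : {classic I} | dval x i <> 0] `|`
    [set i : {classic I} | dval y i <> 0])).
    move=> i /= xy; apply: contrapT => /not_orP[/contrapT x0 /contrapT y0]; apply: xy.
    rewrite (dval_linear c x y) (dprod_comp_linear i c (dval x) (dval y)).
    by rewrite x0 y0 scaler0 addr0.
  by rewrite finite_setU.
move=> i x /=; apply: (@sub_finite_set _ _ [set (i : {classic I})]) => [j /= ij|];
  last exact: finite_set1.
by apply: contrapT => ji; apply: ij; rewrite dval_in dinj_neq// => /esym.
Qed.

Lemma dsum_univ (E : lmodType K) (phi : forall i, M i -> E) :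
  (forall i, linear (phi i)) ->
  exists2 f : dsum -> E, linear f & forall i x, f (@dsum_in i x) = phi i x.
Proof.
move=> lphi; pose f (x : dsum) := \sum_(i \in [set: {classic I}]) phi i (dval x i).
have fin (x : dsum) : finite_set ([set: {classic I}] `&`
    (fun i => phi i (dval x i)) @^-1` [set~ 0]).
  apply: sub_finite_set (dsum_supp x) => i [_ /=] h xi; apply: h.
  by rewrite xi (lin0 (lphi i)).
exists f => [c x y|i x]; last first.
  rewrite /f -(fsbig_widen [set (i : {classic I})] setT)//.
    by rewrite fsbig_set1 dval_in dinjE.
  by move=> j [_ /= /nesym ij]; rewrite /preimage /= dval_in dinj_neq ?(lin0 (lphi j)).
(* One finite set containing the supports of [x], [y] and [c *: x + y], so that the three sums can
   be compared term by term. *)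
pose S := [set i : {classic I} | dval x i <> 0] `|` [set i : {classic I} | dval y i <> 0].
have fS : finite_set S by rewrite finite_setU; split; apply: dsum_supp.
have fE z : [set i : {classic I} | dval z i <> 0] `<=` S ->
    f z = \sum_(i \in S) phi i (dval z i).
  move=> zS; apply/esym/fsbig_widen => // i [_ /= Si].
  by rewrite /preimage /=; apply: contra_notP Si => zi; apply: zS => /= z0;
     apply: zi; rewrite z0 (lin0 (lphi i)).
rewrite !fE; [|by move=> i; right|by move=> i; left|].
  rewrite !fsbig_finite// scaler_sumr -big_split; apply: eq_bigr => i _ /=.
  by rewrite -lphi.
move=> i /= xy; apply: contrapT => /not_orP[/contrapT x0 /contrapT y0]; apply: xy.
rewrite (dval_linear c x y) (dprod_comp_linear i c (dval x) (dval y)).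
by rewrite x0 y0 scaler0 addr0.
Qed.

End DirectSum.

Section GradedElements.
Variables (K : fieldType) (M : lmodType K) (L : M -> M).
Hypothesis lL : linear L.

Definition graded_elem (m : M) := exists s : seq M,
  (forall x, x \in s -> exists h, gen_eigen L h x) /\ m = \sum_(x <- s) x.

Lemma eigen_iter_linear h n : linear (iter n (fun x => L x - h *: x)).
Proof.
elim: n => [//|n IH] c x y; rewrite iterS IH lL scalerBr !scalerDr opprD addrACA.
by rewrite !scalerA mulrC.
Qed.

Lemma gen_eigen_subspace h : subspace (gen_eigen L h).
Proof.
split=> [|c x y [n nx] [m my]]; first by exists 0%N.
exists (n + m)%N; rewrite eigen_iter_linear {1}addnC !iterD nx my.
by rewrite !(lin0 (eigen_iter_linear _ _)) scaler0 addr0.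
Qed.

Lemma graded_elem_subspace : subspace graded_elem.
Proof.
split=> [|c x y [s [sP ->]] [t [tP ->]]]; first by exists [::]; rewrite big_nil.
exists ([seq c *: x | x <- s] ++ t); rewrite big_cat big_map scaler_sumr.
split=> // z; rewrite mem_cat => /orP[/mapP[w ws ->]|/tP//].
by have [h wh] := sP w ws; exists h; apply: subspaceZ (gen_eigen_subspace h) wh.
Qed.

End GradedElements.

Section GradedMap.
Variables (K : fieldType) (M N : lmodType K) (LM : M -> M) (LN : N -> N).
Variable f : M -> N.
Hypotheses (lf : linear f) (fL : forall x, f (LM x) = LN (f x)).

Lemma gen_eigen_map h x : gen_eigen LM h x -> gen_eigen LN h (f x).
Proof.
move=> [n nx]; exists n; rewrite -(lin0 lf) -nx.
by elim: n {nx} => //= n ->; rewrite (linB lf) (linZ lf) fL.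
Qed.

Lemma graded_elem_map x : graded_elem LM x -> graded_elem LN (f x).
Proof.
move=> [s [sP ->]]; exists (map f s); rewrite (lin_sum lf) big_map; split=> //.
by move=> _ /mapP[y ys ->]; have [h /gen_eigen_map ?] := sP y ys; exists h.
Qed.

End GradedMap.

(** * Quotients and direct sums of generalized modules *)

Section GmodConstructions.
Variables (R : realType) (V : voa R).

Lemma vhom0 (M N : gmod V) (f : vhom M N) : f 0 = 0.
Proof. exact: lin0 (vhom_linear f). Qed.

Lemma vhomB (M N : gmod V) (f : vhom M N) x y : f (x - y) = f x - f y.
Proof. exact: linB (vhom_linear f) x y. Qed.

Lemma act_trunc_itw (M : gmod V) : trunc_itw (@act R V M).
Proof.
move=> v m h; have [N NP] := trunc_actN v m h (@act_trunc _ _ M).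
by exists N => n /NP; rewrite natz.
Qed.

Lemma act_jacobiE (M : gmod V) v m1 m2 l m h :
  jacobi_lhs act act (@act R V M) v m1 m2 l m h =
  jacobi_rhs (@vact R V) (@act R V M) v m1 m2 l m h.
Proof. exact: act_jacobi. Qed.

Section Quotient.
Variables (M : gmod V) (U : set M) (Um : submodule U).
Let Us := Um.1.
Notation Q := (quot Us).
Notation qpi := (quot_pi Us).

Definition quot_act (v : V) (n : int) (q : Q) : Q := qpi (act v n (quot_repr q)).

Lemma quot_act_pi v n x : quot_act v n (qpi x) = qpi (act v n x).
Proof.
apply/quot_piP; rewrite -(linB (act_linr _ _)); apply: Um.2; exact: quot_repr_pi.
Qed.

Lemma quot_act_linl n m : linear (fun v => quot_act v n m).
Proof.
move=> c v w; have [x <-] := quot_surj m.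
by rewrite !quot_act_pi act_linl quot_pi_linear.
Qed.

Lemma quot_act_linr v n : linear (quot_act v n).
Proof.
move=> c p q; have [[x <-] [y <-]] := conj (quot_surj p) (quot_surj q).
by rewrite -quot_pi_linear !quot_act_pi act_linr quot_pi_linear.
Qed.

Lemma quot_act_trunc : trunc_act quot_act.
Proof.
move=> v m; have [x <-] := quot_surj m; have [N NP] := act_trunc v x.
by exists N => n /NP xn; rewrite quot_act_pi xn.
Qed.

Lemma quot_act_vac n m : quot_act (vac V) n m = if n == -1 then m else 0.
Proof. by have [x <-] := quot_surj m; rewrite quot_act_pi act_vac; case: ifP. Qed.

Lemma quot_act_jacobi : jacobi (@vact R V) quot_act quot_act quot_act.
Proof.
move=> v m1 m2 l m h; have [x <-] := quot_surj m2.
have piE w n y : qpi (act w n y) = quot_act w n (qpi y) by rewrite quot_act_pi.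
have := act_jacobiE v m1 x l m h.
apply: (jacobi_push (f1 := id) (f2 := qpi) (f3 := qpi)) => //.
- by move=> *; apply: act_linr.
- by move=> *; apply: act_linl.
- by move=> *; apply: act_linr.
- exact: vact_trunc.
- exact: act_trunc.
- exact: act_trunc_itw.
- exact: quot_pi_linear.
Qed.

Lemma quot_act_graded m : graded_elem (quot_act (conf V) 1) m.
Proof.
have [x <-] := quot_surj m; apply: graded_elem_map (gmod_graded x).
  exact: quot_pi_linear.
by move=> y; rewrite quot_act_pi.
Qed.

Definition quot_gmod : gmod V := @Gmod R V Q quot_act quot_act_linl quot_act_linr
  quot_act_trunc quot_act_vac quot_act_jacobi quot_act_graded.

Definition quot_hom : vhom M quot_gmod.
Proof.
exists (qpi : M -> quot_gmod); first exact: quot_pi_linear.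
by move=> v n m; rewrite -quot_act_pi.
Defined.

(** From here on only surjectivity and the kernel of the projection are used. *)
Lemma quot_gmod_exists : exists (Q : gmod V) (q : vhom M Q),
  (forall y, exists x, q x = y) /\ forall x, q x = 0 <-> U x.
Proof.
exists quot_gmod, quot_hom; split=> [q|x]; first exact: quot_surj.
exact: quot_pi_eq0.
Qed.

End Quotient.

Section DirectSumGmod.
Variables (I : Type) (M : I -> gmod V).
Notation ML := (fun i => M i : lmodType R[i]).
Notation D := (dsum ML).

Definition dprod_act v n (f : dprod ML) : dprod ML := fun i => act v n (f i).

Lemma dprod_act_linear v n : linear (dprod_act v n).
Proof. by move=> c f g; apply: dprodP => i; apply: act_linr. Qed.

Lemma dprod_act_in v n i x : dprod_act v n (@dinj _ _ ML i x) = dinj (act v n x).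
Proof.
apply: dprodP => j; rewrite /dprod_act; have [<-|ij] := pselect (i = j).
  by rewrite !dinjE.
by rewrite !dinj_neq// (lin0 (act_linr _ _)).
Qed.

Lemma dprod_act_span v n f : span (@dgen _ _ ML) f -> span (@dgen _ _ ML) (dprod_act v n f).
Proof.
move=> /(_ [set g | span (@dgen _ _ ML) (dprod_act v n g)]); apply.
split=> [|_ [i [x ->]]].
  split=> [|c x y Sx Sy] /=.
    by rewrite (lin0 (dprod_act_linear v n)); apply: (span_subspace _).1.
  by rewrite dprod_act_linear; apply: (span_subspace _).2.
by rewrite /= dprod_act_in; apply: sub_span; exists i, (act v n x).
Qed.

Definition dsum_act v n (f : D) : D := dsum_mk (dprod_act_span v n (dvalP f)).

Lemma dsum_act_val v n f i : dval (dsum_act v n f) i = act v n (dval f i).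
Proof. by []. Qed.

Lemma dsum_act_in v n i x : dsum_act v n (@dsum_in _ _ ML i x) = dsum_in (act v n x).
Proof. by apply: dval_inj; rewrite dval_mk dval_in dprod_act_in. Qed.

Lemma dsum_act_linl n m : linear (fun v => dsum_act v n m).
Proof.
move=> c v w; apply: dval_inj; apply: dprodP => i.
by rewrite dval_linear [RHS](dprod_comp_linear i) !dsum_act_val act_linl.
Qed.

Lemma dsum_act_linr v n : linear (dsum_act v n).
Proof.
move=> c v' w; apply: dval_inj; apply: dprodP => i.
rewrite [in RHS]dval_linear [RHS](dprod_comp_linear i) !dsum_act_val.
by rewrite dval_linear [X in act _ _ X](dprod_comp_linear i) act_linr.
Qed.

(** In the full product infinitely many components need not share a bound; for finite combinations
    the maximum of the bounds works. *)
Lemma dsum_act_trunc : trunc_act dsum_act.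
Proof.
move=> v; apply: dsum_ind => [|i x]; last first.
  have [N NP] := act_trunc v x; exists N => n /NP xn.
  by rewrite dsum_act_in xn (lin0 (@dsum_in_linear _ _ _ _)).
split=> [|c x y [N NP] [N' NP']].
  by exists 0 => n _; rewrite (lin0 (dsum_act_linr _ _)).
exists (Num.max N N') => n; rewrite ge_max => /andP[/NP xn /NP' yn].
by rewrite dsum_act_linr xn yn scaler0 addr0.
Qed.

Lemma dsum_act_vac n m : dsum_act (vac V) n m = if n == -1 then m else 0.
Proof.
apply: dval_inj; apply: dprodP => i; rewrite dsum_act_val act_vac; by case: ifP.
Qed.

Lemma dsum_act_jacobi : jacobi (@vact R V) dsum_act dsum_act dsum_act.
Proof.
move=> v m1 m2 l m h; apply: dval_inj; apply: dprodP => i.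
have := act_jacobiE v m1 (dval m2 i) l m h.
apply: (jacobi_pull (f1 := id) (f2 := fun x : D => dval x i) (f3 := fun x : D => dval x i)) => //.
- by move=> *; apply: dsum_act_linr.
- by move=> *; apply: dsum_act_linl.
- by move=> *; apply: dsum_act_linr.
- exact: vact_trunc.
- exact: dsum_act_trunc.
- move=> m1' m2' h'; have [N NP] := trunc_actN m1' m2' h' dsum_act_trunc.
  by exists N => n /NP; rewrite natz.
Qed.

Lemma dsum_act_graded m : graded_elem (dsum_act (conf V) 1) m.
Proof.
move: m; apply: dsum_ind => [|i x].
  exact: graded_elem_subspace (dsum_act_linr _ _).
apply: graded_elem_map (gmod_graded x); first exact: dsum_in_linear.
by move=> y; rewrite dsum_act_in.
Qed.

Definition dsum_gmod : gmod V := @Gmod R V D dsum_act dsum_act_linl dsum_act_linr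
  dsum_act_trunc dsum_act_vac dsum_act_jacobi dsum_act_graded.

Definition dsum_hom i : vhom (M i) dsum_gmod.
Proof.
exists (@dsum_in _ _ ML i : M i -> dsum_gmod); first exact: dsum_in_linear.
by move=> v n m; rewrite -dsum_act_in.
Defined.

End DirectSumGmod.
End GmodConstructions.

(** * Colimits of generalized modules *)

Section VhomBasics.
Variables (R : realType) (V : voa R).
Implicit Types M N : gmod V.

Definition vhom_zero M N : vhom M N.
Proof.
exists (fun _ : M => 0 : N); first by move=> c x y; rewrite scaler0 addr0.
by move=> v n m; rewrite (lin0 (act_linr v n)).
Defined.

Definition vhom_add M N (f g : vhom M N) : vhom M N.
Proof.
exists (fun x => f x + g x).
  by move=> c x y; rewrite !vhom_linear scalerDr addrACA.
by move=> v n m; rewrite !vhom_act (linD (act_linr v n)).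
Defined.

Definition vhom_opp M N (f : vhom M N) : vhom M N.
Proof.
exists (fun x => - f x).
  by move=> c x y; rewrite !vhom_linear opprD scalerN.
by move=> v n m; rewrite !vhom_act (linN (act_linr v n)).
Defined.

Lemma vhom_lift M N A (f : vhom N M) (g : vhom A M) : injective f ->
  (forall a, exists x, f x = g a) -> exists h : vhom A N, forall a, f (h a) = g a.
Proof.
move=> finj gf; pose h a := sval (cid (gf a)).
have hE a : f (h a) = g a by rewrite /h; case: cid.
have lh : linear h by move=> c x y; apply: finj; rewrite vhom_linear !hE vhom_linear.
have ah v n m : h (act v n m) = act v n (h m).
  by apply: finj; rewrite vhom_act !hE vhom_act.
by exists (@Vhom R V A N h lh ah).
Qed.

Lemma range_submodule M N (f : vhom M N) : submodule (range f).
Proof.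
split=> [|v n _ [x _ <-]]; last by exists (act v n x); rewrite ?vhom_act.
split=> [|c _ _ [x _ <-] [y _ <-]]; first by exists 0; rewrite ?vhom0.
by exists (c *: x + y); rewrite ?vhom_linear.
Qed.

Lemma ker_submodule M N (f : vhom M N) : submodule [set x | f x = 0].
Proof.
split=> [|v n x /= fx]; last by rewrite vhom_act fx (lin0 (act_linr _ _)).
split=> [|c x y /= fx fy]; first exact: vhom0.
by rewrite vhom_linear fx fy scaler0 addr0.
Qed.

Lemma vhom_ker_inj M N (f : vhom M N) : (forall x, f x = 0 -> x = 0) -> injective f.
Proof. by move=> f0 x y /eqP; rewrite -subr_eq0 -vhomB => /eqP/f0/eqP; rewrite subr_eq0 => /eqP. Qed.

Lemma vhom_surj_lift M Q N (q : vhom M Q) (f : vhom M N) :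
  (forall y, exists x, q x = y) -> (forall x, q x = 0 -> f x = 0) ->
  exists g : vhom Q N, forall x, g (q x) = f x.
Proof.
move=> qsurj f0.
have [g lg gE] := lin_surj_lift (vhom_linear q) qsurj (vhom_linear f) f0.
have ag v n y : g (act v n y) = act v n (g y).
  by have [x <-] := qsurj y; rewrite -vhom_act !gE vhom_act.
by exists (@Vhom R V Q N g lg ag).
Qed.

End VhomBasics.

Section LinColimit.
Variables (R : realType) (V : voa R) (I : Type) (N : I -> gmod V).
Variable E : forall j k, vhom (N j) (N k) -> Prop.

Record lin_colimit (L : gmod V) (i : forall j, vhom (N j) L) : Prop := LinColimit {
  lc_cocone : forall j k (u : vhom (N j) (N k)), E u -> forall x, i k (u x) = i j x;
  lc_span : forall x, span [set y | exists j z, y = i j z] x;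
  lc_univ : forall (F : lmodType R[i]) (phi : forall j, N j -> F),
    (forall j, linear (phi j)) ->
    (forall j k (u : vhom (N j) (N k)), E u -> forall x, phi k (u x) = phi j x) ->
    exists2 f : L -> F, linear f & forall j x, f (i j x) = phi j x }.

(** The glued linear map respects the action because [f (act v n m)] and [act v n (f m)] are both
    linear in [m] and agree on the legs, whose images span. *)
Lemma lc_vhom L i (Z : gmod V) (h : forall j, vhom (N j) Z) : @lin_colimit L i ->
  (forall j k (u : vhom (N j) (N k)), E u -> forall x, h k (u x) = h j x) ->
  exists f : vhom L Z, forall j x, f (i j x) = h j x.
Proof.
move=> lc hE; have [f lf fE] := lc_univ lc (fun j => vhom_linear (h j)) hE.
have fact v n m : f (act v n m) = act v n (f m).
  apply: (lin_eq_span (f := fun m => f (act v n m)) (g := fun m => act v n (f m))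
    _ _ _ (lc_span lc m)).
  - by move=> c x y; rewrite act_linr lf.
  - by move=> c x y; rewrite lf act_linr.
  - by move=> _ [j [z ->]]; rewrite -vhom_act !fE vhom_act.
by exists (@Vhom R V L Z f lf fact).
Qed.

Lemma lc_vhom_eq L i (Z : gmod V) (f g : vhom L Z) : @lin_colimit L i ->
  (forall j x, f (i j x) = g (i j x)) -> f = g.
Proof.
move=> lc fg; apply: vhomP => x.
apply: (lin_eq_span (vhom_linear f) (vhom_linear g) _ (lc_span lc x)).
by move=> _ [j [z ->]].
Qed.

Lemma lin_colimit_iso L i L' (f : vhom L L') (g : vhom L' L) : @lin_colimit L i ->
  cancel f g -> cancel g f -> @lin_colimit L' (fun j => vhom_comp f (i j)).
Proof.
move=> lc fK gK; split=> [j k u Eu x|x|F phi lphi phiE] /=.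
- by rewrite (lc_cocone lc Eu).
- pose S := span [set y | exists j z, y = f (i j z)].
  suff : S (f (g x)) by rewrite gK.
  have Ss : subspace [set y | S (f y)].
    have Ss := span_subspace [set y | exists j z, y = f (i j z)].
    split=> [|c y z Sy Sz] /=; first by rewrite vhom0; case: Ss.
    by rewrite vhom_linear; apply: Ss.2.
  apply: (span_min Ss) (lc_span lc (g x)) => _ [j [z ->]].
  by apply: sub_span; exists j, z.
have [h lh hE] := lc_univ lc lphi phiE.
exists (fun x => h (g x)) => [c x y|j x]; first by rewrite vhom_linear lh.
by rewrite fK hE.
Qed.

End LinColimit.

(* The indices are small here, whereas those of [lin_colimit] may be the objects
   of a large category. *)
Section LinColimitExistence.
Variables (R : realType) (V : voa R) (I : small) (N : I -> gmod V).
Variable E : forall j k, vhom (N j) (N k) -> Prop.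

Lemma dsum_gmod_exists : exists (D : gmod V) (d : forall j, vhom (N j) D),
  (forall P : set D, subspace P -> (forall j x, P (d j x)) -> forall x, P x) /\
  forall (F : lmodType R[i]) (phi : forall j, N j -> F), (forall j, linear (phi j)) ->
    exists2 f : D -> F, linear f & forall j x, f (d j x) = phi j x.
Proof.
exists (dsum_gmod N), (dsum_hom N); split=> [P|F phi]; first exact: dsum_ind.
exact: dsum_univ.
Qed.

Lemma lin_colimit_exists : exists L i, @lin_colimit R V I N E L i.
Proof.
have [D [d [spanD univD]]] := dsum_gmod_exists.
pose G : set D := [set y | exists j k (u : vhom (N j) (N k)) x,
  E u /\ y = d k (u x) - d j x].
(* Edges are module maps, so the relations are stable under the action and their linear span is
   already a submodule; this is why the module colimit is also one of vector spaces. *)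
have Gm : submodule (span G).
  split; first exact: span_subspace.
  move=> v n m /(_ [set m | span G (act v n m)]); apply.
  have Gs := span_subspace G; split=> [|_ [j [k [u [x [Eu ->]]]]] /=].
    split=> [|c x y Sx Sy] /=.
      by rewrite (lin0 (act_linr _ _)); case: Gs.
    by rewrite act_linr; apply: Gs.2.
  rewrite (linB (act_linr _ _)) -!vhom_act; apply: sub_span.
  by exists j, k, u, (act v n x).
have [Q [q [qsurj q0]]] := quot_gmod_exists Gm; exists Q, (fun j => vhom_comp q (d j)).
split=> [j k u Eu x|x|F phi lphi phiE] /=.
- apply/eqP; rewrite -subr_eq0 -vhomB; apply/eqP/q0; apply: sub_span.
  by exists j, k, u, x.
- have [y <-] := qsurj x; move: y.
  set S := [set y | _]; have Ss := span_subspace S.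
  apply: (spanD [set y | span S (q y)]) => [|j z]; last first.
    by apply: sub_span; exists j, z.
  split=> [|c y z Sy Sz] /=; first by rewrite vhom0; case: Ss.
  by rewrite vhom_linear; apply: Ss.2.
have [f lf fE] := univD _ _ lphi.
have f0 (x : D) : q x = 0 -> f x = 0.
  move=> /q0/(_ [set x | f x = 0]); apply; split.
    split=> [|c y z /= fy fz]; first by rewrite /= (lin0 lf).
    by rewrite lf fy fz scaler0 addr0.
  move=> _ [j [k [u [y [Eu ->]]]]] /=.
  by rewrite (linB lf) !fE phiE// subrr.
have [g lg gE] := lin_surj_lift (vhom_linear q) qsurj lf f0.
by exists g => // j x; rewrite gE fE.
Qed.

End LinColimitExistence.

(** * The closure of a subcategory under unions *)

Section UnionClosure.
Variables (R : realType) (V : voa R) (C0 : gmod V -> Prop).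
Hypothesis C0_coprod : closed_fin_coproducts C0.
Hypothesis C0_quot : closed_quotients C0.
Hypothesis C0_V : C0 (voa_gmod V).
Implicit Types M A B : gmod V.
Local Notation C := (union_closure C0).

(** [closed_fin_coproducts] concerns any coproduct in the category of all generalized modules, so it
    applies to the linear colimit of two objects without edges. *)
Lemma C0_sum A B : C0 A -> C0 B -> exists P (i : vhom A P) (j : vhom B P),
  C0 P /\ forall Z (f : vhom A Z) (g : vhom B Z), exists h : vhom P Z,
    (forall a, h (i a) = f a) /\ (forall b, h (j b) = g b).
Proof.
move=> CA CB; pose N (b : 'I_2) := if b == ord0 then A else B.
have [L [i lc]] := lin_colimit_exists (N := N) (fun _ _ _ => False).
exists L, (i ord0), (i ord_max); split.
  apply: (C0_coprod (n := 2) (F := N : 'I_2 -> gmod_cat V) (L := L) (i := i)).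
    by move=> j; rewrite /N; case: ifP.
  move=> L' i'.
  have [|f fE] := lc_vhom (h := i') lc; first by [].
  exists f; split=> [j|g gE]; first by apply: vhomP => x; rewrite /= fE.
  by apply: (lc_vhom_eq lc) => j x; rewrite fE -gE.
move=> Z f g; pose h (b : 'I_2) : vhom (N b) Z :=
  if b == ord0 as c return vhom (if c then A else B) Z then f else g.
have [|k kE] := lc_vhom (h := h) lc; first by [].
by exists k; split; [exact: (kE ord0)|exact: (kE ord_max)].
Qed.

(** [submodule_in] asks for an injective map: [f] is replaced by the map it induces on the quotient
    by its kernel, which closure under quotients keeps in [C0]. *)
Lemma range_submodule_in A M (f : vhom A M) : C0 A -> submodule_in C0 (range f).
Proof.
move=> CA; split; first exact: range_submodule.
have km := ker_submodule f.
have [Q [q [qsurj q0]]] := quot_gmod_exists km.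
have [g gE] := vhom_surj_lift qsurj (fun x qx => (q0 x).1 qx : f x = 0).
exists Q; split; first by apply: (C0_quot (f := q)) CA => y _; have [x <-] := qsurj y; exists x.
exists g; split.
  apply: vhom_ker_inj => y; have [x <-] := qsurj y.
  by rewrite gE => fx; apply/q0.
apply/seteqP; split => [_ [y _ <-]|_ [x _ <-]].
  by have [x <-] := qsurj y; rewrite gE; exists x.
by exists (q x).
Qed.

(** Drops the injectivity in the definition of the closure; by [range_submodule_in] the two
    descriptions agree, and this one is stable under maps at sight. *)
Definition C0_points M : set M := [set x | exists A (f : vhom A M) a, C0 A /\ x = f a].

(** The coproduct of two objects of [C0] reaches both elements through a single map. *)
Lemma C0_points_subspace M : subspace (@C0_points M).
Proof.
split; first by exists (voa_gmod V), (vhom_zero _ _), 0; split.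
move=> c _ _ [A [f [a [CA ->]]]] [B [g [b [CB ->]]]].
have [P [i [j [CP hP]]]] := C0_sum CA CB; have [h [hi hj]] := hP _ f g.
by exists P, h, (c *: i a + j b); rewrite vhom_linear hi hj.
Qed.

Lemma unionP M : C M <-> forall x, @C0_points M x.
Proof.
split=> [[F [FC FM]] x|Mx].
  have [U /FC[_ [A [CA [f [_ <-]]]]] [a _ <-]] : (\bigcup_(U in F) U) x by rewrite FM.
  by exists A, f, a.
exists [set U | submodule_in C0 U]; split=> //; apply/seteqP; split=> // x _.
have [A [f [a [CA ->]]]] := Mx x; exists (range f); last by exists a.
exact: range_submodule_in.
Qed.

Lemma C_quot : closed_quotients C.
Proof.
move=> M N f fsurj /unionP Mx; apply/unionP => y.
have [x _ <-] := fsurj y I; have [A [g [a [CA ->]]]] := Mx x.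
by exists A, (vhom_comp f g), a.
Qed.

Lemma C_lin_colimit (I : Type) (N : I -> gmod V) E L i :
  (forall j, C (N j)) -> @lin_colimit R V I N E L i -> C L.
Proof.
move=> CN lc; apply/unionP => x; apply: (span_min (@C0_points_subspace L)) (lc_span lc x).
move=> _ [j [z ->]]; have /unionP/(_ z)[A [g [a [CA ->]]]] := CN j.
by exists A, (vhom_comp (i j) g), a.
Qed.

Section Subobjects.
Variable M : gmod V.

Definition C0sub := {U : set M | submodule_in C0 U}.

Lemma C0subP (U : C0sub) : exists N (f : vhom N M), [/\ C0 N, injective f & range f = sval U].
Proof. by case: U => U [Um [N [CN [f [fi fr]]]]] /=; exists N, f. Qed.

Definition sub_mod (U : C0sub) : gmod V := sval (cid (C0subP U)).
Definition sub_incl (U : C0sub) : vhom (sub_mod U) M := sval (cid (svalP (cid (C0subP U)))).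

Lemma sub_modP U : [/\ C0 (sub_mod U), injective (sub_incl U) & range (sub_incl U) = sval U].
Proof. exact: (svalP (cid (svalP (cid (C0subP U))))). Qed.

Definition sub_edge (U U' : C0sub) (u : vhom (sub_mod U) (sub_mod U')) :=
  forall x, sub_incl U' (u x) = sub_incl U x.

(** Every map factors through its image, so the submodules are cofinal among all maps from objects
    of [C0]. *)
Lemma sub_factor A (f : vhom A M) : C0 A ->
  exists U (g : vhom A (sub_mod U)), forall a, f a = sub_incl U (g a).
Proof.
move=> CA; pose U : C0sub := exist _ (range f) (range_submodule_in f CA).
have [CU inj rg] := sub_modP U; exists U.
have [|g gE] := vhom_lift (g := f) inj; last by exists g.
move=> a; have : range (sub_incl U) (f a) by rewrite rg; exists a.
by move=> [x _ <-]; exists x.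
Qed.

(** The upper bound is the sum of the two submodules, obtained as the image of their coproduct. *)
Lemma sub_directed U U' : exists W (u : vhom (sub_mod U) (sub_mod W))
  (u' : vhom (sub_mod U') (sub_mod W)), sub_edge u /\ sub_edge u'.
Proof.
have [[CU _ _] [CU' _ _]] := (sub_modP U, sub_modP U').
have [P [i [j [CP hP]]]] := C0_sum CU CU'.
have [h [hi hj]] := hP _ (sub_incl U) (sub_incl U').
have [W [g gE]] := sub_factor h CP.
by exists W, (vhom_comp g i), (vhom_comp g j); split=> x /=; rewrite -gE.
Qed.

Lemma sub_lin_colimit : C M -> lin_colimit sub_edge sub_incl.
Proof.
move=> /unionP Mx.
have reach x : exists U y, sub_incl U y = x.
  have [A [f [a [CA ->]]]] := Mx x; have [U [g gE]] := sub_factor f CA.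
  by exists U, (g a); rewrite -gE.
split=> [//|x|F phi lphi phiE].
  by have [U [y <-]] := reach x; apply: sub_span; exists U, y.
(* Independence of the representative: both are moved into a common larger submodule, where
   injectivity of the inclusion identifies them. *)
have phi_eq U U' y y' : sub_incl U y = sub_incl U' y' -> phi U y = phi U' y'.
  move=> yy'; have [W [u [u' [uE u'E]]]] := sub_directed U U'.
  rewrite -(phiE _ _ _ uE) -(phiE _ _ _ u'E); congr phi.
  by have [_ inj _] := sub_modP W; apply: inj; rewrite uE u'E.
pose f x := let: U := sval (cid (reach x)) in
  phi U (sval (cid (svalP (cid (reach x))))).
have fE U x : f (sub_incl U x) = phi U x.
  by rewrite /f; apply: phi_eq; rewrite (svalP (cid (svalP (cid (reach _))))).
exists f => // c x x'; have [U [y <-]] := reach x; have [U' [y' <-]] := reach x'.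
have [W [u [u' [uE u'E]]]] := sub_directed U U'.
by rewrite -(uE y) -(u'E y') -vhom_linear !fE lphi.
Qed.

End Subobjects.
End UnionClosure.

(** * Intertwining operators *)

Section Intertwining.
Variables (R : realType) (V : voa R).
Implicit Types (A B X Z : gmod V).

Lemma itw_trunc_itw A B Z (Y : intertwining A B Z) k : trunc_itw (coef Y k).
Proof. by move=> m1 m2 h; have [N NP] := itw_trunc Y m1 m2 h; exists N => n /NP. Qed.

Lemma itw_jacobiE A B Z (Y : intertwining A B Z) k v m1 m2 l m h :
  jacobi_lhs act act (coef Y k) v m1 m2 l m h =
  jacobi_rhs act (coef Y k) v m1 m2 l m h.
Proof. exact: itw_jacobi. Qed.

Definition itw_comp A B A' B' Z (Y : intertwining A B Z) (f : vhom A' A)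
  (g : vhom B' B) : intertwining A' B' Z.
Proof.
exists (fun a b => Y (f a) (g b)).
- by move=> b e k c x y; rewrite vhom_linear itw_linl.
- by move=> a e k c x y; rewrite vhom_linear itw_linr.
- by move=> a b; apply: itw_poly.
- by move=> a b; apply: itw_trunc.
- move=> k v a b l m h; have := itw_jacobiE Y k v (f a) (g b) l m h.
  apply: (jacobi_pull (f1 := f) (f2 := g) (f3 := id)) => //.
  + by move=> *; apply: act_linr.
  + by move=> h' m2' c x y; rewrite /coef vhom_linear itw_linl.
  + by move=> m1' h' c x y; rewrite /coef vhom_linear itw_linr.
  + exact: act_trunc.
  + exact: act_trunc.
  + by move=> m1 m2 h'; have [N NP] := itw_trunc Y (f m1) (g m2) h'; exists N => n nN; exact: NP.
  + by move=> *; apply: vhom_act.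
  + by move=> *; apply: vhom_act.
- by move=> a b; rewrite /vir vhom_act; apply: itw_deriv.
Defined.

Definition itw_post A B Z Z' (h : vhom Z Z') (Y : intertwining A B Z) :
  intertwining A B Z'.
Proof.
exists (fun a b e k => h (Y a b e k)).
- by move=> b e k c x y; rewrite itw_linl vhom_linear.
- by move=> a e k c x y; rewrite itw_linr vhom_linear.
- by move=> a b e; have [K KP] := itw_poly Y a b e; exists K => k /KP ->; rewrite vhom0.
- move=> a b e; have [K KP] := itw_trunc Y a b e; exists K => n k nK.
  by rewrite /coef; have := KP n k nK; rewrite /coef => ->; rewrite vhom0.
- move=> k v a b l m e; have := itw_jacobiE Y k v a b l m e.
  apply: (jacobi_push (f1 := id) (f2 := id) (f3 := h)) => //.
  + by move=> *; apply: act_linr.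
  + by move=> *; apply: itw_linl.
  + by move=> *; apply: itw_linr.
  + exact: act_trunc.
  + exact: act_trunc.
  + exact: itw_trunc_itw.
  + exact: vhom_linear.
  + by move=> *; apply: vhom_act.
- move=> a b; apply/funext => e; apply/funext => k.
  by rewrite itw_deriv /fser_deriv (linD (vhom_linear h)) !(linZ (vhom_linear h)).
Defined.

(** Turns an inclusion of images into a factorization; each axiom is checked after the injective map
    [f]. *)
Lemma itw_lift A B Z N (f : vhom N Z) (Y : intertwining A B Z) : injective f ->
  (forall a b e k, exists n, f n = Y a b e k) ->
  exists Y' : intertwining A B N, forall a b e k, f (Y' a b e k) = Y a b e k.
Proof.
move=> finj fY; pose Y' a b e k := sval (cid (fY a b e k)).
have YE a b e k : f (Y' a b e k) = Y a b e k by rewrite /Y'; case: cid.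
have Yl b e k : linear (fun a => Y' a b e k).
  by move=> c x y; apply: finj; rewrite vhom_linear !YE itw_linl.
have Yr a e k : linear (fun b => Y' a b e k).
  by move=> c x y; apply: finj; rewrite vhom_linear !YE itw_linr.
have Yp a b e : exists K : nat, forall k, (K <= k)%N -> Y' a b e k = 0.
  have [K KP] := itw_poly Y a b e; exists K => k /KP Y0.
  by apply: finj; rewrite YE Y0 vhom0.
have Yt a b h : exists N : nat, forall n k, (N <= n)%N -> coef Y' k a (h + n%:R) b = 0.
  have [K KP] := itw_trunc Y a b h; exists K => n k /(KP _ k) Y0.
  by apply: finj; rewrite YE vhom0.
have Yj k : jacobi act act act (coef Y' k).
  move=> v a b l m h; apply: finj; move: (itw_jacobiE Y k v a b l m h).
  apply: (jacobi_pull (f1 := id) (f2 := id) (f3 := f)) => //.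
  + by move=> *; apply: act_linr.
  + by move=> *; apply: Yl.
  + by move=> *; apply: Yr.
  + exact: act_trunc.
  + exact: act_trunc.
  + by move=> m1 m2 h'; have [n nP] := Yt m1 m2 h'; exists n => i /nP.
  + exact: vhom_linear.
  + by move=> *; apply: vhom_act.
  + by move=> *; rewrite /coef YE.
have Yd a b : Y' (vir A (-1) a) b = fser_deriv (Y' a b).
  apply/funext => e; apply/funext => k; apply: finj.
  by rewrite YE itw_deriv /fser_deriv vhom_linear (linZ (vhom_linear f)) !YE.
by exists (@Intertwining R V A B N Y' Yl Yr Yp Yt Yj Yd).
Qed.

Section Gluing.
Variables (I I' : Type) (N : I -> gmod V) (N' : I' -> gmod V).
Variable E : forall j k, vhom (N j) (N k) -> Prop.
Variable E' : forall j k, vhom (N' j) (N' k) -> Prop.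
Variables (A X Z : gmod V) (i : forall j, vhom (N j) A) (i' : forall j, vhom (N' j) X).
Hypotheses (lcA : lin_colimit E i) (lcX : lin_colimit E' i').

Lemma bilin_colimit_ind (P : A -> X -> Prop) :
  (forall x, subspace (P^~ x)) -> (forall a, subspace (P a)) ->
  (forall j j' y y', P (i j y) (i' j' y')) -> forall a x, P a x.
Proof.
move=> Pl Pr Pi a x.
apply: (span_min (Pl x)) (lc_span lcA a) => _ [j [y ->]].
apply: (span_min (Pr _)) (lc_span lcX x) => _ [j' [y' ->]].
exact: Pi.
Qed.

Lemma fun_linE (T : Type) (F : lmodType R[i]) c (g h : T -> F) x :
  (c *: g + h) x = c *: g x + h x.
Proof. by []. Qed.

(** By currying: for fixed [y] the family extends along [X], and the resulting functions extend
    along [A] with the vector space [X -> F] as target. *)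
Lemma bilin_colimit_univ (F : lmodType R[i]) (b : forall j j', N j -> N' j' -> F) :
  (forall j j' y', linear (fun y => b j j' y y')) ->
  (forall j j' y, linear (b j j' y)) ->
  (forall j k j' (u : vhom (N j) (N k)), E u ->
    forall y y', b k j' (u y) y' = b j j' y y') ->
  (forall j j' k' (u : vhom (N' j') (N' k')), E' u ->
    forall y y', b j k' y (u y') = b j j' y y') ->
  exists f : A -> X -> F,
    [/\ forall x, linear (f^~ x), forall a, linear (f a) &
    forall j j' y y', f (i j y) (i' j' y') = b j j' y y'].
Proof.
move=> bl br bE bE'.
have f_ex j y : exists g : X -> F, linear g /\ forall j' y', g (i' j' y') = b j j' y y'.
  have [|g lg gE] := lc_univ lcX (fun j' => br j j' y); last by exists g.
  by move=> j' k' u Eu y'; apply: bE'.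
pose f j y : X -> F := sval (cid (f_ex j y)).
have fl j y : linear (f j y) := proj1 (svalP (cid (f_ex j y))).
have fE j y j' y' : f j y (i' j' y') = b j j' y y' by apply: (proj2 (svalP (cid (f_ex j y)))).
have f_eq g h : linear g -> linear h -> (forall j' y', g (i' j' y') = h (i' j' y')) ->
    g = h :> (X -> F).
  move=> lg lh gh; apply/funext => x.
  by apply: (lin_eq_span lg lh) (lc_span lcX x) => _ [j' [y' ->]].
have comb_lin c g h : linear g -> linear h -> linear (c *: g + h : X -> F).
  move=> lg lh d x y; rewrite !fun_linE lg lh !scalerDr !scalerA.
  by rewrite addrACA [c * d]mulrC.
have [| |g lg gE] := lc_univ lcA (F := (X -> F : lmodType R[i])) (phi := f).
- move=> j c y z; apply: f_eq => [||j' y']; [exact: fl|exact: comb_lin|].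
  by rewrite fun_linE !fE bl.
- by move=> j k u Eu y; apply: f_eq => // j' y'; rewrite !fE (bE _ _ _ _ Eu).
exists g; split=> [x c y z|a|j j' y y']; first by rewrite lg.
(* The target [X -> F] contains all functions, so linearity of [g a] has to be recovered: it holds
   on the legs and is preserved by linear combinations. *)
- have : subspace [set a | linear (g a)].
    split=> [|c y z gy gz] /=; last by rewrite lg; apply: comb_lin.
    by rewrite (lin0 lg) => d x y; rewrite /= scaler0 addr0.
  move=> /span_min; apply; last exact: (lc_span lcA a).
  by move=> _ [j [z ->]] /=; rewrite gE.
- by rewrite gE fE.
Qed.

(** With [R[i] -> nat -> Z] as target, all coefficients are glued at once. Each axiom is stable
    under linear combinations in either variable, bounds being combined by maxima, so it suffices to
    check it on the legs. *)
Lemma glue_itw (J : forall j j', intertwining (N j) (N' j') Z) :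
  (forall j k j' (u : vhom (N j) (N k)), E u ->
    forall y y' e n, J k j' (u y) y' e n = J j j' y y' e n) ->
  (forall j j' k' (u : vhom (N' j') (N' k')), E' u ->
    forall y y' e n, J j k' y (u y') e n = J j j' y y' e n) ->
  exists Y : intertwining A X Z,
    forall j j' y y' e n, Y (i j y) (i' j' y') e n = J j j' y y' e n.
Proof.
move=> JE JE'.
have [||||Y [Yl0 Yr0 YE0]] := @bilin_colimit_univ (R[i] -> nat -> Z : lmodType R[i])
  (fun j j' y y' => J j j' y y').
- by move=> j j' y' c x y; apply/funext => e; apply/funext => n; apply: itw_linl.
- by move=> j j' y c x y'; apply/funext => e; apply/funext => n; apply: itw_linr.
- by move=> *; apply/funext => e; apply/funext => n; apply: JE.
- by move=> *; apply/funext => e; apply/funext => n; apply: JE'.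
have YE j j' y y' e n : Y (i j y) (i' j' y') e n = J j j' y y' e n by rewrite YE0.
have Yl b e k : linear (fun a => Y a b e k) by move=> c x y; rewrite Yl0.
have Yr a e k : linear (fun b => Y a b e k) by move=> c x y; rewrite Yr0.
have Yp a b e : exists K : nat, forall k, (K <= k)%N -> Y a b e k = 0.
  move: a b; apply: bilin_colimit_ind => [x|a|j j' y y']; last first.
  - by have [K KP] := itw_poly (J j j') y y' e; exists K => k /KP; rewrite YE.
  - split=> [|c y z [K KP] [K' KP']]; first by exists 0%N => k _; rewrite (lin0 (Yr _ _ _)).
    exists (maxn K K') => k; rewrite geq_max => /andP[/KP yk /KP' zk].
    by rewrite Yr yk zk scaler0 addr0.
  - split=> [|c y z [K KP] [K' KP']]; first by exists 0%N => k _; rewrite (lin0 (Yl _ _ _)).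
    exists (maxn K K') => k; rewrite geq_max => /andP[/KP yk /KP' zk].
    by rewrite Yl yk zk scaler0 addr0.
have Yt a b h : exists K : nat, forall n k, (K <= n)%N -> coef Y k a (h + n%:R) b = 0.
  rewrite /coef; move: a b; apply: bilin_colimit_ind => [x|a|j j' y y']; last first.
  - by have [K KP] := itw_trunc (J j j') y y' h; exists K => n k /(KP _ k); rewrite YE.
  - split=> [|c y z [K KP] [K' KP']]; first by exists 0%N => n k _; rewrite (lin0 (Yr _ _ _)).
    exists (maxn K K') => n k; rewrite geq_max => /andP[/(KP _ k) yk /(KP' _ k) zk].
    by rewrite Yr yk zk scaler0 addr0.
  - split=> [|c y z [K KP] [K' KP']]; first by exists 0%N => n k _; rewrite (lin0 (Yl _ _ _)).
    exists (maxn K K') => n k; rewrite geq_max => /andP[/(KP _ k) yk /(KP' _ k) zk].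
    by rewrite Yl yk zk scaler0 addr0.
have Ytr k : trunc_itw (coef Y k).
  by move=> a b h; have [K KP] := Yt a b h; exists K => n /KP.
have cl k h b : linear (fun a => coef Y k a h b) by move=> c x y; rewrite /coef Yl.
have cr k a h : linear (coef Y k a h) by move=> c x y; rewrite /coef Yr.
have Yj k : jacobi act act act (coef Y k).
  move=> v a b l m h.
  apply: (bilin_colimit_ind (P := fun a b => jacobi_lhs act act (coef Y k) v a b l m h =
    jacobi_rhs act (coef Y k) v a b l m h)) => {a b} [x|a|j j' y y'].
  - have ll := @jacobi_lhs_linl _ _ _ _ _ _
      _ _ _ (coef Y k) (@act_linr _ _ Z) (cl k) (cr k)
      (@act_trunc _ _ A) (@act_trunc _ _ X) (Ytr k) v x l m h.
    have lr := @jacobi_rhs_linl _ _ _ _ _ _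
      _ _ _ (coef Y k) (@act_linr _ _ A) (@act_linr _ _ Z) (cl k) (cr k)
      (@act_trunc _ _ A) (@act_trunc _ _ X) (Ytr k) v x l m h.
    split=> [|c y z yE zE]; first by rewrite (lin0 ll) (lin0 lr).
    by rewrite ll lr yE zE.
  - have ll := @jacobi_lhs_linr _ _ _ _ _ _
      _ _ _ (coef Y k) (@act_linr _ _ X) (@act_linr _ _ Z) (cl k) (cr k)
      (@act_trunc _ _ A) (@act_trunc _ _ X) (Ytr k) v a l m h.
    have lr := @jacobi_rhs_linr _ _ _ _ _ _
      _ _ _ (coef Y k) (@act_linr _ _ Z) (cl k) (cr k)
      (@act_trunc _ _ A) (@act_trunc _ _ X) (Ytr k) v a l m h.
    split=> [|c y z yE zE]; first by rewrite (lin0 ll) (lin0 lr).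
    by rewrite ll lr yE zE.
  - have := itw_jacobiE (J j j') k v y y' l m h.
    apply: (jacobi_push (f1 := i j) (f2 := i' j') (f3 := id)) => //.
    + by move=> *; apply: act_linr.
    + by move=> *; apply: itw_linl.
    + by move=> *; apply: itw_linr.
    + exact: act_trunc.
    + exact: act_trunc.
    + exact: itw_trunc_itw.
    + by move=> *; apply: vhom_act.
    + by move=> *; apply: vhom_act.
    + by move=> *; rewrite /coef YE.
have Yd a b : Y (vir A (-1) a) b = fser_deriv (Y a b).
  apply/funext => e; apply/funext => n; rewrite /fser_deriv.
  move: a b; apply: bilin_colimit_ind => [x|a|j j' y y'].
  - split=> [|c y z yE zE]; first by rewrite /vir (lin0 (act_linr _ _)) !(lin0 (Yl _ _ _)) !scaler0 addr0.
    rewrite /vir act_linr !Yl yE zE !scalerDr !scalerA ![c * _]mulrC.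
    by rewrite -!addrA; congr (_ + _); rewrite addrCA.
  - split=> [|c y z yE zE]; first by rewrite !(lin0 (Yr _ _ _)) !scaler0 addr0.
    rewrite !Yr yE zE !scalerDr !scalerA ![c * _]mulrC.
    by rewrite -!addrA; congr (_ + _); rewrite addrCA.
  - by rewrite /vir -vhom_act !YE [J j j' _ _]itw_deriv.
by exists (@Intertwining R V A X Z Y Yl Yr Yp Yt Yj Yd).
Qed.

End Gluing.

(** Presents the factor that stays fixed when only the other one varies along a diagram. *)
Lemma lin_colimit_point A :
  lin_colimit (I := unit) (N := fun _ => A) (fun _ _ _ => False) (fun _ => vhom_id A).
Proof.
split=> // [x|F phi lphi _]; first by apply: sub_span; exists tt, x.
by exists (phi tt) => // -[] x.
Qed.

Section TensorProducts.
Variable D : gmod V -> Prop.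
Hypothesis D_quot : closed_quotients D.

(** The target [Z] may lie outside [D], so uniqueness cannot be applied to it directly. The quotient
    of [T] by the kernel of [f - g] does lie in [D]; its projection kills the coefficients of [Y],
    hence equals 0, and the kernel is all of [T]. *)
Lemma tensor_hom_eq A B T (Y : intertwining A B T) (Z : gmod V) (f g : vhom T Z) :
  D T -> is_tensor_product D Y ->
  (forall a b e k, f (Y a b e k) = g (Y a b e k)) -> f = g.
Proof.
move=> DT univ fg; pose h := vhom_add f (vhom_opp g).
have [Q [q [qsurj q0]]] := quot_gmod_exists (ker_submodule h).
have DQ : D Q by apply: (D_quot (f := q)) DT => y _; have [x <-] := qsurj y; exists x.
have [p [_ pE]] := univ Q DQ (itw_post q Y).
have : q = vhom_zero T Q.
  rewrite -(pE q)// -(pE (vhom_zero T Q))// => a b e k /=; apply/esym/q0.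
  by rewrite /= fg subrr.
move=> qE; apply: vhomP => x; apply/eqP; rewrite -subr_eq0; apply/eqP.
by apply/(q0 x); rewrite qE.
Qed.

End TensorProducts.

End Intertwining.

(** * Weights and formal series *)

Section Eigen.
Variables (K : fieldType) (M : lmodType K) (L : M -> M).
Hypothesis lL : linear L.
Notation D h := (fun x => L x - h *: x).

Lemma eigen_iterC g h n x : iter n (D g) (D h x) = D h (iter n (D g) x).
Proof.
elim: n => //= n ->; rewrite !(linB lL) !(linZ lL) !scalerBr !scalerA.
by rewrite !opprB mulrC -!addrA; congr (_ + _); rewrite addrC [RHS]addrC addrAC.
Qed.

Lemma gen_eigen_iter g h n x : gen_eigen L h x -> gen_eigen L h (iter n (D g) x).
Proof.
move=> [m mx]; exists m; rewrite -(lin0 (eigen_iter_linear lL g n)) -mx.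
by elim: m {mx} => //= m ->; rewrite eigen_iterC.
Qed.

(** By induction [L x - h *: x] vanishes, so [x] is a true eigenvector on which the powers of
    [L - g] act by powers of the nonzero scalar [h - g]. *)
Lemma gen_eigen_disjoint g h x : g != h -> gen_eigen L g x -> gen_eigen L h x -> x = 0.
Proof.
move=> gh [m mx] [n]; elim: n x mx => [//|n IH] x mx nx.
have Lx : L x = h *: x.
  apply/eqP; rewrite -subr_eq0; apply/eqP/IH; last by rewrite -iterSr.
  by rewrite eigen_iterC mx (lin0 lL) scaler0 subr0.
move: mx; have -> k : iter k (D g) x = (h - g) ^+ k *: x.
  elim: k => [|k IHk]; first by rewrite scale1r.
  by rewrite iterS IHk (linZ lL) Lx !scalerA -scalerBl exprS mulrBl mulrC.
move=> /eqP; rewrite scaler_eq0 expf_eq0 subr_eq0 eq_sym (negPf gh) andbF /=.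
by move/eqP.
Qed.

(** A power of [L - g] kills the first summand; by induction it kills [y] too, which puts [y] in two
    different generalized eigenspaces. *)
Lemma gen_eigen_sum0 h y (s : seq M) : gen_eigen L h y ->
  (forall x, x \in s -> exists2 g, g != h & gen_eigen L g x) ->
  y = \sum_(x <- s) x -> y = 0.
Proof.
have [n ns] := ubnP (size s); elim: n s y ns => // n IH [|x s] y /= ns yh sP.
  by rewrite big_nil.
have [g gh [m mx]] := sP x (mem_head _ _).
rewrite big_cons => yE; apply: (gen_eigen_disjoint gh) => //; exists m.
have lm := eigen_iter_linear lL g m.
apply: (IH (map (iter m (D g)) s)); rewrite ?size_map//.
- exact: gen_eigen_iter.
- move=> _ /mapP[z zs ->]; have [|g' g'h z_] := sP z; first by rewrite inE zs orbT.
  by exists g' => //; apply: gen_eigen_iter.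
- by rewrite yE (linD lm) mx add0r (lin_sum lm) big_map.
Qed.

End Eigen.

Section Weights.
Variables (R : realType) (V : voa R).
Implicit Types (M N : gmod V) (h g : R[i]).

Lemma vir_linear {M} n : linear (vir M n).
Proof. exact: act_linr. Qed.

Lemma vir_vhom M N (f : vhom M N) n x : f (vir M n x) = vir N n (f x).
Proof. exact: vhom_act. Qed.

Lemma wt_space_subspace {M} h : subspace (@wt_space R V M h).
Proof. exact: (@gen_eigen_subspace _ M (vir M 0) (@vir_linear M 0) h). Qed.

Lemma wt_space_vhom M N (f : vhom M N) h x : wt_space h x -> wt_space h (f x).
Proof. exact: (@gen_eigen_map _ M N (vir M 0) (vir N 0) f (vhom_linear f) (vir_vhom f 0) h x). Qed.

(** The complement of a weight space, in the form in which [wt_proj] asks for it. *)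
Definition off_wt M h (x : M) := exists s : seq M,
  (forall z, z \in s -> exists2 g, g != h & wt_space g z) /\ x = \sum_(z <- s) z.

Lemma off_wt_subspace {M} h : subspace (@off_wt M h).
Proof.
split=> [|c x y [s [sP ->]] [t [tP ->]]]; first by exists [::]; rewrite big_nil.
exists ([seq c *: x | x <- s] ++ t); rewrite big_cat big_map scaler_sumr.
split=> // z; rewrite mem_cat => /orP[/mapP[w ws ->]|/tP//].
by have [g gh wg] := sP w ws; exists g => //; exact: (subspaceZ c (wt_space_subspace g) wg).
Qed.

Lemma off_wt_vhom M N (f : vhom M N) h x : off_wt h x -> off_wt h (f x).
Proof.
move=> [s [sP ->]]; exists (map f s); rewrite (lin_sum (vhom_linear f)) big_map; split=> //.
by move=> _ /mapP[y ys ->]; have [g gh gy] := sP y ys; exists g => //; apply: wt_space_vhom.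
Qed.

Lemma wt_decomp M h (x : M) : exists2 y, wt_space h y & off_wt h (x - y).
Proof.
have [s [sP ->]] := gmod_graded x.
elim: s sP => [|z s IH] sP.
  exists 0; first exact: (wt_space_subspace h).1.
  by rewrite big_nil subrr; apply: (off_wt_subspace h).1.
have [|y yh yo] := IH; first by move=> x' xs; apply: sP; rewrite inE xs orbT.
have [g gz] := sP z (mem_head _ _); rewrite big_cons.
have [gh|gh] := eqVneq g h.
  exists (z + y); first by apply: subspaceD (wt_space_subspace h) _ _ => //; rewrite -gh.
  by rewrite opprD addrACA subrr add0r.
exists y => //; rewrite -addrA; apply: subspaceD (off_wt_subspace h) _ _ => //.
exists [:: z]; rewrite big_seq1; split=> // w; rewrite inE => /eqP ->.
by exists g.
Qed.

(** The grading supplies a decomposition, so the default value 0 in [wt_proj] is never reached for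
    want of one. *)
Lemma wt_projP M h (x : M) : wt_space h (wt_proj h x) /\ off_wt h (x - wt_proj h x).
Proof.
rewrite /wt_proj; case: xgetP => [y _ [yh [s [sP ->]]]|none].
  by rewrite addrC addKr; split=> //; exists s.
have [y yh [s [sP xE]]] := wt_decomp h x.
case: (none y); split=> //; exists s; split=> //.
by rewrite -xE addrC subrK.
Qed.

Lemma wt_projE M h (x y : M) : wt_space h y -> off_wt h (x - y) -> wt_proj h x = y.
Proof.
move=> yh yo; have [ph po] := wt_projP h x.
apply/eqP; rewrite -subr_eq0; apply/eqP.
have [s [sP sE]] := subspaceB (off_wt_subspace h) yo po.
apply: (gen_eigen_sum0 (vir_linear 0) _ sP); last first.
  by rewrite -sE opprB [RHS]addrC subrKA.
exact: subspaceB (wt_space_subspace h) _ _.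
Qed.

Lemma wt_proj_vhom M N (f : vhom M N) h x : wt_proj h (f x) = f (wt_proj h x).
Proof.
have [ph po] := wt_projP h x; apply: wt_projE; first exact: wt_space_vhom.
by rewrite -vhomB; apply: off_wt_vhom.
Qed.

Lemma wt_projD M h (x y : M) : wt_proj h (x + y) = wt_proj h x + wt_proj h y.
Proof.
have [[xh xo] [yh yo]] := (wt_projP h x, wt_projP h y); apply: wt_projE.
  exact: subspaceD (wt_space_subspace h) _ _.
by rewrite opprD addrACA; apply: subspaceD (off_wt_subspace h) _ _.
Qed.

Lemma wt_proj_off M g h (x : M) : g != h -> wt_space g x -> wt_proj h x = 0.
Proof.
move=> gh xg; apply: wt_projE; first exact: (wt_space_subspace h).1.
rewrite subr0; exists [:: x]; rewrite big_seq1; split=> // w.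
by rewrite inE => /eqP ->; exists g.
Qed.

Lemma wt_proj0 M h : wt_proj h (0 : M) = 0.
Proof.
apply: wt_projE; first exact: (wt_space_subspace h).1.
by rewrite subrr; apply: (off_wt_subspace h).1.
Qed.

Section ItwWeights.
Variables (A B Z : gmod V) (Y : intertwining A B Z).

Lemma bincoef0 (K : fieldType) n : bincoef K n 0 = 1.
Proof. by rewrite /bincoef expr0 big_ord0 fact0 divr1 mulr1. Qed.

Lemma bincoef_small (K : fieldType) (n i : nat) : (n < i)%N -> bincoef K n%:Z i = 0.
Proof.
move=> ni; rewrite /bincoef (bigD1 (Ordinal ni))//= subrr !mul0r mulr0//.
Qed.

(* The coefficient (l, m) = (0, 1) of the Jacobi identity for the conformal
   vector, combined with the L_{-1}-derivative property. *)
Lemma itw_L0 a b e k : vir Z 0 (Y a b e k) =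
  Y (vir A 0 a) b e k + Y a (vir B 0 b) e k + e *: Y a b e k + k.+1%:R *: Y a b e k.+1.
Proof.
(* [coef] at [h] reads the exponent [- h - 1], so [- e - 1] selects the exponent [e]. On the left
   only i = 0 survives. On the right i = 0 gives the L_{-1} term and i = 1 the L_0 term; the
   coefficient, up to sign binom(i - 2, i), is 0 from i = 2 on. *)
have := itw_jacobiE Y k (conf V) a b 0 1 (- e - 1).
have z3 i : (2 <= i)%N -> bincoef R[i] (i%:Z - 1 - 1) i = 0.
  by move=> i2; rewrite -addrA -[- 1 - 1]/(- 2%:Z) subzn// bincoef_small// ltn_subrL; case: i i2.
rewrite /jacobi_lhs /jacobi_rhs [RHS](@fsum_nat _ _ 2) ?(@fsum_nat _ _ 1); first last.
- by move=> i i2; rewrite z3// scale0r.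
- by move=> i i1; rewrite bincoef_small// scale0r.
- by move=> i i1; rewrite bincoef_small// mulr0 scale0r.
rewrite !big_ord_recr !big_ord0 /= !add0r !bincoef0 expr0z mul1r !scale1r.
rewrite /bincoef big_ord1 expr1 -[1`!%N]/1%N divr1 mulN1r.
have -> : - e - 1 + 0%:~R - 0 = - e - 1 :> R[i] by ring.
have -> : - e - 1 + 1%:~R - 0 = - e :> R[i] by ring.
have -> : - e - 1 + 0 = - e - 1 :> R[i] by ring.
have -> : - e - 1 + 1%:~R - 1 = - e - 1 :> R[i] by ring.
have -> : - ((-1)%:~R - (@ord0 0)%:R) = 1 :> R[i] by rewrite subr0 mulrN1z opprK.
rewrite scale1r -[1 + 0 - 0%Z]/(0 + 1 : int) -[1%Z]/(0 + 1 : int).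
rewrite -[0%Z]/(-1 + 1 : int) -![act (conf V) _ _]/(vir _ _ _) /coef.
have -> : - (- e - 1) - 1 = e by ring.
rewrite itw_deriv /fser_deriv opprK subrK => /eqP; rewrite subr_eq => /eqP ->.
by rewrite -addrA addrC !addrA.
Qed.

(** By [itw_L0], L_0 - (h1 + h2 + e) turns a coefficient into those of (L_0 - h1) a and (L_0 - h2) b
    plus a multiple of the one at the next power of log x. The first two have a smaller total
    nilpotency order [n1 + n2]. *)
Lemma itw_wt_hom h1 h2 a b e k : wt_space h1 a -> wt_space h2 b ->
  wt_space (h1 + h2 + e) (Y a b e k).
Proof.
move=> [n1 n1a] [n2 n2b]; have [n ln] := ubnP (n1 + n2).
elim: n n1 n2 a b ln n1a n2b k => // n IH n1 n2 a b; rewrite ltnS => ln n1a n2b.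
have [K KP] := itw_poly Y a b e.
(* Descending induction on the power of the logarithm, started at the bound from which the
   coefficients vanish. *)
suff H d k : (K <= k + d)%N -> wt_space (h1 + h2 + e) (Y a b e k).
  by move=> k; apply: (H K); rewrite leq_addl.
elim: d k => [|d IHd] k Kk.
  by rewrite KP; [exact: (wt_space_subspace _).1|rewrite addn0 in Kk].
set W := wt_space _; have Ws : subspace W by exact: wt_space_subspace.
have : W (vir Z 0 (Y a b e k) - (h1 + h2 + e) *: Y a b e k).
  have -> : vir Z 0 (Y a b e k) - (h1 + h2 + e) *: Y a b e k =
      Y (vir A 0 a - h1 *: a) b e k + Y a (vir B 0 b - h2 *: b) e k +
      k.+1%:R *: Y a b e k.+1.
    rewrite itw_L0 (linB (itw_linl Y b e k)) (linB (itw_linr Y a e k)).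
    rewrite (linZ (itw_linl Y b e k)) (linZ (itw_linr Y a e k)) !scalerDl.
    rewrite !opprD !addrA; set x := Y _ b e k; set y := Y a _ e k.
    set z := e *: _; set u := k.+1%:R *: _; set p := h1 *: _; set q := h2 *: _.
    rewrite [x + y + z + u]addrAC [_ - q - z]addrAC [_ - p - z]addrAC addrK.
    by rewrite [x + y + u - p]addrAC [_ + u - q]addrAC [x + y - p]addrAC.
  apply: (subspaceD Ws); first apply: (subspaceD Ws).
  - case: n1 n1a ln => [/= a0 _|n1 n1a ln]; last by apply: (IH n1 n2) => //; rewrite -iterSr.
    by rewrite a0 (lin0 (vir_linear 0)) scaler0 subrr (lin0 (itw_linl _ _ _ _)); case: Ws.
  - case: n2 n2b ln => [/= b0 _|n2 n2b ln]; last by apply: (IH n1 n2); rewrite -?iterSr// -ltnS -addnS.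
    by rewrite b0 (lin0 (vir_linear 0)) scaler0 subrr (lin0 (itw_linr _ _ _ _)); case: Ws.
  - by apply: subspaceZ Ws _; apply: IHd; rewrite addSnnS.
by move=> [m mP]; exists m.+1; rewrite iterSr.
Qed.

(** For homogeneous [a] and [b] only the exponent [h - h1 - h2] contributes to weight [h], with
    finitely many powers of log x; general vectors are finite sums of these. This makes [fser_eval]
    a true finite sum in each weight. *)
Lemma itw_support_fin a b h :
  finite_set [set p : R[i] * nat | wt_proj h (Y a b p.1 p.2) <> 0].
Proof.
have [s [sP ->]] := gmod_graded a; have [t [tP ->]] := gmod_graded b.
have sub0 (F G H : R[i] * nat -> Z) : (forall p, F p = G p + H p) ->
    finite_set [set p | G p <> 0] -> finite_set [set p | H p <> 0] ->
    finite_set [set p | F p <> 0].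
  move=> FE fG fH; apply: sub_finite_set (_ : finite_set ([set p | G p <> 0] `|` [set p | H p <> 0])).
    move=> p /= Fp; apply: contrapT => /not_orP[/contrapT G0 /contrapT H0]; apply: Fp.
    by rewrite FE G0 H0 addr0.
  by rewrite finite_setU.
have fin0 (F : R[i] * nat -> Z) : (forall p, F p = 0) -> finite_set [set p | F p <> 0].
  by move=> F0; rewrite (_ : [set p | _] = set0)//; apply/seteqP; split=> p //=; rewrite F0.
elim: s sP => [|x s IHs] sP.
  by apply: fin0 => p; rewrite big_nil (lin0 (itw_linl _ _ _ _)) wt_proj0.
rewrite big_cons; apply: (sub0 _ (fun p => wt_proj h (Y x (\sum_(y <- t) y) p.1 p.2))
    (fun p => wt_proj h (Y (\sum_(y <- s) y) (\sum_(y <- t) y) p.1 p.2))).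
- by move=> p; rewrite (linD (itw_linl _ _ _ _)) wt_projD.
- have [h1 xh] := sP x (mem_head _ _); elim: t tP {IHs} => [|y t IHt] tP.
    by apply: fin0 => p; rewrite big_nil (lin0 (itw_linr _ _ _ _)) wt_proj0.
  rewrite big_cons; apply: (sub0 _ (fun p => wt_proj h (Y x y p.1 p.2))
      (fun p => wt_proj h (Y x (\sum_(y <- t) y) p.1 p.2))).
  + by move=> p; rewrite (linD (itw_linr _ _ _ _)) wt_projD.
  + have [h2 yh] := tP y (mem_head _ _); have [K KP] := itw_poly Y x y (h - h1 - h2).
    apply: (@sub_finite_set _ _ ((fun k => (h - h1 - h2, k)) @` `I_K)).
      move=> [e k] /= ne0; have [eh|eh] := eqVneq (h1 + h2 + e) h; last first.
        by case: ne0; apply: wt_proj_off eh _; apply: itw_wt_hom.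
      have -> : e = h - h1 - h2 by rewrite -eh; ring.
      exists k => //=; rewrite ltnNge; apply/negP => /KP Y0; apply: ne0.
      by rewrite (_ : e = h - h1 - h2) ?Y0 ?wt_proj0// -eh; ring.
    by apply: finite_image; apply: finite_II.
  + by apply: IHt => z zt; apply: tP; rewrite inE zt orbT.
- by apply: IHs => z zs; apply: sP; rewrite inE zs orbT.
Qed.

Lemma fser_eval_vhom Z' (f : vhom Z Z') a b r h :
  f (fser_eval (Y a b) r h) = fser_eval (fun e k => f (Y a b e k)) r h.
Proof.
rewrite /fser_eval (lin_fsum (vhom_linear f)); last first.
  apply: sub_finite_set (itw_support_fin a b h) => p [_ /= pn0] p0; apply: pn0.
  by rewrite p0 scaler0.
by apply: eq_fsbigr => p _; rewrite (linZ (vhom_linear f)) wt_proj_vhom.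
Qed.

End ItwWeights.
End Weights.

Section SeriesMaps.
Variables (R : realType) (V : voa R).
Implicit Types (A B M N Z W : gmod V).

Lemma itw_product_vhom A B Z P W A' B' Z' P' W'
    (Y1 : intertwining A P W) (Y2 : intertwining B Z P)
    (Y1' : intertwining A' P' W') (Y2' : intertwining B' Z' P')
    (a : vhom A A') (b : vhom B B') (c : vhom Z Z') (p : vhom P P') (w : vhom W W') :
  (forall x y e k, Y2' (b x) (c y) e k = p (Y2 x y e k)) ->
  (forall x y e k, Y1' (a x) (p y) e k = w (Y1 x y e k)) ->
  forall x y z r1 r2 h g, itw_product Y1' Y2' (a x) (b y) (c z) r1 r2 h g =
    w (itw_product Y1 Y2 x y z r1 r2 h g).
Proof.
move=> E2 E1 x y z r1 r2 h g; rewrite /itw_product.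
have -> : Y2' (b y) (c z) = (fun e k => p (Y2 y z e k)).
  by apply/funext => e; apply/funext => k.
have <- := fser_eval_vhom Y2 p y z r2 h; set q := fser_eval (Y2 y z) r2 h.
have -> : Y1' (a x) (p q) = (fun e k => w (Y1 x q e k)).
  by apply/funext => e; apply/funext => k.
exact: esym (fser_eval_vhom Y1 w _ _ _ _).
Qed.

Lemma itw_iterate_vhom A B Z P W A' B' Z' P' W'
    (Y1 : intertwining P Z W) (Y2 : intertwining A B P)
    (Y1' : intertwining P' Z' W') (Y2' : intertwining A' B' P')
    (a : vhom A A') (b : vhom B B') (c : vhom Z Z') (p : vhom P P') (w : vhom W W') :
  (forall x y e k, Y2' (a x) (b y) e k = p (Y2 x y e k)) ->
  (forall x y e k, Y1' (p x) (c y) e k = w (Y1 x y e k)) ->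
  forall x y z r0 r2 h g, itw_iterate Y1' Y2' (a x) (b y) (c z) r0 r2 h g =
    w (itw_iterate Y1 Y2 x y z r0 r2 h g).
Proof.
move=> E2 E1 x y z r1 r2 h g; rewrite /itw_iterate.
have -> : Y2' (a x) (b y) = (fun e k => p (Y2 x y e k)).
  by apply/funext => e; apply/funext => k.
have <- := fser_eval_vhom Y2 p x y r1 h; set q := fser_eval (Y2 x y) r1 h.
have -> : Y1' (p q) (c z) = (fun e k => w (Y1 q z e k)).
  by apply/funext => e; apply/funext => k.
exact: esym (fser_eval_vhom Y1 w _ _ _ _).
Qed.

(** Module maps preserve weights, so a functional of the graded dual of [N] composed with [f] lies
    in that of [M], where convergence is known. *)
Lemma compl_sum_vhom M N (f : vhom M N) u z : compl_sum u z ->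
  compl_sum (fun h g => f (u h g)) (fun g => f (z g)).
Proof.
move=> [zc zs]; split=> [h|phi [lphi [s sP]]]; first exact: wt_space_vhom.
apply: (zs (fun x => phi (f x))); split.
  by move=> c x y; rewrite vhom_linear lphi.
by exists s => h m hs mh; apply: sP hs _; apply: wt_space_vhom.
Qed.

Lemma fser_int_fin (T : zmodType) (F : int -> T) (e : R[i]) :
  finite_set ([set n : int | n%:~R = e] `&` F @^-1` [set~ 0]).
Proof.
apply: sub_finite_set (@subIsetl _ _ _) _.
have [[n ne]|none] := pselect (exists n : int, n%:~R = e); last first.
  by rewrite (_ : [set n | _] = set0)//; apply/seteqP; split=> n //= ne; apply: none; exists n.
apply: (@sub_finite_set _ _ [set n]); last exact: finite_set1.
by move=> m /=; rewrite -ne => /intr_inj.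
Qed.

Lemma fser_int_vhom M N (f : vhom M N) (F : int -> M) e k :
  f (fser_int F e k) = fser_int (fun n => f (F n)) e k.
Proof.
rewrite /fser_int; case: ifP => _; last exact: vhom0.
exact/(lin_fsum (vhom_linear f))/fser_int_fin.
Qed.

Lemma mod_series_vhom M N (f : vhom M N) v m e k :
  f (mod_series v m e k) = mod_series v (f m) e k.
Proof.
rewrite /mod_series fser_int_vhom; congr (fser_int _ _ _); apply/funext => n.
exact: vhom_act.
Qed.

Lemma mod_series_neg_vhom M N (f : vhom M N) v m e k :
  f (mod_series_neg v m e k) = mod_series_neg v (f m) e k.
Proof.
rewrite /mod_series_neg fser_int_vhom; congr (fser_int _ _ _); apply/funext => n.
by rewrite (linZ (vhom_linear f)) vhom_act.
Qed.

Lemma mod_series_neg_trunc M v (m : M) (e : R[i]) :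
  exists K : nat, forall j k, (K <= j)%N -> mod_series_neg v m (e - j%:R) k = 0.
Proof.
have [[n ne]|none] := pselect (exists n : int, n%:~R = e).
  have [K KP] := trunc_actN v m (- n - 1) (@act_trunc _ _ M).
  exists K => j k Kj; rewrite /mod_series_neg /fser_int; case: ifP => // _.
  rewrite fsbig1// => i /= ie; have -> : i = n - j%:Z.
    by apply: (@intr_inj R[i]); rewrite ie rmorphB /= ne.
  have -> : - (n - j%:Z) - 1 = - n - 1 + j%:Z by ring.
  by rewrite KP// scaler0.
exists 0%N => j k _; rewrite /mod_series_neg /fser_int; case: ifP => // _.
rewrite fsbig1// => i /= ie; case: none; exists (i + j%:Z).
by rewrite rmorphD /= ie subrK.
Qed.

Lemma iter_vir_vhom M N (f : vhom M N) n j x :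
  f (iter j (vir M n) x) = iter j (vir N n) (f x).
Proof. by elim: j => //= j <-; rewrite vir_vhom. Qed.

Lemma iter_vir0 M n j : iter j (vir M n) 0 = 0.
Proof. by elim: j => //= j ->; exact: (lin0 (vir_linear n)). Qed.

Lemma fser_exp_xL_vhom M N (f : vhom M N) (s : fser M) e k :
  (exists K : nat, forall j, (K <= j)%N -> s (e - j%:R) k = 0) ->
  f (fser_exp_xL s e k) = fser_exp_xL (fun e k => f (s e k)) e k.
Proof.
move=> [K KP]; rewrite /fser_exp_xL (lin_fsum (vhom_linear f)).
  by apply: eq_fsbigr => j _; rewrite (linZ (vhom_linear f)) iter_vir_vhom.
by apply: (@finite_nat_support _ _ K) => j /KP ->; rewrite iter_vir0 scaler0.
Qed.

Lemma fser_rot_vhom M N (f : vhom M N) (s : fser M) e k :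
  (exists K : nat, forall j, (K <= j)%N -> s e j = 0) ->
  f (fser_rot s e k) = fser_rot (fun e k => f (s e k)) e k.
Proof.
move=> [K KP]; rewrite /fser_rot (lin_fsum (vhom_linear f)).
  by apply: eq_fsbigr => j _; rewrite (linZ (vhom_linear f)).
apply: (@sub_finite_set _ _ `I_K) => [j [_ /= ns]|]; last exact: finite_II.
by rewrite ltnNge; apply/negP => /KP sj; apply: ns; rewrite sj scaler0.
Qed.

(** Lower truncation bounds the exponential of L_{-1}, and polynomiality in log x bounds the
    rotation, so [f] passes through both sums. *)
Lemma skew_vhom A B M N (Y : intertwining A B M) (f : vhom M N) a b e k :
  f (fser_exp_xL (fser_rot (Y a b)) e k) =
  fser_exp_xL (fser_rot (fun e k => f (Y a b e k))) e k.
Proof.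
rewrite fser_exp_xL_vhom; last first.
  have [K KP] := itw_trunc Y a b (- e - 1); exists K => j Kj.
  rewrite /fser_rot fsbig1// => i _.
  have := KP j i Kj; rewrite /coef (_ : - (- e - 1 + j%:R) - 1 = e - j%:R); last by ring.
  by move=> ->; rewrite scaler0.
have -> : (fun e k => f (fser_rot (Y a b) e k)) = fser_rot (fun e k => f (Y a b e k)).
  apply/funext => e'; apply/funext => k'.
  by apply: fser_rot_vhom; exact: itw_poly.
by [].
Qed.

End SeriesMaps.

(** * Colimits and additivity of the closure under unions *)

Section Colimits.
Variables (R : realType) (V : voa R) (C0 : gmod V -> Prop).
Hypothesis C0_coprod : closed_fin_coproducts C0.
Hypothesis C0_quot : closed_quotients C0.
Hypothesis C0_V : C0 (voa_gmod V).
Local Notation C := (union_closure C0).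
Variables (J : category) (F : functor J (full_sub C)).

Definition functor_edge (j k : J) (w : vhom (F j : subob C) (F k : subob C)) : Prop :=
  exists u : hom j k, w = fmor F u.

Lemma lin_colimit_colimit (L : subob C) (i : forall j, vhom (F j : subob C) L) :
  lin_colimit functor_edge i -> @is_colimit J (full_sub C) F L i.
Proof.
move=> lc; split=> [j k u|L' i' i'E].
  by apply: vhomP => x; apply: (lc_cocone lc); exists u.
have [|f fE] := lc_vhom (Z := (L' : subob C)) (h := i') lc.
  by move=> j k _ [u ->] x; rewrite -[in RHS](i'E j k u).
exists f; split=> [j|g gE]; first by apply: vhomP => x; apply: fE.
by apply: (lc_vhom_eq lc) => j x; rewrite fE -gE.
Qed.

(** Objects of [J] are only covered by a small type [I], so the colimit is built over [I] and the
    leg at [j] goes through a chosen index of [j]. *)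
Lemma functor_lin_colimit : small_category J ->
  exists (L : subob C) (i : forall j, vhom (F j : subob C) L), lin_colimit functor_edge i.
Proof.
move=> [[I [g gsurj]] _].
pose E (j k : I) (w : vhom (F (g j) : subob C) (F (g k) : subob C)) :=
  exists u : hom (g j) (g k), w = fmor F u.
have [L [i lc]] := lin_colimit_exists E.
have CL : C L by apply: (C_lin_colimit C0_coprod C0_quot C0_V _ lc) => j; apply: subobP.
pose s j := sval (cid (gsurj j)).
have gs j : g (s j) = j by rewrite /s; case: cid.
(* The equality of [g (s j)] and [j] is turned into a pair of morphisms, which spares all later
   transports along it. *)
have iso_ex j : exists u : hom j (g (s j)) * hom (g (s j)) j, u.2 \c u.1 = idm j.
  by rewrite gs; exists (idm j, idm j); rewrite comp1m.
pose u j := sval (cid (iso_ex j)).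
have uK j : (u j).2 \c (u j).1 = idm j by rewrite /u; case: cid.
pose Fu (j k : J) (w : hom j k) : vhom (F j : subob C) (F k : subob C) := fmor F w.
have FuM j k l (w : hom k l) (w' : hom j k) x : Fu j l (w \c w') x = Fu k l w (Fu j k w' x).
  by rewrite /Fu fmorM.
have Fu1 j x : Fu j j (idm j) x = x by rewrite /Fu fmor1.
have iE j k (w : hom (g j) (g k)) x : i k (Fu _ _ w x) = i j x.
  by apply: (lc_cocone lc); exists w.
exists (Subob CL), (fun j => vhom_comp (i (s j)) (Fu _ _ (u j).1)).
have legE k x : i (s (g k)) (Fu _ _ (u (g k)).1 x) = i k x.
  by rewrite -(iE _ _ (u (g k)).2 (Fu _ _ _ x)) -FuM uK Fu1.
split=> [j k _ [w ->] x|x|G phi lphi phiE] /=.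
- rewrite -[fmor F w]/(Fu _ _ w) -FuM.
  rewrite -(iE _ _ ((u k).1 \c w \c (u j).2) (Fu _ _ (u j).1 x)) -FuM.
  by rewrite -compA uK compm1.
- have Ss := span_subspace [set y | exists j z, y = i (s j) (Fu _ _ (u j).1 z)].
  apply: (span_min Ss) (lc_span lc x) => _ [j [z ->]].
  by apply: sub_span; exists (g j), z; rewrite legE.
have [||f lf fE] := lc_univ lc (phi := fun j => phi (g j)).
- by move=> j; apply: lphi.
- by move=> j k _ [w ->] x; apply: phiE; exists w.
exists f => // j x; rewrite fE.
by apply: (phiE j (g (s j)) (Fu _ _ (u j).1)); exists (u j).1.
Qed.

(** A categorical colimit is isomorphic to the constructed one and inherits its linear universal
    property; this lets cocontinuity treat arbitrary colimits. *)
Lemma colimit_lin_colimit (L : subob C) (i : forall j, vhom (F j : subob C) L) :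
  small_category J -> @is_colimit J (full_sub C) F L i -> lin_colimit functor_edge i.
Proof.
move=> Js [ic iu]; have [L' [i' lc]] := functor_lin_colimit Js.
have [i'c i'u] := lin_colimit_colimit lc.
have [f [fE _]] := i'u L i ic; have [g [gE _]] := iu L' i' i'c.
have fE' j x : (f : vhom _ _) (i' j x) = i j x.
  exact: (congr1 (fun h : vhom (F j : subob C) L => h x) (fE j)).
have gE' j x : (g : vhom _ _) (i j x) = i' j x.
  exact: (congr1 (fun h : vhom (F j : subob C) L' => h x) (gE j)).
have gf : vhom_comp g f = vhom_id L'.
  have [k [_ kU]] := i'u L' i' i'c; transitivity k; [apply/esym|]; apply: kU => j.
    by apply: vhomP => x /=; rewrite fE' gE'.
  exact: vhomP.
have fg : vhom_comp f g = vhom_id L.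
  have [k [_ kU]] := iu L i ic; transitivity k; [apply/esym|]; apply: kU => j.
    by apply: vhomP => x /=; rewrite gE' fE'.
  exact: vhomP.
have fK : cancel f g by move=> x; rewrite -[LHS]/((vhom_comp g f) x) gf.
have gK : cancel g f by move=> x; rewrite -[LHS]/((vhom_comp f g) x) fg.
have := lin_colimit_iso lc fK gK; congr (lin_colimit _ _).
by apply: functional_extensionality_dep => j; exact: fE.
Qed.

End Colimits.

Section Additive.
Variables (R : realType) (V : voa R) (C0 : gmod V -> Prop).
Hypothesis C0_coprod : closed_fin_coproducts C0.
Hypothesis C0_quot : closed_quotients C0.
Hypothesis C0_V : C0 (voa_gmod V).
Local Notation C := (union_closure C0).

Lemma union_cocomplete : cocomplete (full_sub C).
Proof.
move=> J Js F; have [L [i lc]] := functor_lin_colimit C0_coprod C0_quot C0_V F Js.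
by exists L, i; apply: lin_colimit_colimit.
Qed.

Definition full_sub_preadditive (D : gmod V -> Prop) : preadditive (full_sub D).
Proof.
exists (fun A B : subob D => @vhom_add R V A B) (fun A B : subob D => vhom_zero A B)
  (fun A B : subob D => @vhom_opp R V A B).
- by move=> A B f g h; apply: vhomP => x /=; rewrite addrA.
- by move=> A B f g; apply: vhomP => x /=; rewrite addrC.
- by move=> A B f; apply: vhomP => x /=; rewrite add0r.
- by move=> A B f; apply: vhomP => x /=; rewrite addNr.
- by move=> A B D' f f' g; apply: vhomP.
- by move=> A B D' f g g'; apply: vhomP => x /=; rewrite (linD (vhom_linear f)).
Defined.

Lemma union_zero : exists Z : full_sub C, is_zero_object Z.
Proof.
have [Z [i lc]] := lin_colimit_exists (I := Empty_set) (V := V)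
  (N := fun j => match j with end) (fun _ _ _ => False).
have CZ : C Z by apply: (C_lin_colimit C0_coprod C0_quot C0_V _ lc) => -[].
exists (Subob CZ) => A; split.
  exists (vhom_zero Z (A : subob C)); split=> // f _.
  by apply: (lc_vhom_eq lc) => -[].
(* Without legs any two maps out of [Z] agree; the identity being 0, so is every map into [Z]. *)
have idZ : vhom_id Z = vhom_zero Z Z by apply: (lc_vhom_eq lc) => -[].
exists (vhom_zero (A : subob C) Z); split=> // f _; apply: vhomP => x.
by rewrite -[RHS]/(vhom_id Z (f x)) idZ.
Qed.

Lemma union_biproduct (A B : full_sub C) :
  exists (P : full_sub C) (i1 : hom A P) (i2 : hom B P) (p1 : hom P A) (p2 : hom P B),
    is_biproduct (full_sub_preadditive C) i1 i2 p1 p2.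
Proof.
pose N (b : bool) : gmod V := if b then (A : subob C) else (B : subob C).
have [P [i lc]] := lin_colimit_exists (N := N) (fun _ _ _ => False).
have CP : C P by apply: (C_lin_colimit C0_coprod C0_quot C0_V _ lc) => -[]; apply: subobP.
pose i1 : vhom (A : subob C) P := i true.
pose i2 : vhom (B : subob C) P := i false.
have copair Z (f : vhom (A : subob C) Z) (g : vhom (B : subob C) Z) :
    exists h : vhom P Z, vhom_comp h i1 = f /\ vhom_comp h i2 = g.
  pose k (b : bool) : vhom (N b) Z := if b as c return vhom (N c) Z then f else g.
  have [|h hE] := lc_vhom (h := k) lc; first by [].
  by exists h; split; apply: vhomP; [exact: (hE true)|exact: (hE false)].
have [p1 [p11 p12]] := copair _ (vhom_id _) (vhom_zero _ _).
have [p2 [p21 p22]] := copair _ (vhom_zero _ _) (vhom_id _).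
exists (Subob CP), i1, i2, p1, p2; split=> //.
have e11 a : p1 (i1 a) = a by rewrite -[LHS]/(vhom_comp p1 i1 a) p11.
have e12 b : p1 (i2 b) = 0 by rewrite -[LHS]/(vhom_comp p1 i2 b) p12.
have e21 a : p2 (i1 a) = 0 by rewrite -[LHS]/(vhom_comp p2 i1 a) p21.
have e22 b : p2 (i2 b) = b by rewrite -[LHS]/(vhom_comp p2 i2 b) p22.
apply: (lc_vhom_eq lc) => -[] x.
  by rewrite -[LHS]/(i1 (p1 (i1 x)) + i2 (p2 (i1 x))) e11 e21 vhom0 addr0.
by rewrite -[LHS]/(i1 (p1 (i2 x)) + i2 (p2 (i2 x))) e12 e22 vhom0 add0r.
Qed.

Lemma union_additive : additive_category (full_sub C).
Proof.
exists (full_sub_preadditive C); split; [exact: union_zero|exact: union_biproduct].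
Qed.

End Additive.

(** * Tensor products in the closure under unions *)

Local Notation "g \@ f" := (vhom_comp g f) (at level 50, left associativity).

Section VhomCategory.
Variables (R : realType) (V : voa R).
Implicit Types M N P Q : gmod V.

Lemma vcompA M N P Q (f : vhom P Q) (g : vhom N P) (h : vhom M N) :
  f \@ (g \@ h) = f \@ g \@ h.
Proof. exact: vhomP. Qed.

Lemma vcomp1m M N (f : vhom M N) : vhom_id N \@ f = f.
Proof. exact: vhomP. Qed.

Lemma vcompm1 M N (f : vhom M N) : f \@ vhom_id M = f.
Proof. exact: vhomP. Qed.

Definition vinv M N (f : vhom M N) (g : vhom N M) :=
  g \@ f = vhom_id M /\ f \@ g = vhom_id N.

End VhomCategory.

Section Tensor.
Variables (R : realType) (V : voa R) (C0 : gmod V -> Prop).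
Hypothesis C0_coprod : closed_fin_coproducts C0.
Hypothesis C0_quot : closed_quotients C0.
Variable S0 : hlz_structure C0.
Local Notation C := (union_closure C0).
Hypothesis C0_image : forall M1 M2 M3 : gmod V, C0 M1 -> C0 M2 ->
  C M3 -> forall Y : intertwining M1 M2 M3,
  exists U, submodule_in C0 U /\ (forall x, itw_image Y x -> U x).

(** * Tensor products of C0 with targets in its closure, and presentations *)

Local Notation T0 A B := (hlz_tens S0 A B : subob C0).
Local Notation Y0 A B := (hlz_Y S0 A B).

(** Retyped as a module map, so that it composes with maps into objects outside [C0]. *)
Definition tm0 (A A' B B' : subob C0) (f : vhom A A') (g : vhom B B') :
  vhom (T0 A B) (T0 A' B') := @tmor (full_sub C0) _ _ (hlz_bm S0) A A' B B' f g.

Lemma tm0E (A A' B B' : subob C0) (f : vhom A A') (g : vhom B B') a b e k :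
  tm0 f g (Y0 A B a b e k) = Y0 A' B' (f a) (g b) e k.
Proof. exact: hlz_tmorE. Qed.

Lemma tm01 (A B : subob C0) : tm0 (vhom_id A) (vhom_id B) = vhom_id _.
Proof. exact: (tmor1 (hlz_bm S0) A B). Qed.

Lemma tm0M (A A' A'' B B' B'' : subob C0) (f' : vhom A' A'') (f : vhom A A')
    (g' : vhom B' B'') (g : vhom B B') :
  tm0 (f' \@ f) (g' \@ g) = tm0 f' g' \@ tm0 f g.
Proof. exact: (@tmorM (full_sub C0) _ _ (hlz_bm S0) A A' A'' B B' B''). Qed.

Lemma T0_hom_eq (A B : subob C0) (Z : gmod V) (f g : vhom (T0 A B) Z) :
  (forall a b e k, f (Y0 A B a b e k) = g (Y0 A B a b e k)) -> f = g.
Proof. exact: (tensor_hom_eq C0_quot (subobP (T0 A B)) (@hlz_univ _ _ _ S0 A B)). Qed.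

(** [C0_image] confines the operator to a submodule from [C0]; it lifts through the injection of
    that submodule, and the universal property in [C0] applies to the lift. *)
Lemma T0_univ_C (A B : subob C0) (Z : gmod V) (Y : intertwining A B Z) : C Z ->
  exists h : vhom (T0 A B) Z, forall a b e k, h (Y0 A B a b e k) = Y a b e k.
Proof.
move=> CZ; have [U [[_ [N [CN [f [finj fU]]]]] YU]] := C0_image (subobP A) (subobP B) CZ Y.
have fY a b e k : exists n, f n = Y a b e k.
  have : U (Y a b e k).
    apply: YU; apply: sub_span; exists k, a, (- e - 1), b.
    by rewrite /coef opprD !opprK addrK.
  by rewrite -fU => -[n _ <-]; exists n.
have [Y' Y'E] := itw_lift finj fY.
have [h [hE _]] := @hlz_univ _ _ _ S0 A B N CN Y'.
by exists (f \@ h) => a b e k /=; rewrite hE Y'E.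
Qed.

(** Presentations by arbitrary diagrams, not just by submodules, can be iterated: a presentation of
    each factor yields one of the tensor product. Identity edges let an edge vary one factor at a
    time. *)
Record pres (X : gmod V) := Pres {
  pI : Type;
  pN : pI -> subob C0;
  pE : forall j k, vhom (pN j) (pN k) -> Prop;
  pi : forall j, vhom (pN j) X;
  pE_refl : forall j, pE (vhom_id (pN j));
  pP : @lin_colimit R V pI pN pE X pi }.

Definition pres_edge (A B : gmod V) (P : pres A) (Q : pres B) (p q : pI P * pI Q)
    (w : vhom (T0 (pN p.1) (pN p.2)) (T0 (pN q.1) (pN q.2))) : Prop :=
  exists u u', [/\ @pE _ P p.1 q.1 u, @pE _ Q p.2 q.2 u' & w = tm0 u u'].

Lemma pres_tensor (A B : gmod V) (P : pres A) (Q : pres B) :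
  exists (L : gmod V) (Y : intertwining A B L)
      (i : forall p : pI P * pI Q, vhom (T0 (pN p.1) (pN p.2)) L),
    [/\ C L, is_tensor_product C Y, lin_colimit (@pres_edge A B P Q) i &
      forall p a b e k,
        i p (Y0 (pN p.1) (pN p.2) a b e k) = Y (pi p.1 a) (pi p.2 b) e k].
Proof.
have [L [i lc]] := lin_colimit_exists (@pres_edge A B P Q).
have CL : C L.
  apply: (C_lin_colimit C0_coprod C0_quot (hlz_V S0)) lc => p.
  by apply: sub_union_closure; exact: subobP.
have [||Y YE] := glue_itw (pP P) (pP Q)
  (J := fun j j' => itw_post (i (j, j')) (Y0 (pN j) (pN j'))).
- move=> j k j' u Eu y y' e n /=.
  have := lc_cocone lc (j := (j, j')) (k := (k, j')) (u := tm0 u (vhom_id (pN j'))) _ _.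
  by move=> <-; [rewrite tm0E|exists u, (vhom_id (pN j')); split=> //; apply: pE_refl].
- move=> j j' k' u Eu y y' e n /=.
  have := lc_cocone lc (j := (j, j')) (k := (j, k')) (u := tm0 (vhom_id (pN j)) u) _ _.
  by move=> <-; [rewrite tm0E|exists (vhom_id (pN j)), u; split=> //; apply: pE_refl].
exists L, Y, i; split=> // [Z CZ Y3|[j j'] a b e k]; last by rewrite YE.
have h_ex (p : pI P * pI Q) :=
  T0_univ_C (itw_comp Y3 (pi p.1) (pi p.2) : intertwining (pN p.1) (pN p.2) Z) CZ.
pose h (p : pI P * pI Q) := sval (cid (h_ex p)).
have hE (p : pI P * pI Q) a b e k : 
    h p (Y0 (pN p.1) (pN p.2) a b e k) = Y3 (pi p.1 a) (pi p.2 b) e k.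
  exact: (svalP (cid (h_ex p))).
have [|f fE] := lc_vhom (h := h) lc.
  move=> p q _ [u [u' [Eu Eu' ->]]] x.
  suff -> : h p = h q \@ tm0 u u' by [].
  apply: T0_hom_eq => a b e k; rewrite /= tm0E !hE.
  by rewrite (lc_cocone (pP P) Eu) (lc_cocone (pP Q) Eu').
exists f; split=> [a b e k|g gE].
  move: a b; apply: (bilin_colimit_ind (pP P) (pP Q)) => [b|a|j j' a b].
  - split=> [|c x y xE yE]; first by rewrite !(lin0 (itw_linl _ _ _ _)) vhom0.
    by rewrite !itw_linl vhom_linear xE yE.
  - split=> [|c x y xE yE]; first by rewrite !(lin0 (itw_linr _ _ _ _)) vhom0.
    by rewrite !itw_linr vhom_linear xE yE.
  - by rewrite YE [LHS](fE (j, j')) hE.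
apply: (lc_vhom_eq lc) => -[j j'] x; rewrite fE.
suff -> : h (j, j') = g \@ i (j, j') by [].
by apply: T0_hom_eq => a b e k; rewrite hE -gE YE.
Qed.

Lemma sub_C0 (A : gmod V) (U : C0sub C0 A) : C0 (sub_mod U).
Proof. by have [] := sub_modP U. Qed.

Definition sub_ob (A : gmod V) (U : C0sub C0 A) : subob C0 := Subob (sub_C0 U).

Definition sub_inc (A : gmod V) (U : C0sub C0 A) : vhom (sub_ob U) A := sub_incl U.

Definition sub_pres (A : subob C) : pres A.
Proof.
apply: (@Pres A (C0sub C0 A) (@sub_ob A) (@sub_edge R V C0 A) (@sub_inc A)) => [//|].
exact: (sub_lin_colimit C0_coprod C0_quot (subobP A)).
Defined.

Lemma tensor_exists (A B : subob C) : exists (T : subob C) (Y : intertwining A B T),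
  is_tensor_product C Y.
Proof.
have [L [Y [i [CL univ _ _]]]] := pres_tensor (sub_pres A) (sub_pres B).
by exists (Subob CL), Y.
Qed.

(** * An arbitrary choice of tensor products in the closure, compared with those of C0 *)

Variable T : subob C -> subob C -> subob C.
Variable Y : forall A B : subob C, intertwining A B (T A B).
Hypothesis T_univ : forall A B, is_tensor_product C (Y A B).
Arguments Y {A B}.

Lemma T_hom_eq (A B : subob C) (Z : gmod V) (f g : vhom (T A B) Z) :
  (forall a b e k, f (Y a b e k) = g (Y a b e k)) -> f = g.
Proof.
apply: (tensor_hom_eq _ (subobP (T A B)) (@T_univ A B)).
exact: (C_quot C0_quot).
Qed.

Lemma T_lift_ex (A B : subob C) (Z : gmod V) (Y3 : intertwining A B Z) : C Z ->
  exists h : vhom (T A B) Z, forall a b e k, h (Y a b e k) = Y3 a b e k.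
Proof. by move=> CZ; have [h [hE _]] := T_univ CZ Y3; exists h. Qed.

Definition tm (A A' B B' : subob C) (f : vhom A A') (g : vhom B B') :
    vhom (T A B) (T A' B') :=
  sval (cid (T_lift_ex (itw_comp Y f g) (subobP (T A' B')))).

Lemma tmE (A A' B B' : subob C) (f : vhom A A') (g : vhom B B') a b e k :
  tm f g (Y a b e k) = Y (f a) (g b) e k.
Proof. exact: (svalP (cid (T_lift_ex (itw_comp Y f g) (subobP (T A' B'))))). Qed.

Lemma tm1 (A B : subob C) : tm (vhom_id A) (vhom_id B) = vhom_id _.
Proof. by apply: T_hom_eq => a b e k; rewrite tmE. Qed.

Lemma tmM (A A' A'' B B' B'' : subob C) (f' : vhom A' A'') (f : vhom A A')
    (g' : vhom B' B'') (g : vhom B B') :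
  tm (f' \@ f) (g' \@ g) = tm f' g' \@ tm f g.
Proof. by apply: T_hom_eq => a b e k; rewrite /= !tmE. Qed.

(** The comparison between the two tensor products, for any maps from objects of [C0]; it absorbs
    [tm0] on the right and [tm] on the left. *)
Definition tmap (A0 B0 : subob C0) (A B : subob C) (a : vhom A0 A) (b : vhom B0 B) :
    vhom (T0 A0 B0) (T A B) :=
  sval (cid (T0_univ_C (itw_comp Y a b) (subobP (T A B)))).

Lemma tmapE (A0 B0 : subob C0) (A B : subob C) (a : vhom A0 A) (b : vhom B0 B) x y e k :
  tmap a b (Y0 A0 B0 x y e k) = Y (a x) (b y) e k.
Proof. exact: (svalP (cid (T0_univ_C (itw_comp Y a b) (subobP (T A B))))). Qed.

Lemma tmap_tm0 (A0 B0 A1 B1 : subob C0) (A B : subob C) (a : vhom A0 A) (b : vhom B0 B)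
    (f : vhom A1 A0) (g : vhom B1 B0) :
  tmap a b \@ tm0 f g = tmap (a \@ f) (b \@ g).
Proof. by apply: T0_hom_eq => x y e k; rewrite /= tm0E !tmapE. Qed.

Lemma tm_tmap (A0 B0 : subob C0) (A B A' B' : subob C) (a : vhom A0 A) (b : vhom B0 B)
    (f : vhom A A') (g : vhom B B') :
  tm f g \@ tmap a b = tmap (f \@ a) (g \@ b).
Proof. by apply: T0_hom_eq => x y e k; rewrite /= !tmapE tmE. Qed.

Lemma tensor_lin_colimit (A B : subob C) (P : pres A) (Q : pres B) :
  lin_colimit (@pres_edge A B P Q)
    (fun p : pI P * pI Q => tmap (pi p.1) (pi p.2)).
Proof.
have [L [YL [i [CL univ lc iE]]]] := pres_tensor P Q.
have [f [fE _]] := univ (T A B) (subobP _) Y.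
have [g gE] := T_lift_ex YL CL.
have gf : g \@ f = vhom_id L.
  have [k [_ kU]] := univ L CL YL; transitivity k; [apply/esym|]; apply: kU => //.
  by move=> a b e n /=; rewrite fE gE.
have fg : f \@ g = vhom_id (T A B) by apply: T_hom_eq => a b e n; rewrite /= gE fE.
have fK : cancel f g by move=> x; rewrite -[LHS]/((g \@ f) x) gf.
have gK : cancel g f by move=> x; rewrite -[LHS]/((f \@ g) x) fg.
have := lin_colimit_iso lc fK gK; congr (lin_colimit _ _).
apply: functional_extensionality_dep => p; apply: T0_hom_eq => a b e n.
by rewrite /= iE fE tmapE.
Qed.

Definition tensor_pres (A B : subob C) (P : pres A) (Q : pres B) : pres (T A B).
Proof.
apply: (@Pres (T A B) (pI P * pI Q) (fun p => T0 (pN p.1) (pN p.2))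
  (@pres_edge A B P Q) (fun p => tmap (pi p.1) (pi p.2))) => [p|].
  exists (vhom_id _), (vhom_id _); split; [exact: pE_refl|exact: pE_refl|].
  by rewrite tm01.
exact: tensor_lin_colimit.
Defined.

(** * Gluing maps out of objects and iterated tensor products *)

Lemma pres_glue (X Z : gmod V) (P : pres X) (h : forall j, vhom (pN j : subob C0) Z) :
  (forall j k (u : vhom (pN j) (pN k)), @pE X P j k u -> h k \@ u = h j) ->
  exists H : vhom X Z, forall j, H \@ pi j = h j.
Proof.
move=> hE; have [|H HE] := lc_vhom (h := h) (pP P); last first.
  by exists H => j; apply: vhomP => x; apply: HE.
by move=> j k u Eu x; rewrite -(hE _ _ _ Eu).
Qed.

Lemma sub_edgeE (A : gmod V) (U U' : C0sub C0 A) (u : vhom (sub_ob U) (sub_ob U')) :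
  @sub_edge R V C0 A U U' u -> sub_inc U' \@ u = sub_inc U.
Proof. by move=> Eu; apply: vhomP. Qed.

Lemma sub_factorE (A : gmod V) (A0 : subob C0) (a : vhom A0 A) :
  exists (U : C0sub C0 A) (a' : vhom A0 (sub_ob U)), a = sub_inc U \@ a'.
Proof.
have [U [a' aE]] := sub_factor C0_quot a (subobP A0).
by exists U, a'; apply: vhomP.
Qed.

(** The family is glued over submodules only; its value at any other [a] follows by factoring [a]
    through its image. *)
Lemma glue1 (A : subob C) (Z : gmod V) (h : forall A0 : subob C0, vhom A0 A -> vhom A0 Z) :
  (forall (A0 A1 : subob C0) (a : vhom A0 A) (f : vhom A1 A0), h A0 a \@ f = h A1 (a \@ f)) ->
  exists H : vhom A Z, forall (A0 : subob C0) (a : vhom A0 A), H \@ a = h A0 a.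
Proof.
move=> hE; have [|H HE] := pres_glue (P := sub_pres A)
  (h := fun U => h (sub_ob U) (sub_inc U)).
  move=> U U' u Eu; rewrite -(sub_edgeE Eu).
  exact: (hE (sub_ob U') (sub_ob U) (sub_inc U') u).
exists H => A0 a; have [U [a' ->]] := sub_factorE a.
by rewrite vcompA [H \@ _](HE U) (hE (sub_ob U) A0 (sub_inc U) a').
Qed.

Lemma tens_glue_pres (A B : subob C) (P : pres A) (Q : pres B) (Z : gmod V)
    (h : forall (p : pI P) (q : pI Q), vhom (T0 (pN p) (pN q)) Z) :
  (forall p p' q q' (u : vhom (pN p) (pN p')) (u' : vhom (pN q) (pN q')),
    @pE _ P p p' u -> @pE _ Q q q' u' -> h p' q' \@ tm0 u u' = h p q) ->
  exists H : vhom (T A B) Z, forall p q, H \@ tmap (pi p) (pi q) = h p q.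
Proof.
move=> hE; have [|H HE] := pres_glue (P := tensor_pres P Q) (h := fun p => h p.1 p.2).
  by move=> [p q] [p' q'] u [v [v' [Ev Ev' ->]]]; apply: hE.
by exists H => p q; rewrite [LHS](HE (p, q)).
Qed.

Lemma glue2 (A B : subob C) (Z : gmod V)
    (h : forall A0 B0 : subob C0, vhom A0 A -> vhom B0 B -> vhom (T0 A0 B0) Z) :
  (forall (A0 A1 B0 B1 : subob C0) a b (f : vhom A1 A0) (g : vhom B1 B0),
    h A0 B0 a b \@ tm0 f g = h A1 B1 (a \@ f) (b \@ g)) ->
  exists H : vhom (T A B) Z, forall A0 B0 a b, H \@ tmap a b = h A0 B0 a b.
Proof.
move=> hE; have [|H HE] := tens_glue_pres (P := sub_pres A) (Q := sub_pres B)
  (h := fun p q => h (sub_ob p) (sub_ob q) (sub_inc p) (sub_inc q)).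
  move=> p p' q q' u u' Eu Eu'; rewrite -(sub_edgeE Eu) -(sub_edgeE Eu').
  exact: (hE (sub_ob p') (sub_ob p) (sub_ob q') (sub_ob q) (sub_inc p') (sub_inc q') u u').
exists H => A0 B0 a b; have [U [a' ->]] := sub_factorE a.
have [W [b' ->]] := sub_factorE b.
rewrite -tmap_tm0 vcompA [H \@ _](HE U W).
exact: (hE (sub_ob U) A0 (sub_ob W) B0 (sub_inc U) (sub_inc W) a' b').
Qed.

Lemma glue3l (A B D : subob C) (Z : gmod V)
    (h : forall A0 B0 D0 : subob C0, vhom A0 A -> vhom B0 B -> vhom D0 D ->
      vhom (T0 A0 (T0 B0 D0)) Z) :
  (forall (A0 A1 B0 B1 D0 D1 : subob C0) a b d
      (f : vhom A1 A0) (g : vhom B1 B0) (k : vhom D1 D0),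
    h A0 B0 D0 a b d \@ tm0 f (tm0 g k) = h A1 B1 D1 (a \@ f) (b \@ g) (d \@ k)) ->
  exists H : vhom (T A (T B D)) Z,
    forall A0 B0 D0 a b d, H \@ tmap a (tmap b d) = h A0 B0 D0 a b d.
Proof.
move=> hE.
have [|H HE] := tens_glue_pres (P := sub_pres A)
  (Q := tensor_pres (sub_pres B) (sub_pres D))
  (h := fun p q => h (sub_ob p) (sub_ob q.1) (sub_ob q.2)
    (sub_inc p) (sub_inc q.1) (sub_inc q.2)).
  move=> p p' [q r] [q' r'] u _ Eu [v [w [Ev Ew ->]]].
  rewrite -(sub_edgeE Eu) -(sub_edgeE Ev) -(sub_edgeE Ew).
  exact: (hE (sub_ob p') (sub_ob p) (sub_ob q') (sub_ob q) (sub_ob r') (sub_ob r)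
    (sub_inc p') (sub_inc q') (sub_inc r') u v w).
exists H => A0 B0 D0 a b d; have [U [a' ->]] := sub_factorE a.
have [U' [b' ->]] := sub_factorE b; have [U'' [d' ->]] := sub_factorE d.
rewrite -tmap_tm0 -tmap_tm0 vcompA [H \@ _](HE U (U', U'')).
exact: (hE (sub_ob U) A0 (sub_ob U') B0 (sub_ob U'') D0
  (sub_inc U) (sub_inc U') (sub_inc U'') a' b' d').
Qed.

Lemma glue3r (A B D : subob C) (Z : gmod V)
    (h : forall A0 B0 D0 : subob C0, vhom A0 A -> vhom B0 B -> vhom D0 D ->
      vhom (T0 (T0 A0 B0) D0) Z) :
  (forall (A0 A1 B0 B1 D0 D1 : subob C0) a b d
      (f : vhom A1 A0) (g : vhom B1 B0) (k : vhom D1 D0),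
    h A0 B0 D0 a b d \@ tm0 (tm0 f g) k = h A1 B1 D1 (a \@ f) (b \@ g) (d \@ k)) ->
  exists H : vhom (T (T A B) D) Z,
    forall A0 B0 D0 a b d, H \@ tmap (tmap a b) d = h A0 B0 D0 a b d.
Proof.
move=> hE.
have [|H HE] := tens_glue_pres (P := tensor_pres (sub_pres A) (sub_pres B))
  (Q := sub_pres D)
  (h := fun p q => h (sub_ob p.1) (sub_ob p.2) (sub_ob q)
    (sub_inc p.1) (sub_inc p.2) (sub_inc q)).
  move=> [q r] [q' r'] p p' _ u [v [w [Ev Ew ->]]] Eu.
  rewrite -(sub_edgeE Eu) -(sub_edgeE Ev) -(sub_edgeE Ew).
  exact: (hE (sub_ob q') (sub_ob q) (sub_ob r') (sub_ob r) (sub_ob p') (sub_ob p)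
    (sub_inc q') (sub_inc r') (sub_inc p') v w u).
exists H => A0 B0 D0 a b d; have [U [a' ->]] := sub_factorE a.
have [U' [b' ->]] := sub_factorE b; have [U'' [d' ->]] := sub_factorE d.
rewrite -tmap_tm0 -tmap_tm0 vcompA [H \@ _](HE (U, U') U'').
exact: (hE (sub_ob U) A0 (sub_ob U') B0 (sub_ob U'') D0
  (sub_inc U) (sub_inc U') (sub_inc U'') a' b' d').
Qed.

(** * Jointly spanning families and equality of maps *)

Definition cover (J : Type) (N : J -> subob C0) (X : gmod V)
    (f : forall j, vhom (N j) X) :=
  forall x, span [set y | exists j z, y = f j z] x.

Lemma cover_eq (J : Type) (N : J -> subob C0) (X Z : gmod V)
    (f : forall j, vhom (N j) X) (g h : vhom X Z) :
  cover f -> (forall j, g \@ f j = h \@ f j) -> g = h.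
Proof.
move=> cf gh; apply: vhomP => x.
apply: (lin_eq_span (vhom_linear g) (vhom_linear h) _ (cf x)) => _ [j [z ->]].
by rewrite -[LHS]/((g \@ f j) z) gh.
Qed.

Lemma cover_all (A : subob C) :
  cover (fun p : {A0 : subob C0 & vhom A0 A} => projT2 p).
Proof.
move=> x; have [A0 [f [a [CA ->]]]] := (unionP C0_quot A).1 (subobP A) x.
by apply: sub_span; exists (existT _ (Subob CA) f), a.
Qed.

(** The images span a submodule containing all coefficients of [Y], so the projection to the
    quotient by it vanishes on them and is 0 by [T_hom_eq]. *)
Lemma cover_tens (J J' : Type) (N : J -> subob C0) (N' : J' -> subob C0)
    (A B : subob C) (f : forall j, vhom (N j) A) (f' : forall j, vhom (N' j) B) :
  cover f -> cover f' -> cover (fun p : J * J' => tmap (f p.1) (f' p.2)).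
Proof.
move=> cf cf'; rewrite /cover; set S := [set y | _].
have Ss := span_subspace S.
have Sm : submodule (span S).
  split=> // v n m /(_ [set m | span S (act v n m)]); apply; split.
    split=> [|c x y Sx Sy] /=; first by rewrite (lin0 (act_linr _ _)); case: Ss.
    by rewrite act_linr; apply: Ss.2.
  by move=> _ [p [z ->]] /=; apply: sub_span; exists p, (act v n z); rewrite vhom_act.
have [Q [q [_ q0]]] := quot_gmod_exists Sm.
suff q_eq0 : q = vhom_zero _ _ by move=> x; apply/q0; rewrite q_eq0.
apply: T_hom_eq => a b e k /=; apply/q0.
have Sl y : subspace [set x | span S (Y x y e k)].
  split=> [|c x x' Sx Sx'] /=; first by rewrite (lin0 (itw_linl _ _ _ _)); case: Ss.
  by rewrite itw_linl; apply: Ss.2.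
have Sr x : subspace [set y | span S (Y x y e k)].
  split=> [|c y y' Sy Sy'] /=; first by rewrite (lin0 (itw_linr _ _ _ _)); case: Ss.
  by rewrite itw_linr; apply: Ss.2.
apply: (span_min (Sl b)) (cf a) => _ [j [z ->]] /=.
apply: (span_min (Sr _)) (cf' b) => _ [j' [z' ->]] /=.
by apply: sub_span; exists (j, j'), (Y0 _ _ z z' e k); rewrite tmapE.
Qed.

Lemma hom_eq1 (A : subob C) (Z : gmod V) (f g : vhom A Z) :
  (forall (A0 : subob C0) (a : vhom A0 A), f \@ a = g \@ a) -> f = g.
Proof. by move=> fg; apply: (cover_eq (@cover_all A)) => -[A0 a]; apply: fg. Qed.

Lemma hom_eq2 (A B : subob C) (Z : gmod V) (f g : vhom (T A B) Z) :
  (forall (A0 B0 : subob C0) (a : vhom A0 A) (b : vhom B0 B),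
    f \@ tmap a b = g \@ tmap a b) -> f = g.
Proof.
move=> fg; apply: (cover_eq (cover_tens (@cover_all A) (@cover_all B))).
by move=> [[A0 a] [B0 b]]; apply: fg.
Qed.

Lemma hom_eq3l (A B D : subob C) (Z : gmod V) (f g : vhom (T A (T B D)) Z) :
  (forall (A0 B0 D0 : subob C0) (a : vhom A0 A) (b : vhom B0 B) (d : vhom D0 D),
    f \@ tmap a (tmap b d) = g \@ tmap a (tmap b d)) -> f = g.
Proof.
move=> fg; apply: (cover_eq (cover_tens (@cover_all A)
  (cover_tens (@cover_all B) (@cover_all D)))).
by move=> [[A0 a] [[B0 b] [D0 d]]]; apply: fg.
Qed.

Lemma hom_eq3r (A B D : subob C) (Z : gmod V) (f g : vhom (T (T A B) D) Z) :
  (forall (A0 B0 D0 : subob C0) (a : vhom A0 A) (b : vhom B0 B) (d : vhom D0 D),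
    f \@ tmap (tmap a b) d = g \@ tmap (tmap a b) d) -> f = g.
Proof.
move=> fg; apply: (cover_eq (cover_tens
  (cover_tens (@cover_all A) (@cover_all B)) (@cover_all D))).
by move=> [[[A0 a] [B0 b]] [D0 d]]; apply: fg.
Qed.

Lemma hom_eq4 (A B D E : subob C) (Z : gmod V) (f g : vhom (T A (T B (T D E))) Z) :
  (forall (A0 B0 D0 E0 : subob C0) (a : vhom A0 A) (b : vhom B0 B) (d : vhom D0 D)
      (e : vhom E0 E),
    f \@ tmap a (tmap b (tmap d e)) = g \@ tmap a (tmap b (tmap d e))) -> f = g.
Proof.
move=> fg; apply: (cover_eq (cover_tens (@cover_all A) (cover_tens (@cover_all B)
  (cover_tens (@cover_all D) (@cover_all E))))).
by move=> [[A0 a] [[B0 b] [[D0 d] [E0 e]]]]; apply: fg.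
Qed.

(** * Unit, braiding and associativity isomorphisms *)

Let V0 : subob C0 := Subob (hlz_V S0).
Let V1 : subob C := Subob (sub_union_closure (hlz_V S0)).
(** [V0] and [V1] share their underlying module, so a map into [V1] is read by conversion as a map
    into [V0]. *)
Let inV : vhom V0 V1 := vhom_id (voa_gmod V).

Definition lun0 (A : subob C0) : vhom (T0 V0 A) A := lunit (hlz_bm S0) A.
Definition run0 (A : subob C0) : vhom (T0 A V0) A := runit (hlz_bm S0) A.
Definition br0 (A B : subob C0) : vhom (T0 A B) (T0 B A) := braid (hlz_bm S0) A B.
Definition as0 (A B D : subob C0) : vhom (T0 A (T0 B D)) (T0 (T0 A B) D) :=
  assoc (hlz_bm S0) A B D.
Definition asV0 (A B D : subob C0) : vhom (T0 (T0 A B) D) (T0 A (T0 B D)) :=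
  assocV (hlz_bm S0) A B D.

Lemma lun0_nat (A B : subob C0) (f : vhom A B) : lun0 B \@ tm0 (vhom_id V0) f = f \@ lun0 A.
Proof. exact: (lunit_nat (hlz_bm S0) (a := A) (b := B)). Qed.

Lemma run0_nat (A B : subob C0) (f : vhom A B) : run0 B \@ tm0 f (vhom_id V0) = f \@ run0 A.
Proof. exact: (runit_nat (hlz_bm S0) (a := A) (b := B)). Qed.

Lemma br0_nat (A A' B B' : subob C0) (f : vhom A A') (g : vhom B B') :
  br0 A' B' \@ tm0 f g = tm0 g f \@ br0 A B.
Proof. exact: (@braid_nat _ _ _ (hlz_bm S0) A A' B B'). Qed.

Lemma as0_nat (A A' B B' D D' : subob C0) (f : vhom A A') (g : vhom B B') (h : vhom D D') :
  as0 A' B' D' \@ tm0 f (tm0 g h) = tm0 (tm0 f g) h \@ as0 A B D.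
Proof. exact: (@assoc_nat _ _ _ (hlz_bm S0) A A' B B' D D'). Qed.

Lemma as0K (A B D : subob C0) : asV0 A B D \@ as0 A B D = vhom_id _.
Proof. exact: (assoc_inv (hlz_bm S0) A B D).1. Qed.

Lemma asV0K (A B D : subob C0) : as0 A B D \@ asV0 A B D = vhom_id _.
Proof. exact: (assoc_inv (hlz_bm S0) A B D).2. Qed.

Lemma asV0_nat (A A' B B' D D' : subob C0) (f : vhom A A') (g : vhom B B') (h : vhom D D') :
  asV0 A' B' D' \@ tm0 (tm0 f g) h = tm0 f (tm0 g h) \@ asV0 A B D.
Proof.
rewrite -[LHS]vcompm1 -(asV0K A B D) vcompA -(vcompA (asV0 _ _ _)) -as0_nat.
by rewrite !vcompA as0K vcomp1m.
Qed.

(** The gluing data involve every map [x] into the unit, so [x] first carries [X0] to [V0], where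
    the unit map of [C0] is available. *)
Lemma lunit_ex (A : subob C) : exists H : vhom (T V1 A) A,
  forall (X0 A0 : subob C0) (x : vhom X0 V1) (a : vhom A0 A),
    H \@ tmap x a = a \@ lun0 A0 \@ tm0 (x : vhom X0 V0) (vhom_id A0).
Proof.
apply: (glue2 (A := V1) (B := A) (Z := A) (h := fun X0 A0 x a =>
  a \@ lun0 A0 \@ tm0 (x : vhom X0 V0) (vhom_id A0))) => A0 A1 B0 B1 a b f g.
rewrite -!vcompA -tm0M vcomp1m [g \@ (_ \@ _)]vcompA -lun0_nat.
by rewrite -(vcompA (lun0 _)) -tm0M vcomp1m vcompm1.
Qed.

Lemma runit_ex (A : subob C) : exists H : vhom (T A V1) A,
  forall (A0 X0 : subob C0) (a : vhom A0 A) (x : vhom X0 V1),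
    H \@ tmap a x = a \@ run0 A0 \@ tm0 (vhom_id A0) (x : vhom X0 V0).
Proof.
apply: (glue2 (A := A) (B := V1) (Z := A) (h := fun A0 X0 a x =>
  a \@ run0 A0 \@ tm0 (vhom_id A0) (x : vhom X0 V0))) => A0 A1 B0 B1 a b f g.
rewrite -!vcompA -tm0M vcomp1m [f \@ (_ \@ _)]vcompA -run0_nat.
by rewrite -(vcompA (run0 _)) -tm0M vcomp1m vcompm1.
Qed.

Lemma braid_ex (A B : subob C) : exists H : vhom (T A B) (T B A),
  forall (A0 B0 : subob C0) (a : vhom A0 A) (b : vhom B0 B),
    H \@ tmap a b = tmap b a \@ br0 A0 B0.
Proof.
apply: (glue2 (A := A) (B := B) (Z := T B A) 
  (h := fun A0 B0 a b => tmap b a \@ br0 A0 B0)) => A0 A1 B0 B1 a b f g.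
by rewrite -vcompA br0_nat vcompA tmap_tm0.
Qed.

Lemma assoc_ex (A B D : subob C) : exists H : vhom (T A (T B D)) (T (T A B) D),
  forall (A0 B0 D0 : subob C0) (a : vhom A0 A) (b : vhom B0 B) (d : vhom D0 D),
    H \@ tmap a (tmap b d) = tmap (tmap a b) d \@ as0 A0 B0 D0.
Proof.
apply: (glue3l (A := A) (B := B) (D := D) (Z := T (T A B) D)
  (h := fun A0 B0 D0 a b d => tmap (tmap a b) d \@ as0 A0 B0 D0)).
move=> A0 A1 B0 B1 D0 D1 a b d f g k.
by rewrite -vcompA as0_nat vcompA !tmap_tm0.
Qed.

Lemma assocV_ex (A B D : subob C) : exists H : vhom (T (T A B) D) (T A (T B D)),
  forall (A0 B0 D0 : subob C0) (a : vhom A0 A) (b : vhom B0 B) (d : vhom D0 D),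
    H \@ tmap (tmap a b) d = tmap a (tmap b d) \@ asV0 A0 B0 D0.
Proof.
apply: (glue3r (A := A) (B := B) (D := D) (Z := T A (T B D))
  (h := fun A0 B0 D0 a b d => tmap a (tmap b d) \@ asV0 A0 B0 D0)).
move=> A0 A1 B0 B1 D0 D1 a b d f g k.
by rewrite -vcompA asV0_nat vcompA !tmap_tm0.
Qed.

Definition lun A := sval (cid (lunit_ex A)).
Definition run A := sval (cid (runit_ex A)).
Definition br A B := sval (cid (braid_ex A B)).
Definition as1 A B D := sval (cid (assoc_ex A B D)).
Definition asV1 A B D := sval (cid (assocV_ex A B D)).

Lemma lun_tmap (A : subob C) (X0 A0 : subob C0) (x : vhom X0 V1) (a : vhom A0 A) :
  lun A \@ tmap x a = a \@ lun0 A0 \@ tm0 (x : vhom X0 V0) (vhom_id A0).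
Proof. exact: (svalP (cid (lunit_ex A))). Qed.

Lemma run_tmap (A : subob C) (X0 A0 : subob C0) (x : vhom X0 V1) (a : vhom A0 A) :
  run A \@ tmap a x = a \@ run0 A0 \@ tm0 (vhom_id A0) (x : vhom X0 V0).
Proof. exact: (svalP (cid (runit_ex A))). Qed.

Lemma br_tmap (A B : subob C) (A0 B0 : subob C0) (a : vhom A0 A) (b : vhom B0 B) :
  br A B \@ tmap a b = tmap b a \@ br0 A0 B0.
Proof. exact: (svalP (cid (braid_ex A B))). Qed.

Lemma as1_tmap (A B D : subob C) (A0 B0 D0 : subob C0) (a : vhom A0 A) (b : vhom B0 B)
    (d : vhom D0 D) :
  as1 A B D \@ tmap a (tmap b d) = tmap (tmap a b) d \@ as0 A0 B0 D0.
Proof. exact: (svalP (cid (assoc_ex A B D))). Qed.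

Lemma asV1_tmap (A B D : subob C) (A0 B0 D0 : subob C0) (a : vhom A0 A) (b : vhom B0 B)
    (d : vhom D0 D) :
  asV1 A B D \@ tmap (tmap a b) d = tmap a (tmap b d) \@ asV0 A0 B0 D0.
Proof. exact: (svalP (cid (assocV_ex A B D))). Qed.

Lemma lun_iso (A : subob C) : exists g, vinv (lun A) g.
Proof.
pose li (A0 : subob C0) : vhom A0 (T0 V0 A0) :=
  sval (cid (lunit_iso (hlz_bm S0) A0)).
have liP (A0 : subob C0) : vinv (lun0 A0) (li A0).
  exact: (svalP (cid (lunit_iso (hlz_bm S0) A0))).
have [|g gE] := glue1 (A := A) (Z := T V1 A) (h := fun A0 a => tmap inV a \@ li A0).
  move=> A0 A1 a f; rewrite -vcompA.
  (* Naturality of the inverse, deduced from that of [lun0]. *)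
  have -> : li A0 \@ f = tm0 (vhom_id V0) f \@ li A1.
    rewrite -[LHS]vcompm1 -(liP A1).2 vcompA -(vcompA _ f) -lun0_nat.
    by rewrite !vcompA (liP A0).1 vcomp1m.
  by rewrite vcompA tmap_tm0 vcompm1.
exists g; split; last first.
  apply: hom_eq1 => A0 a; rewrite -vcompA gE vcompA lun_tmap -!vcompA.
  by rewrite [tm0 _ _]tm01 vcomp1m (liP A0).2 vcompm1 vcomp1m.
apply: hom_eq2 => X0 A0 x a; rewrite -vcompA lun_tmap !vcompA gE.
by rewrite -(vcompA _ (li A0)) (liP A0).1 vcompm1 tmap_tm0 vcompm1 vcomp1m [inV \@ x]vcomp1m.
Qed.

Lemma run_iso (A : subob C) : exists g, vinv (run A) g.
Proof.
pose ri (A0 : subob C0) : vhom A0 (T0 A0 V0) :=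
  sval (cid (runit_iso (hlz_bm S0) A0)).
have riP (A0 : subob C0) : vinv (run0 A0) (ri A0).
  exact: (svalP (cid (runit_iso (hlz_bm S0) A0))).
have [|g gE] := glue1 (A := A) (Z := T A V1) (h := fun A0 a => tmap a inV \@ ri A0).
  move=> A0 A1 a f; rewrite -vcompA.
  have -> : ri A0 \@ f = tm0 f (vhom_id V0) \@ ri A1.
    rewrite -[LHS]vcompm1 -(riP A1).2 vcompA -(vcompA _ f) -run0_nat.
    by rewrite !vcompA (riP A0).1 vcomp1m.
  by rewrite vcompA tmap_tm0 vcompm1.
exists g; split; last first.
  apply: hom_eq1 => A0 a; rewrite -vcompA gE vcompA run_tmap -!vcompA.
  by rewrite [tm0 _ _]tm01 vcomp1m (riP A0).2 vcompm1 vcomp1m.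
apply: hom_eq2 => A0 X0 a x; rewrite -vcompA run_tmap !vcompA gE.
by rewrite -(vcompA _ (ri A0)) (riP A0).1 vcompm1 tmap_tm0 vcompm1 vcomp1m [inV \@ x]vcomp1m.
Qed.

(** The braiding need not be symmetric, so the inverse is glued from the inverses in [C0] instead of
    being [br B A]. *)
Lemma br_iso (A B : subob C) : exists g, vinv (br A B) g.
Proof.
pose bi (A0 B0 : subob C0) : vhom (T0 B0 A0) (T0 A0 B0) :=
  sval (cid (braid_iso (hlz_bm S0) A0 B0)).
have biP (A0 B0 : subob C0) : vinv (br0 A0 B0) (bi A0 B0).
  exact: (svalP (cid (braid_iso (hlz_bm S0) A0 B0))).
have [|g gE] := glue2 (A := B) (B := A) (Z := T A B)
  (h := fun B0 A0 b a => tmap a b \@ bi A0 B0).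
  move=> B0 B1 A0 A1 b a g f; rewrite -vcompA.
  have -> : bi A0 B0 \@ tm0 g f = tm0 f g \@ bi A1 B1.
    rewrite -[LHS]vcompm1 -(biP A1 B1).2 vcompA -(vcompA _ (tm0 g f)) -br0_nat.
    by rewrite !vcompA (biP A0 B0).1 vcomp1m.
  by rewrite vcompA tmap_tm0.
exists g; split; apply: hom_eq2 => A0 B0 a b; rewrite -vcompA.
  by rewrite br_tmap vcompA gE -vcompA (biP A0 B0).1 vcompm1 vcomp1m.
by rewrite gE vcompA br_tmap -vcompA (biP B0 A0).2 vcompm1 vcomp1m.
Qed.

Lemma as1_inv (A B D : subob C) : vinv (as1 A B D) (asV1 A B D).
Proof.
split; [apply: hom_eq3l|apply: hom_eq3r] => A0 B0 D0 a b d; rewrite -vcompA.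
  by rewrite as1_tmap vcompA asV1_tmap -vcompA as0K vcompm1 vcomp1m.
by rewrite asV1_tmap vcompA as1_tmap -vcompA asV0K vcompm1 vcomp1m.
Qed.

(** * Naturality and coherence *)

Lemma lun_nat (A B : subob C) (f : vhom A B) : lun B \@ tm (vhom_id V1) f = f \@ lun A.
Proof.
apply: hom_eq2 => X0 A0 x a.
by rewrite -vcompA tm_tmap vcomp1m !lun_tmap -!vcompA lun_tmap -!vcompA.
Qed.

Lemma run_nat (A B : subob C) (f : vhom A B) : run B \@ tm f (vhom_id V1) = f \@ run A.
Proof.
apply: hom_eq2 => A0 X0 a x.
by rewrite -vcompA tm_tmap vcomp1m !run_tmap -!vcompA run_tmap -!vcompA.
Qed.

Lemma br_nat (A A' B B' : subob C) (f : vhom A A') (g : vhom B B') :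
  br A' B' \@ tm f g = tm g f \@ br A B.
Proof.
by apply: hom_eq2 => A0 B0 a b; rewrite -!vcompA tm_tmap !br_tmap vcompA tm_tmap.
Qed.

Lemma as1_nat (A A' B B' D D' : subob C) (f : vhom A A') (g : vhom B B') (h : vhom D D') :
  as1 A' B' D' \@ tm f (tm g h) = tm (tm f g) h \@ as1 A B D.
Proof.
apply: hom_eq3l => A0 B0 D0 a b d.
by rewrite -!vcompA !tm_tmap !as1_tmap vcompA !tm_tmap.
Qed.

Lemma as1_pentagon (A B D E : subob C) :
  as1 (T A B) D E \@ as1 A B (T D E) =
  tm (as1 A B D) (vhom_id E) \@ as1 A (T B D) E \@ tm (vhom_id A) (as1 B D E).
Proof.
apply: hom_eq4 => A0 B0 D0 E0 a b d e.
have pent0 : as0 (T0 A0 B0) D0 E0 \@ as0 A0 B0 (T0 D0 E0) =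
    tm0 (as0 A0 B0 D0) (vhom_id E0) \@ as0 A0 (T0 B0 D0) E0
      \@ tm0 (vhom_id A0) (as0 B0 D0 E0) := pentagon (hlz_bm S0) A0 B0 D0 E0.
rewrite -!vcompA as1_tmap tm_tmap vcomp1m as1_tmap.
rewrite (vcompA (as1 (T A B) D E)) as1_tmap -vcompA pent0.
(* Writing [a] as [a \@ vhom_id A0] pulls [as0 B0 D0 E0] out of the second slot as a factor [tm0],
   so that [as1_tmap] applies to what remains. *)
rewrite -[a in RHS]vcompm1 -tmap_tm0 (vcompA (as1 A _ E)) as1_tmap.
rewrite !vcompA tm_tmap as1_tmap vcomp1m.
by rewrite -[e in RHS]vcompm1 -tmap_tm0.
Qed.

Lemma as1_triangle (A B : subob C) :
  tm (run A) (vhom_id B) \@ as1 A V1 B = tm (vhom_id A) (lun B).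
Proof.
apply: hom_eq3l => A0 X0 B0 a x b.
have tri0 : tm0 (run0 A0) (vhom_id B0) \@ as0 A0 V0 B0 = tm0 (vhom_id A0) (lun0 B0) :=
  triangle (hlz_bm S0) A0 B0.
rewrite -vcompA as1_tmap vcompA !tm_tmap !vcomp1m run_tmap lun_tmap.
have -> : tmap (a \@ run0 A0 \@ tm0 (vhom_id A0) (x : vhom X0 V0)) b =
    tmap a b \@ tm0 (run0 A0) (vhom_id B0) \@
      tm0 (tm0 (vhom_id A0) (x : vhom X0 V0)) (vhom_id B0).
  by rewrite !tmap_tm0 !vcompm1.
have -> : tmap a (b \@ lun0 B0 \@ tm0 (x : vhom X0 V0) (vhom_id B0)) =
    tmap a b \@ tm0 (vhom_id A0) (lun0 B0) \@
      tm0 (vhom_id A0) (tm0 (x : vhom X0 V0) (vhom_id B0)).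
  by rewrite !tmap_tm0 !vcompm1.
(* Naturality moves [x] past the associativity map, so that the triangle of [C0] is used at the unit
   itself. *)
by rewrite -(vcompA _ _ (as0 _ _ _)) -as0_nat vcompA -(vcompA (tmap a b)) tri0.
Qed.

Lemma br_hexagon1 (A B D : subob C) :
  as1 D A B \@ br (T A B) D \@ as1 A B D =
  tm (br A D) (vhom_id B) \@ as1 A D B \@ tm (vhom_id A) (br B D).
Proof.
apply: hom_eq3l => A0 B0 D0 a b d.
have hex0 : as0 D0 A0 B0 \@ br0 (T0 A0 B0) D0 \@ as0 A0 B0 D0 =
    tm0 (br0 A0 D0) (vhom_id B0) \@ as0 A0 D0 B0 \@ tm0 (vhom_id A0) (br0 B0 D0) :=
  hexagon1 (hlz_bm S0) A0 B0 D0.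
rewrite -!vcompA as1_tmap (vcompA (br _ _)) br_tmap !vcompA as1_tmap.
rewrite -!vcompA [in LHS](vcompA (as0 _ _ _)) hex0.
rewrite tm_tmap vcomp1m br_tmap -[a in RHS]vcompm1 -tmap_tm0.
rewrite [in RHS](vcompA (as1 _ _ _)) as1_tmap !vcompA tm_tmap br_tmap vcomp1m.
by rewrite -[b in RHS]vcompm1 -tmap_tm0.
Qed.

Lemma br_hexagon2 (A B D : subob C) :
  asV1 B D A \@ br A (T B D) \@ asV1 A B D =
  tm (vhom_id B) (br A D) \@ asV1 B A D \@ tm (br A B) (vhom_id D).
Proof.
apply: hom_eq3r => A0 B0 D0 a b d.
have hex0 : asV0 B0 D0 A0 \@ br0 A0 (T0 B0 D0) \@ asV0 A0 B0 D0 =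
    tm0 (vhom_id B0) (br0 A0 D0) \@ asV0 B0 A0 D0 \@ tm0 (br0 A0 B0) (vhom_id D0) :=
  hexagon2 (hlz_bm S0) A0 B0 D0.
rewrite -!vcompA asV1_tmap (vcompA (br _ _)) br_tmap !vcompA asV1_tmap.
rewrite -!vcompA [in LHS](vcompA (asV0 _ _ _)) hex0.
rewrite tm_tmap vcomp1m br_tmap -[d in RHS]vcompm1 -tmap_tm0.
rewrite [in RHS](vcompA (asV1 _ _ _)) asV1_tmap !vcompA tm_tmap br_tmap vcomp1m.
by rewrite -[b in RHS]vcompm1 -tmap_tm0.
Qed.

Definition union_bm : @braided_monoidal (full_sub C) V1 T :=
  @BraidedMonoidal (full_sub C) V1 T tm tm1 tmM lun run br as1 asV1
    lun_iso run_iso br_iso as1_inv lun_nat run_nat br_nat as1_nat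
    as1_pentagon as1_triangle br_hexagon1 br_hexagon2.

(** * The defining formulas of the vertex algebraic structure *)

Lemma C_reach (A : subob C) (x : A) :
  exists (A0 : subob C0) (f : vhom A0 A) (a : A0), x = f a.
Proof.
have [A0 [f [a [CA ->]]]] := (unionP C0_quot A).1 (subobP A) x.
by exists (Subob CA), f, a.
Qed.

Lemma union_tmorE (A A' B B' : subob C) (f : vhom A A') (g : vhom B B') (a : A) (b : B) e k :
  (@tmor (full_sub C) _ _ union_bm A A' B B' f g : vhom _ _) (Y a b e k) =
  Y (f a) (g b) e k.
Proof. exact: tmE. Qed.

Lemma union_lunitE (A : subob C) (v : V) (a : A) e k :
  (lunit union_bm A : vhom _ _) (@Y V1 A v a e k) = mod_series v a e k.
Proof.
have [A0 [f [x ->]]] := C_reach a.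
have := tmapE inV f v x e k; rewrite -[inV v]/v => <-.
rewrite -[LHS]/((lun A \@ tmap inV f) _) lun_tmap tm01 vcompm1.
rewrite -mod_series_vhom; congr (f _); exact: (hlz_lunitE S0).
Qed.

Lemma union_runitE (A : subob C) (v : V) (a : A) e k :
  (runit union_bm A : vhom _ _) (@Y A V1 a v e k) =
  fser_exp_xL (mod_series_neg v a) e k.
Proof.
have [A0 [f [x ->]]] := C_reach a.
have := tmapE f inV x v e k; rewrite -[inV v]/v => <-.
rewrite -[LHS]/((run A \@ tmap f inV) _) run_tmap tm01 vcompm1.
have -> : mod_series_neg v (f x) = (fun e k => f (mod_series_neg v x e k)).
  by apply/funext => e'; apply/funext => k'; rewrite mod_series_neg_vhom.
rewrite -[RHS](fser_exp_xL_vhom f (s := mod_series_neg v x)).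
  by congr (f _); exact: (hlz_runitE S0).
by have [K KP] := mod_series_neg_trunc v x e; exists K => j /KP.
Qed.

Lemma union_braidE (A B : subob C) (a : A) (b : B) e k :
  (braid union_bm A B : vhom _ _) (Y a b e k) = fser_exp_xL (fser_rot (Y b a)) e k.
Proof.
have [A0 [f [x ->]]] := C_reach a; have [B0 [g [y ->]]] := C_reach b.
rewrite -(tmapE f g) -[LHS]/((br A B \@ tmap f g) _) br_tmap.
have -> : Y (g y) (f x) = (fun e k => tmap g f (Y0 B0 A0 y x e k)) :> fser _.
  by apply/funext => e'; apply/funext => k'; rewrite tmapE.
rewrite -[RHS](skew_vhom (Y0 B0 A0) (tmap g f)).
by congr (tmap g f _); exact: (hlz_braidE S0).
Qed.

(** The three vectors come from objects of [C0], where both sides converge; the limits are carried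
    over by the comparison maps, which intertwine products, iterates and associativity. *)
Lemma union_assocE (A B D : subob C) (a : A) (b : B) (d : D) (r1 r2 : R) :
  r2 < r1 -> r1 - r2 < r2 -> 0 < r1 - r2 ->
  exists z1 z2,
    [/\ compl_sum (itw_product (@Y A (T B D)) (@Y B D) a b d r1 r2) z1,
        compl_sum (itw_iterate (@Y (T A B) D) (@Y A B) a b d (r1 - r2) r2) z2 &
        forall h, (assoc union_bm A B D : vhom _ _) (z1 h) = z2 h].
Proof.
move=> r12 r122 r0; have [A0 [f [x ->]]] := C_reach a.
have [B0 [g [y ->]]] := C_reach b; have [D0 [h [z ->]]] := C_reach d.
have [z1 [z2 [s1 s2 E]]] := hlz_assocE S0 x y z r12 r122 r0.
exists (fun w => tmap f (tmap g h) (z1 w)), (fun w => tmap (tmap f g) h (z2 w)); split.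
- rewrite (_ : itw_product _ _ _ _ _ _ _ = fun w w' =>
    tmap f (tmap g h) (itw_product (Y0 A0 (T0 B0 D0)) (Y0 B0 D0) x y z r1 r2 w w')).
    exact: compl_sum_vhom.
  apply/funext => w; apply/funext => w'.
  by apply: (itw_product_vhom (p := tmap g h)) => *; rewrite tmapE.
- rewrite (_ : itw_iterate _ _ _ _ _ _ _ = fun w w' =>
    tmap (tmap f g) h (itw_iterate (Y0 (T0 A0 B0) D0) (Y0 A0 B0) x y z (r1 - r2) r2 w w')).
    exact: compl_sum_vhom.
  apply/funext => w; apply/funext => w'.
  by apply: (itw_iterate_vhom (p := tmap f g)) => *; rewrite tmapE.
- move=> w; rewrite -E -[LHS]/((as1 A B D \@ tmap f (tmap g h)) _) as1_tmap.
  by [].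
Qed.

Definition union_hlz : hlz_structure C :=
  @Hlz R V C (sub_union_closure (hlz_V S0)) T (@Y) T_univ union_bm union_tmorE
    union_lunitE union_runitE union_braidE union_assocE.

(** * The inclusion of C0 as a braided monoidal functor *)

Let K (A : subob C0) : subob C := Subob (sub_union_closure (subobP A)).

(** The chosen tensor product need not restrict to that of [C0] on the nose. Both are universal for
    targets in the closure, and the inverse of [j] is [tmap] at identities. *)
Lemma incl_tens_ex (A B : subob C0) : exists j : vhom (T (K A) (K B)) (T0 A B),
  (forall a b e k, j (Y a b e k) = Y0 A B a b e k) /\ exists g, vinv j g.
Proof.
have [j jE] := T_lift_ex (A := K A) (B := K B) (Y0 A B) (subobP (K (T0 A B))).
exists j; split=> //; exists (tmap (vhom_id A : vhom A (K A)) (vhom_id B : vhom B (K B))).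
split; first by apply: T_hom_eq => a b e k; rewrite /= jE tmapE.
by apply: T0_hom_eq => a b e k; rewrite /= tmapE jE.
Qed.

Definition incl_tens (A B : subob C0) : vhom (T (K A) (K B)) (T0 A B) :=
  sval (cid (incl_tens_ex A B)).

Lemma incl_tensE (A B : subob C0) a b e k :
  incl_tens A B (Y a b e k) = Y0 A B a b e k.
Proof. exact: (svalP (cid (incl_tens_ex A B))).1. Qed.

Lemma incl_tens_iso (A B : subob C0) : exists g, vinv (incl_tens A B) g.
Proof. exact: (svalP (cid (incl_tens_ex A B))).2. Qed.

Lemma incl_tens_tmap (A B A0 B0 : subob C0) (a : vhom A0 (K A)) (b : vhom B0 (K B)) :
  incl_tens A B \@ tmap a b = tm0 (a : vhom A0 A) (b : vhom B0 B).
Proof. by apply: T0_hom_eq => x y e k; rewrite /= tmapE incl_tensE tm0E. Qed.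

Lemma incl_braided : braided_monoidal_functor (hlz_bm S0) (hlz_bm union_hlz)
  (full_sub_incl (@sub_union_closure R V C0)).
Proof.
exists inV, incl_tens; split; first by exists (vhom_id _); split; apply: vhomP.
split; first by move=> A B; have [g [gl gr]] := incl_tens_iso A B; exists g.
split.
- move=> A A' B B' f g; apply: (@T_hom_eq (K A) (K B)) => a b e k.
  (* Here and below, compositions in the categories are restated by conversion as compositions of
     module maps. *)
  rewrite -[LHS]/(incl_tens A' B'
    (tm (f : vhom (K A) (K A')) (g : vhom (K B) (K B')) (Y a b e k))).
  rewrite -[RHS]/(tm0 f g (incl_tens A B (Y a b e k))).
  by rewrite tmE !incl_tensE tm0E.
- move=> A B D; apply: (@hom_eq3l (K A) (K B) (K D)) => A0 B0 D0 a b d.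
  rewrite -[X in X \@ _ = _]/(as0 A B D \@ incl_tens A (T0 B D) \@
    tm (vhom_id (K A)) (incl_tens B D : vhom _ (K (T0 B D)))).
  rewrite -[X in _ = X \@ _]/(incl_tens (T0 A B) D \@
    tm (incl_tens A B : vhom _ (K (T0 A B))) (vhom_id (K D)) \@ as1 (K A) (K B) (K D)).
  rewrite -!vcompA as1_tmap (vcompA (tm _ _)) !tm_tmap !vcomp1m.
  rewrite [incl_tens B D \@ _]incl_tens_tmap [incl_tens A B \@ _]incl_tens_tmap.
  by rewrite [RHS]vcompA !incl_tens_tmap as0_nat.
- move=> A; apply: (@hom_eq2 V1 (K A)) => X0 A0 x a.
  rewrite -[LHS]/(lun0 A \@ incl_tens V0 A \@
    tm (inV : vhom V1 (K V0)) (vhom_id (K A)) \@ tmap x a).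
  rewrite -[RHS]/(lun (K A) \@ tmap x a) lun_tmap.
  rewrite -!vcompA tm_tmap !vcomp1m incl_tens_tmap vcompA.
  by rewrite -lun0_nat -vcompA -tm0M vcomp1m vcompm1.
- move=> A; apply: (@hom_eq2 (K A) V1) => A0 X0 a x.
  rewrite -[LHS]/(run0 A \@ incl_tens A V0 \@
    tm (vhom_id (K A)) (inV : vhom V1 (K V0)) \@ tmap a x).
  rewrite -[RHS]/(run (K A) \@ tmap a x) run_tmap.
  rewrite -!vcompA tm_tmap !vcomp1m incl_tens_tmap vcompA.
  by rewrite -run0_nat -vcompA -tm0M vcomp1m vcompm1.
- move=> A B; apply: (@hom_eq2 (K A) (K B)) => A0 B0 a b.
  rewrite -[X in X \@ _ = _]/(br0 A B \@ incl_tens A B).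
  rewrite -[X in _ = X \@ _]/(incl_tens B A \@ br (K A) (K B)).
  by rewrite -!vcompA br_tmap incl_tens_tmap vcompA incl_tens_tmap br0_nat.
Qed.

(** * Cocontinuity in each factor *)

Lemma ltensor_cocontinuous (W : full_sub C) : cocontinuous (ltensor (hlz_bm union_hlz) W).
Proof.
move=> J Js F L i iL.
have lc := colimit_lin_colimit C0_coprod C0_quot (hlz_V S0) Js iL.
split=> [j k u|L' i' i'c].
  rewrite -[LHS]/(tm (vhom_id (W : subob C)) (i k) \@ tm (vhom_id (W : subob C)) (fmor F u)).
  rewrite -tmM vcomp1m; congr tm; exact: (iL.1 j k u).
pose Z (j : J) : vhom (T W (F j)) (L' : subob C) := i' j.
(* The cocone amounts to a compatible family of intertwining operators on [W] and the [F j]; gluing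
   them gives one operator on [W] and [L], hence the map sought. *)
have [||Y3 Y3E] := glue_itw (lin_colimit_point (W : subob C)) lc
  (J := fun _ j => itw_post (Z j) (@Y W (F j))).
- by [].
- move=> _ j k _ [u ->] w x e n.
  transitivity (Z k (tm (vhom_id (W : subob C)) (fmor F u) (Y w x e n))).
    by rewrite tmE.
  exact: (congr1 (fun h : vhom (T W (F j)) (L' : subob C) => h _) (i'c j k u)).
have [h hE] := T_lift_ex Y3 (subobP L').
(* Uniqueness: any map compatible with the cocone must induce the glued operator. *)
have tmiE (f : vhom (T W L) (L' : subob C)) :
    (forall j, f \@ tm (vhom_id (W : subob C)) (i j) = Z j) ->
    forall w x e n, f (Y w x e n) = Y3 w x e n.
  move=> fE w x e n; move: w x.
  apply: (bilin_colimit_ind (lin_colimit_point (W : subob C)) lc) => [x|w|[] j w x].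
  - split=> [|c y y' yE yE']; first by rewrite !(lin0 (itw_linl _ _ _ _)) vhom0.
    by rewrite !itw_linl vhom_linear yE yE'.
  - split=> [|c y y' yE yE']; first by rewrite !(lin0 (itw_linr _ _ _ _)) vhom0.
    by rewrite !itw_linr vhom_linear yE yE'.
  - transitivity (Z j (Y w x e n)); last exact: esym (Y3E tt j w x e n).
    rewrite -fE -[RHS]/(f (tm (vhom_id (W : subob C)) (i j) (Y w x e n))).
    by rewrite tmE.
exists h; split=> [j|g gE].
  apply: (@T_hom_eq W (F j)) => w x e n.
  rewrite -[LHS]/(h (tm (vhom_id (W : subob C)) (i j) (Y w x e n))) tmE hE.
  exact: (Y3E tt).
by apply: (@T_hom_eq W L) => w x e n; rewrite hE tmiE.
Qed.

Lemma rtensor_cocontinuous (W : full_sub C) : cocontinuous (rtensor (hlz_bm union_hlz) W).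
Proof.
move=> J Js F L i iL.
have lc := colimit_lin_colimit C0_coprod C0_quot (hlz_V S0) Js iL.
split=> [j k u|L' i' i'c].
  rewrite -[LHS]/(tm (i k) (vhom_id (W : subob C)) \@ tm (fmor F u) (vhom_id (W : subob C))).
  rewrite -tmM vcomp1m; congr (tm _ _); exact: (iL.1 j k u).
pose Z (j : J) : vhom (T (F j) W) (L' : subob C) := i' j.
have [||Y3 Y3E] := glue_itw lc (lin_colimit_point (W : subob C))
  (J := fun j _ => itw_post (Z j) (@Y (F j) W)).
- move=> j k _ _ [u ->] x w e n.
  transitivity (Z k (tm (fmor F u) (vhom_id (W : subob C)) (Y x w e n))).
    by rewrite tmE.
  exact: (congr1 (fun h : vhom (T (F j) W) (L' : subob C) => h _) (i'c j k u)).
- by [].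
have [h hE] := T_lift_ex Y3 (subobP L').
have tmiE (f : vhom (T L W) (L' : subob C)) :
    (forall j, f \@ tm (i j) (vhom_id (W : subob C)) = Z j) ->
    forall x w e n, f (Y x w e n) = Y3 x w e n.
  move=> fE x w e n; move: x w.
  apply: (bilin_colimit_ind lc (lin_colimit_point (W : subob C))) => [w|x|j [] x w].
  - split=> [|c y y' yE yE']; first by rewrite !(lin0 (itw_linl _ _ _ _)) vhom0.
    by rewrite !itw_linl vhom_linear yE yE'.
  - split=> [|c y y' yE yE']; first by rewrite !(lin0 (itw_linr _ _ _ _)) vhom0.
    by rewrite !itw_linr vhom_linear yE yE'.
  - transitivity (Z j (Y x w e n)); last exact: esym (Y3E j tt x w e n).
    rewrite -fE -[RHS]/(f (tm (i j) (vhom_id (W : subob C)) (Y x w e n))).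
    by rewrite tmE.
exists h; split=> [j|g gE].
  apply: (@T_hom_eq (F j) W) => x w e n.
  rewrite -[LHS]/(h (tm (i j) (vhom_id (W : subob C)) (Y x w e n))) tmE hE.
  exact: (Y3E j tt).
by apply: (@T_hom_eq L W) => x w e n; rewrite hE tmiE.
Qed.

End Tensor.

Theorem theorem6p8 (R : realType) (V : voa R) (C0 : gmod V -> Prop)
    (C0_small : ess_small (full_sub C0))
    (C0_coprod : closed_fin_coproducts C0)
    (C0_quot : closed_quotients C0)
    (S0 : hlz_structure C0)
    (C0_image : forall M1 M2 M3 : gmod V, C0 M1 -> C0 M2 ->
      union_closure C0 M3 -> forall Y : intertwining M1 M2 M3,
      exists U, submodule_in C0 U /\ (forall x, itw_image Y x -> U x))
    (C0_fg : forall M, C0 M -> finitely_generated M) :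
  additive_category (full_sub (union_closure C0)) /\
  cocomplete (full_sub (union_closure C0)) /\
  exists S : hlz_structure (union_closure C0),
    braided_monoidal_functor (hlz_bm S0) (hlz_bm S)
      (full_sub_incl (@sub_union_closure R V C0)) /\
    forall W : full_sub (union_closure C0),
      cocontinuous (ltensor (hlz_bm S) W) /\
      cocontinuous (rtensor (hlz_bm S) W).
Proof.
have C0_V := hlz_V S0.
split; first exact: (union_additive C0_coprod C0_quot C0_V).
split; first exact: (union_cocomplete C0_coprod C0_quot C0_V).
(* One tensor product is chosen for every pair of objects; the constructions above hold for any such
   choice. *)
pose tens A B := cid (tensor_exists C0_coprod C0_quot S0 C0_image A B).
pose Y A B := cid (svalP (tens A B)).
pose T_univ A B := svalP (Y A B).
exists (union_hlz C0_coprod C0_quot S0 C0_image T_univ).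
split; first exact: incl_braided.
by move=> W; split; [exact: ltensor_cocontinuous|exact: rtensor_cocontinuous].
Qed.
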